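(* Let $\mathbb{H},\mathbb{U}$ be Hilbert spaces, let $(A,\mathcal{D}(A))$ be the infinitesimal generator of a strongly continuous group on $\mathbb{H}$, and let $B\in\mathcal{L}(\mathbb{U},\mathcal{D}(A^* )')$ be an admissible control operator. Assume that the control system $y'=Ay+Bu$ is exactly controllable in some positive time. Then the system $y'=Ay+Bu$ is rapidly (statically) stabilizable in the trajectory sense.
   Context: Notation. $e^{tA}$, $t\in\mathbb{R}$, is the group generated by $A$; $A^*$ is the adjoint of $A$ and generates the group $e^{tA^*}=(e^{tA})^*$. $\mathcal{D}(A^* )$ carries the graph scalar product, and $\mathcal{D}(A^* )'$ is its dual with respect to the pivot space $\mathbb{H}$. $B^*\in\mathcal{L}(\mathcal{D}(A^* ),\mathbb{U})$ is the adjoint of $B$: $\langle Bu,\varphi\rangle=\langle u,B^*\varphi\rangle_{\mathbb{U}}$. Admissibility: for every $T>0$ and $u\in L^2((0,T);\mathbb{U})$, the function $t\mapsto\int_0^te^{(t-s)A}Bu(s)\,ds$ (computed in $\mathcal{D}(A^* )'$) belongs to $C([0,T];\mathbb{H})$. Weak solution of $y'=Ay+Bu$, $y(0)=y_0$ ($u\in L^2((0,T);\mathbb{U})$): the unique $y\in C([0,T];\mathbb{H})$ with $y(0)=y_0$ and $\frac{d}{dt}\langle y,\varphi\rangle_{\mathbb{H}}=\langle y,A^*\varphi\rangle_{\mathbb{H}}+\langle u,B^*\varphi\rangle_{\mathbb{U}}$ in the distributional sense on $(0,T)$ for all $\varphi\in\mathcal{D}(A^* )$. Exact controllability in time $T>0$: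 for all $y_0,y_T\in\mathbb{H}$ there is $u\in L^2((0,T);\mathbb{U})$ such that the weak solution satisfies $y(T)=y_T$. A symmetric bounded operator $K$ is non-negative if $\langle Kx,x\rangle\ge0$ for all $x$, and positive if there is $c>0$ with $\langle Kx,x\rangle\ge c\|x\|^2$ for all $x$. Rapid static stabilizability in the trajectory sense (the feedback ''$u=-WB^*Q^{-1}y$'' is given a meaning along trajectories only): for every $\nu>0$ there exist $\lambda\in\mathbb{R}$, a symmetric, positive, invertible $Q\in\mathcal{L}(\mathbb{H})$, symmetric non-negative $R\in\mathcal{L}(\mathbb{H})$ and $W\in\mathcal{L}(\mathbb{U})$, and $C>0$, such that for every $y_0\in\mathbb{H}$ the weak solution $(y,\tilde y)$ of $$y'=Ay-BWB^*\tilde y,\quad\tilde y'=-A^*\tilde y-2\lambda\tilde y-RQ\tilde y\ \text{ in }(0,+\infty),\qquad y(0)=y_0,\ \tilde y(0)=Q^{-1}y_0$$ satisfies $\tilde y(t)=Q^{-1}y(t)$ and $\|y(t)\|_{\mathbb{H}}\le Ce^{-\nu t}\|y_0\|_{\mathbb{H}}$ for all $t\ge0$. Here $\tilde y\in C([0,\infty);\mathbb{H})$ solves $\tilde y(t)=e^{-tA^*}\tilde y(0)+\int_0^te^{-(t-s)A^*}h(s)\,ds$ with $h=-2\lambda\tilde y-RQ\tilde y$; $B^*\tilde y\in L^2((0,T);\mathbb{U})$ is the value at $(\tilde y(0),h)$ of the unique continuous extension to $\mathbb{H}\times L^1((0,T);\mathbb{H})$ of the map sending $(\tilde y_0,h)\in\mathcal{D}(A^*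 )\times C([0,T];\mathcal{D}(A^* ))$ to $B^*$ applied to the solution of $\tilde y'=-A^*\tilde y+h$, $\tilde y(0)=\tilde y_0$ (it exists by admissibility); and $y$ is the weak solution of $y'=Ay+Bu$, $y(0)=y_0$, with $u=-WB^*\tilde y$, on $[0,T]$ for every $T>0$. *)

(* Defs.v *)
From HB Require Import structures.
From mathcomp Require Import all_boot all_order all_algebra.
From mathcomp Require Import complex.
From mathcomp Require Import all_classical all_reals all_analysis.

Set Implicit Arguments.
Unset Strict Implicit.
Unset Printing Implicit Defensive.

Import Order.TTheory GRing.Theory Num.Theory.
Import numFieldNormedType.Exports.

Local Open Scope classical_set_scope.
Local Open Scope ring_scope.

(** * Scalars and Hilbert spaces

  Everything is done uniformly for real and for complex Hilbert spaces.  A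
  Hilbert space over K = R or R[i] is seen as a complete normed module over R
  (so that norms, limits and integrals are those of the library over the reals)
  equipped with a compatible scalar multiplication by K and with a K-valued
  inner product, linear in its first argument.  [Rcomplex R] is the library's
  R[i] with its structure of R-algebra. *)

Variant scalar_kind := RealScalars | ComplexScalars.

Definition scalar_field (R : realType) (k : scalar_kind) : lalgType R :=
  match k with RealScalars => R^o | ComplexScalars => Rcomplex R end.

Definition scalar_Re (R : realType) (k : scalar_kind) : scalar_field R k -> R :=
  match k return scalar_field R k -> R with
  | RealScalars => id | ComplexScalars => @complex.Re R end.

Definition scalar_Im (R : realType) (k : scalar_kind) : scalar_field R k -> R :=
  match k return scalar_field R k -> R with
  | RealScalars => fun=> 0 | ComplexScalars => @complex.Im R end.

(* for K = R the second argument is ignored *)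
Definition scalar_of (R : realType) (k : scalar_kind) : R -> R -> scalar_field R k :=
  match k return R -> R -> scalar_field R k with
  | RealScalars => fun a _ => a | ComplexScalars => @complex.Complex R end.

Definition scalar_conj (R : realType) (k : scalar_kind) (z : scalar_field R k) :
    scalar_field R k :=
  scalar_of k (scalar_Re z) (- scalar_Im z).

Definition modulus (R : realType) (k : scalar_kind) (z : scalar_field R k) : R :=
  Num.sqrt (scalar_Re z ^+ 2 + scalar_Im z ^+ 2).

HB.mixin Record isHilbert (R : realType) (k : scalar_kind) H
    of CompleteNormedModule R H := {
  act : scalar_field R k -> H -> H;
  inner : H -> H -> scalar_field R k;
  actA : forall a b x, act a (act b x) = act (a * b) x;
  actDr : forall a x y, act a (x + y) = act a x + act a y;
  actDl : forall a b x, act (a + b) x = act a x + act b x;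
  act_real : forall (r : R) x, act (r *: 1) x = r *: x;
  innerDl : forall x y z, inner (x + y) z = inner x z + inner y z;
  inner_actl : forall a x y, inner (act a x) y = a * inner x y;
  inner_conj : forall x y, inner y x = scalar_conj (inner x y);
  inner_norm : forall x, inner x x = (`|x| ^+ 2) *: 1
}.

#[short(type="hilbertType")]
HB.structure Definition Hilbert (R : realType) (k : scalar_kind) :=
  {H of CompleteNormedModule R H & isHilbert R k H}.

(** * Operators *)

Section Operators.
Context {R : realType} {k : scalar_kind}.
Implicit Types H U : hilbertType R k.

Definition klinear H U (f : H -> U) :=
  forall (a : scalar_field R k) (x y : H), f (act a x + y) = act a (f x) + f y.

Definition bounded_operator H U (f : H -> U) := klinear f /\ continuous f.

Definition symmetric_operator H (K : H -> H) :=
  forall x y : H, inner (K x) y = inner x (K y).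

Definition nonneg_operator H (K : H -> H) :=
  forall x : H, 0 <= scalar_Re (inner (K x) x).

Definition positive_operator H (K : H -> H) :=
  exists2 c : R, 0 < c &
    forall x : H, c * `|x| ^+ 2 <= scalar_Re (inner (K x) x).

(* An unbounded operator; the values of [app] outside [dom] are irrelevant. *)
Record operator H := Operator { dom : set H ; app :> H -> H }.

(* [xget] selects the unique [z] when the domain of [A] is dense. *)
Definition adjoint H (A : operator H) : operator H :=
  let adj (phi : H) : set H :=
    [set z | forall x, dom A x -> inner (A x) phi = inner x z] in
  Operator [set phi | adj phi !=set0] (fun phi => xget 0 (adj phi)).

Definition badjoint H (f : H -> H) : H -> H := adjoint (Operator setT f).

(* [S t] is e^{tA} *)
Definition strongly_continuous_group H (S : R -> H -> H) :=
  [/\ forall t, bounded_operator (S t),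
      S 0 = id,
      forall s t x, S (s + t) x = S s (S t x) &
      forall x, continuous (fun t => S t x)].

Definition generator H (S : R -> H -> H) (A : operator H) :=
  forall x z : H, (dom A x /\ A x = z) <->
    ((fun h : R => h^-1 *: (S h x - x)) @ 0^' --> z).

Definition graph_norm H (A : operator H) (x : H) : R :=
  Num.sqrt (`|x| ^+ 2 + `|A x| ^+ 2).

(** The space D(A)', for the pivot space H: continuous antilinear functionals
  on D(A), a point x of H being identified with <x, .>.  They are represented
  by functions on H whose values outside D(A) are irrelevant. *)

Definition dual_norm H (A : operator H) (f : H -> scalar_field R k) : \bar R :=
  ereal_sup [set (modulus (f phi))%:E |
    phi in [set phi | dom A phi /\ graph_norm A phi <= 1]].

Definition dual_space H (A : operator H) : set (H -> scalar_field R k) :=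
  [set f | (forall a phi psi, dom A phi -> dom A psi ->
              f (act a phi + psi) = scalar_conj a * f phi + f psi)
         /\ (dual_norm A f < +oo)%E].

Definition pivot H (x : H) : H -> scalar_field R k := fun phi => inner x phi.

(* [B] belongs to L(U, D(A)') *)
Definition bounded_to_dual H U (A : operator H) (B : U -> H -> scalar_field R k) :=
  [/\ forall u, dual_space A (B u),
      forall a u v phi, dom A phi ->
        B (act a u + v) phi = a * B u phi + B v phi &
      exists C : R, forall u, (dual_norm A (B u) <= (C * `|u|)%:E)%E].

(* Riesz: B^* phi is the w in U such that <B u, phi> = <u, w> for all u *)
Definition control_adjoint H U (B : U -> H -> scalar_field R k) (phi : H) : U :=
  xget 0 [set w : U | forall u, B u phi = inner u w].

End Operators.

(** * Vector-valued integration

  The target is the subspace [E] of [V] with norm [N]: for a Hilbert space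
  [E] is [setT]; for the dual of [dom (adjoint A)], [V] is H -> K and [N] is the
  dual norm.  Elements of L^p are represented by functions that are everywhere
  limits of simple functions with Borel fibres; any almost everywhere class has
  such a representative. *)

Section Bochner.
Context {R : realType} {V : lmodType R} (E : set V) (N : V -> \bar R).
Local Notation mu := (@lebesgue_measure R).

Definition simple_function (s : R -> V) :=
  [/\ forall t, E (s t), finite_set (range s) &
      forall v, measurable (s @^-1` [set v])].

Definition simple_integral (D : set R) (s : R -> V) : V :=
  \sum_(v \in range s) fine (mu (D `&` s @^-1` [set v])) *: v.

Definition strongly_measurable (D : set R) (f : R -> V) :=
  exists2 s : nat -> R -> V, forall n, simple_function (s n) &
    forall t, D t -> N (f t - s n t) @[n --> \oo] --> 0%E.

Definition bochner_integral (D : set R) (f : R -> V) (v : V) :=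
  strongly_measurable D f /\
  exists s : nat -> R -> V,
    [/\ forall n, simple_function (s n),
        (\int[mu]_(t in D) N (f t - s n t)%R)%E @[n --> \oo] --> 0%E &
        N (v - simple_integral D (s n)) @[n --> \oo] --> 0%E].

End Bochner.

Section ControlSystem.
Context {R : realType} {k : scalar_kind} {H U : hilbertType R k}.
Local Notation mu := (@lebesgue_measure R).

Definition enorm (X : hilbertType R k) (x : X) : \bar R := `|x|%:E.

Definition bochner (X : hilbertType R k) (D : set R) (f : R -> X) (v : X) :=
  bochner_integral setT (@enorm X) D f v.

Definition Lp_class (p : nat) (X : hilbertType R k) (T : R) : set (R -> X) :=
  [set f | strongly_measurable setT (@enorm X) `]0, T[ f /\
           (\int[mu]_(t in `]0%R, T[) (`|f t| ^+ p)%:E < +oo)%E].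

Definition scalar_integral (D : set R) (f : R -> scalar_field R k) : scalar_field R k :=
  scalar_of k (Rintegral mu D (fun t => scalar_Re (f t)))
              (Rintegral mu D (fun t => scalar_Im (f t))).

Definition test_function (T : R) (psi : R -> R) :=
  (forall n t, derivable (derive1n n psi) t 1) /\
  exists a b : R, [/\ 0 < a, b < T & forall t, psi t != 0 -> a <= t <= b].

Variables (S : R -> H -> H) (A : operator H) (B : U -> H -> scalar_field R k).

(* the adjoint of e^{tA}, generated by the adjoint of A *)
Definition adjoint_group (t : R) : H -> H := badjoint (S t).

(* the extension of e^{tA} to the dual of [dom (adjoint A)], by duality *)
Definition extended_group (t : R) (f : H -> scalar_field R k) : H -> scalar_field R k :=
  fun phi => f (adjoint_group t phi).

Definition admissible :=
  forall (T : R) (u : R -> U), 0 < T -> Lp_class 2 T u ->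
  exists2 y : R -> H, {within `[0, T], continuous y} &
    forall t, 0 <= t <= T ->
      bochner_integral (dual_space (adjoint A)) (dual_norm (adjoint A)) `]0, t[
        (fun s => extended_group (t - s) (B (u s))) (pivot (y t)).

Definition weak_solution (T : R) (u : R -> U) (y0 : H) (y : R -> H) :=
  [/\ Lp_class 2 T u,
      {within `[0, T], continuous y},
      y 0 = y0 &
      forall phi psi, dom (adjoint A) phi -> test_function T psi ->
        scalar_integral `]0, T[ (fun t => derive1 psi t *: inner (y t) phi) =
        - scalar_integral `]0, T[ (fun t => psi t *:
            (inner (y t) (adjoint A phi) +
             inner (u t) (control_adjoint B phi)))].

Definition exactly_controllable (T : R) :=
  forall y0 yT : H, exists u y, weak_solution T u y0 y /\ y T = yT.

(* mild solution on [0, T] of z' = - (adjoint A) z + h, z(0) = z0 *)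
Definition dual_solution (T : R) (z0 : H) (h : R -> H) (z : R -> H) :=
  {within `[0, T], continuous z} /\
  forall t, 0 <= t <= T ->
    bochner `]0, t[ (fun s => adjoint_group (- (t - s)) (h s))
      (z t - adjoint_group (- t) z0).

(* [g] is continuous on [0, T] for the graph norm of [adjoint A] *)
Definition continuous_graph (T : R) (g : R -> H) :=
  [/\ forall t, 0 <= t <= T -> dom (adjoint A) (g t),
      {within `[0, T], continuous g} &
      {within `[0, T], continuous (adjoint A \o g)}].

(* [E] is a continuous map from H x L^1((0,T); H) to L^2((0,T); U) extending
   (z0, g) |-> B^* z, where z' = - (adjoint A) z + g and z(0) = z0, defined for
   z0 in D = dom (adjoint A) and g in C([0,T]; D).  Continuity forces [E] to
   respect almost everywhere equality. *)
Definition trace_extension (T : R) (E : H -> (R -> H) -> R -> U) :=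
  [/\ forall z0 h, Lp_class 1 T h -> Lp_class 2 T (E z0 h),
      forall z0 h, Lp_class 1 T h -> forall eps : R, 0 < eps ->
        exists2 delta : R, 0 < delta & forall z1 h1, Lp_class 1 T h1 ->
          `|z1 - z0| < delta ->
          (\int[mu]_(t in `]0%R, T[) `|h1 t - h t|%:E < delta%:E)%E ->
          (\int[mu]_(t in `]0%R, T[) (`|E z1 h1 t - E z0 h t| ^+ 2)%:E
             < (eps ^+ 2)%:E)%E &
      forall z0 g z, dom (adjoint A) z0 -> continuous_graph T g ->
        dual_solution T z0 g z ->
        {ae mu, forall t, t \in `]0, T[ -> E z0 g t = control_adjoint B (z t)}].

(* [w] is the trace B^* z in L^2((0,T); U), z' = - (adjoint A) z + h, z(0) = z0 *)
Definition trace_value (T : R) (z0 : H) (h : R -> H) (w : R -> U) :=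
  [/\ Lp_class 1 T h, Lp_class 2 T w &
      exists2 E, trace_extension T E &
        {ae mu, forall t, t \in `]0, T[ -> w t = E z0 h t}].

(* y' = A y - B W B^* z, z' = - (adjoint A) z - 2 lambda z - P Q z *)
Definition closed_loop_solution (lambda : R) (Q P : H -> H) (W : U -> U)
    (y0 z0 : H) (y z : R -> H) :=
  let h t := - ((2 * lambda) *: z t) - P (Q (z t)) in
  [/\ z 0 = z0,
      forall T, 0 < T -> dual_solution T z0 h z &
      forall T, 0 < T -> exists2 w, trace_value T z0 h w &
        weak_solution T (fun t => - W (w t)) y0 y].

Definition rapidly_stabilizable :=
  forall nu : R, 0 < nu ->
  exists (lambda : R) (Q Qinv P : H -> H) (W : U -> U) (C : R),
  [/\ [/\ bounded_operator Q, symmetric_operator Q & positive_operator Q],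
      [/\ bounded_operator Qinv, cancel Q Qinv & cancel Qinv Q],
      [/\ bounded_operator P, symmetric_operator P & nonneg_operator P],
      [/\ bounded_operator W, symmetric_operator W & nonneg_operator W] &
      0 < C /\ forall y0 : H,
        (exists y z, closed_loop_solution lambda Q P W y0 (Qinv y0) y z) /\
        forall y z, closed_loop_solution lambda Q P W y0 (Qinv y0) y z ->
        forall t, 0 <= t ->
          z t = Qinv (y t) /\ `|y t| <= C * expR (- nu * t) * `|y0|].

End ControlSystem.

(* Main.v *)
Require Import Defs.
From HB Require Import structures.
From mathcomp Require Import all_boot all_order all_algebra.
From mathcomp Require Import complex.
From mathcomp Require Import all_classical all_reals all_analysis.
From mathcomp Require Import measurable_realfun ring lra.
Set Implicit Arguments.
Unset Strict Implicit.
Unset Printing Implicit Defensive.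
Import Order.TTheory GRing.Theory Num.Theory.
Import numFieldNormedType.Exports.
Local Open Scope classical_set_scope.
Local Open Scope ring_scope.

(** Write V(t) = e^{-tA^*}.  The feedback comes from the Gramian of the dual system,
  weighted on the half-line: for l larger than the growth exponent w of the group,

    <Q phi, psi> = int_0^oo e^{-2lt} <B^* V(t) phi, B^* V(t) psi> dt.

  Admissibility bounds the integral over [0, 1], and translations by n cost a factor
  e^{-2(l-w)n}, so that Q is a bounded symmetric operator ([gramian_exists]).  Exact
  controllability is dual to observability ([observability]), which makes Q positive
  ([gramian_positive]), hence invertible.  Differentiating e^{-2ls} <Q V(s) phi, V(s) psi>
  at s = 0 gives the Lyapunov identity ([gramian_lyapunov])

    <Q A^* phi, psi> + <Q phi, A^* psi> + 2 l <Q phi, psi> = <B^* phi, B^* psi>.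

  The theorem holds with lambda = l, W = id and no quadratic term, that is, R = 0.  The
  equation of z is then decoupled from that of y, and its solution is
  z(t) = e^{-2lt} V(t) z0 ([damped_unique]).  By the Lyapunov identity y = Q z solves
  y' = A y - B B^* z ([trace_weak_solution]), and weak solutions are unique
  ([weak_solution_unique]).  The decay of z is at least of order e^{-(2l-w)t}, and
  l = w + nu is large enough.

  Three points need work.  Weak solutions are defined by test functions: the lemma of du
  Bois-Reymond and an increment argument lead to the duality formula between controls and
  observations ([weak_solution_duality]), the source of uniqueness and of observability.
  The inequalities behind admissibility and observability are uniform boundedness
  principles, in L^2 and in H ([L2_uniform_boundedness], [weakly_bounded]).  Finally the
  trace B^* z is defined through a continuous extension.  The energy <Q z, z> gives a
  Lipschitz bound for regular data ([mild_trace_bound]); as these are dense, an extension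
  exists ([trace_extension_exists]), and any extension agrees with the limit of the traces
  of regular solutions ([trace_value_limit]).

  All estimates use the real inner product [ip], the real part of the given one; imaginary
  parts are recovered by replacing a vector with its multiple by i. *)

(** * Scalars and the real inner product *)

Section Scalars.
Context {R : realType} {k : scalar_kind}.
Implicit Types a b : scalar_field R k.

Lemma scalar_ReD a b : scalar_Re (a + b) = scalar_Re a + scalar_Re b.
Proof. by case: k a b => //= -[? ?] [? ?]. Qed.

Lemma scalar_ImD a b : scalar_Im (a + b) = scalar_Im a + scalar_Im b.
Proof. by case: k a b => /= [? ?|[? ?] [? ?]]; rewrite ?addr0. Qed.

Lemma scalar_Re_real (r : R) : scalar_Re (r *: 1 : scalar_field R k) = r.
Proof. by case: k; rewrite /GRing.scale /= ?mulr1 ?mulr0 ?subr0. Qed.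

Lemma scalar_Im_real (r : R) : scalar_Im (r *: 1 : scalar_field R k) = 0.
Proof. by case: k => //; rewrite /GRing.scale /= mulr0. Qed.

Lemma scalar_ReM a b :
  scalar_Re (a * b) = scalar_Re a * scalar_Re b - scalar_Im a * scalar_Im b.
Proof. by case: k a b => /= [? ?|[? ?] [? ?]]; rewrite ?mulr0 ?subr0. Qed.

Lemma scalar_ImM a b :
  scalar_Im (a * b) = scalar_Re a * scalar_Im b + scalar_Im a * scalar_Re b.
Proof. by case: k a b => /= [? ?|[? ?] [? ?]]; rewrite ?mulr0 ?mul0r ?addr0. Qed.

Lemma scalar_Re_conj a : scalar_Re (scalar_conj a) = scalar_Re a.
Proof. by case: k a. Qed.

Lemma scalar_Im_conj a : scalar_Im (scalar_conj a) = - scalar_Im a.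
Proof. by case: k a => //= a; rewrite oppr0. Qed.

Lemma scalar_eq a b :
  scalar_Re a = scalar_Re b -> scalar_Im a = scalar_Im b -> a = b.
Proof. by case: k a b => //= -[? ?] [? ?] /= -> ->. Qed.

(** It is 0 over R, so that statements about imaginary parts hold trivially there. *)
Definition imaginary_unit : scalar_field R k := scalar_of k 0 1.

Lemma scalar_Re_i : scalar_Re imaginary_unit = 0.
Proof. by rewrite /imaginary_unit; case: k. Qed.

(** Stated as a product because the left factor is 1 over R[i] and 0 over R, where
  imaginary parts vanish. *)
Lemma scalar_Im_i a : scalar_Im imaginary_unit * scalar_Im a = scalar_Im a.
Proof. by rewrite /imaginary_unit; case: k a => /= a; rewrite ?mul0r ?mul1r. Qed.

Lemma scalar_ofK x y : scalar_Re (scalar_of k x y) = x :> R.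
Proof. by case: k. Qed.

Lemma scalar_of_inj (x x' y y' : R) : x = x' -> y = y' ->
  scalar_of k x y = scalar_of k x' y'.
Proof. by move=> -> ->. Qed.

End Scalars.
Arguments imaginary_unit {R k}.

Section RealInner.
Context {R : realType} {k : scalar_kind} {H : hilbertType R k}.
Implicit Types x y z : H.

(** The real inner product determines the K-valued one by [inner_eq], so that the
  analysis can be done with real numbers only. *)
Definition ip x y : R := scalar_Re (inner x y).

Lemma ipC x y : ip x y = ip y x.
Proof. by rewrite /ip inner_conj scalar_Re_conj. Qed.

Lemma ipDl x y z : ip (x + y) z = ip x z + ip y z.
Proof. by rewrite /ip innerDl scalar_ReD. Qed.

Lemma ipDr x y z : ip z (x + y) = ip z x + ip z y.
Proof. by rewrite ipC ipDl ![ip _ z]ipC. Qed.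

Lemma ipZl (r : R) x y : ip (r *: x) y = r * ip x y.
Proof.
by rewrite /ip -act_real inner_actl scalar_ReM scalar_Re_real scalar_Im_real
  mul0r subr0.
Qed.

Lemma ipZr (r : R) x y : ip x (r *: y) = r * ip x y.
Proof. by rewrite ipC ipZl ipC. Qed.

Lemma ip0l x : ip 0 x = 0.
Proof. by rewrite -(scale0r (0 : H)) ipZl mul0r. Qed.

Lemma ip0r x : ip x 0 = 0. Proof. by rewrite ipC ip0l. Qed.

Lemma ipNl x y : ip (- x) y = - ip x y.
Proof. by rewrite -scaleN1r ipZl mulN1r. Qed.

Lemma ipNr x y : ip x (- y) = - ip x y.
Proof. by rewrite ipC ipNl ipC. Qed.

Lemma ipBl x y z : ip (x - y) z = ip x z - ip y z.
Proof. by rewrite ipDl ipNl. Qed.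

Lemma ipBr x y z : ip z (x - y) = ip z x - ip z y.
Proof. by rewrite ipDr ipNr. Qed.

Lemma ip_norm x : ip x x = `|x| ^+ 2.
Proof. by rewrite /ip inner_norm scalar_Re_real. Qed.

Lemma ip_CS x y : `|ip x y| <= `|x| * `|y|.
Proof.
have pos (r : R) : 0 <= `|x| ^+ 2 - 2 * r * ip x y + r ^+ 2 * `|y| ^+ 2.
  have := sqr_ge0 `|x - r *: y|; rewrite -(ip_norm (_ - _)) ipBl !ipBr !ipZl !ipZr !ip_norm.
  by rewrite [ip y x]ipC; congr (0 <= _); ring.
have [->|y0] := eqVneq y 0; first by rewrite ip0r !normr0 mulr0.
rewrite -(@ler_pXn2r _ 2) ?nnegrE ?mulr_ge0// real_normK ?num_real//.
have ny : 0 < `|y| ^+ 2 by rewrite exprn_gt0 ?normr_gt0.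
have := pos (ip x y / `|y| ^+ 2); set n := `|y| ^+ 2 in ny *.
have -> : `|x| ^+ 2 - 2 * (ip x y / n) * ip x y + (ip x y / n) ^+ 2 * n =
   (`|x| ^+ 2 * n - ip x y ^+ 2) / n by field; rewrite gt_eqF.
by rewrite pmulr_lge0 ?invr_gt0// subr_ge0 exprMn.
Qed.

Lemma ip_eq0 x : (forall y, ip y x = 0) -> x = 0.
Proof.
by move=> /(_ x)/eqP; rewrite ip_norm sqrf_eq0 normr_eq0 => /eqP.
Qed.

Lemma ip_inj x y : (forall z, ip z x = ip z y) -> x = y.
Proof.
by move=> h; apply/eqP; rewrite -subr_eq0; apply/eqP/ip_eq0 => z; rewrite ipBr h subrr.
Qed.

Lemma norm_le_ip x (c : R) : 0 <= c ->
  (forall y, ip y x <= c * `|y|) -> `|x| <= c.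
Proof.
move=> c0 h; have [->|x0] := eqVneq x 0; first by rewrite normr0.
have nx : 0 < `|x| by rewrite normr_gt0.
by have := h x; rewrite ip_norm expr2 ler_pM2r.
Qed.

Lemma ip_act (a : scalar_field R k) x y :
  ip (act a x) y = ip x (act (scalar_conj a) y).
Proof.
rewrite [RHS]ipC /ip !inner_actl (inner_conj x y) !scalar_ReM !scalar_Re_conj.
by rewrite !scalar_Im_conj mulrNN.
Qed.

Lemma scalar_conjK (a : scalar_field R k) : scalar_conj (scalar_conj a) = a.
Proof. by apply: scalar_eq; rewrite ?scalar_Re_conj// !scalar_Im_conj opprK. Qed.

Lemma ip_actr (a : scalar_field R k) x y :
  ip x (act a y) = ip (act (scalar_conj a) x) y.
Proof. by rewrite ip_act scalar_conjK. Qed.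

(** <x, i y> = - i <x, y>, and the real part of - i c is the imaginary part of c. *)
Lemma Im_inner x y : scalar_Im (inner x y) = ip x (act imaginary_unit y).
Proof.
rewrite ipC /ip inner_actl scalar_ReM scalar_Re_i mul0r sub0r scalar_Im_i.
by rewrite (inner_conj x y) scalar_Im_conj opprK.
Qed.

Lemma inner_eq (H' : hilbertType R k) x y (x' y' : H') :
  ip x y = scalar_Re (inner x' y') ->
  ip x (act imaginary_unit y) = scalar_Im (inner x' y') ->
  inner x y = inner x' y'.
Proof. by move=> h1 h2; apply: scalar_eq => //; rewrite Im_inner. Qed.

Lemma act1 x : act 1 x = x.
Proof. by rewrite -[in RHS](scale1r x) -act_real scale1r. Qed.

Lemma act0 (a : scalar_field R k) : act a 0 = 0 :> H.
Proof. by apply: (addIr (act a 0)); rewrite -actDr !add0r. Qed.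

End RealInner.

Section NormIp.
Context {R : realType} {k : scalar_kind} {H : hilbertType R k}.
Implicit Types x y z : H.

Lemma normD_sqr x y : `|x + y| ^+ 2 = `|x| ^+ 2 + 2 * ip x y + `|y| ^+ 2.
Proof. by rewrite -!ip_norm ipDl !ipDr [ip y x]ipC; ring. Qed.

Lemma normB_sqr x y : `|x - y| ^+ 2 = `|x| ^+ 2 - 2 * ip x y + `|y| ^+ 2.
Proof. by rewrite normD_sqr ipNr normrN; ring. Qed.

Lemma ip_AMGM x y : 2 * ip x y <= `|x| ^+ 2 + `|y| ^+ 2.
Proof. by have := sqr_ge0 `|x - y|; rewrite normB_sqr; lra. Qed.

Lemma ip_le x y : ip x y <= `|x| * `|y|.
Proof. exact: le_trans (ler_norm _) (ip_CS x y). Qed.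

Lemma norm_act (a : scalar_field R k) x : `|act a x| ^+ 2 = modulus a ^+ 2 * `|x| ^+ 2.
Proof.
rewrite -ip_norm ip_act actA ipC /ip inner_actl inner_norm scalar_ReM.
rewrite scalar_Re_real scalar_Im_real mulr0 subr0; congr (_ * _).
rewrite scalar_ReM scalar_Re_conj scalar_Im_conj /modulus sqr_sqrtr ?addr_ge0 ?sqr_ge0//.
ring.
Qed.

Lemma cvg_ip {T : Type} {F : set_system T} {FF : Filter F} (f g : T -> H) x y :
  f @ F --> x -> g @ F --> y -> ip (f t) (g t) @[t --> F] --> ip x y.
Proof.
move=> fx gy.
have -> : (fun t => ip (f t) (g t)) =
  (fun t => ip (f t - x) (g t - y) + ip (f t - x) y + ip x (g t)).
  by apply/funext => t; rewrite !ipBl !ipBr; ring.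
have z1 : `|f t - x| @[t --> F] --> (0 : R).
  rewrite -(normr0 H); apply: cvg_norm.
  by rewrite -(subrr x); apply: cvgB => //; exact: cvg_cst.
have z2 : `|g t - y| @[t --> F] --> (0 : R).
  rewrite -(normr0 H); apply: cvg_norm.
  by rewrite -(subrr y); apply: cvgB => //; exact: cvg_cst.
have lin (u : T -> H) w v : `|u t - w| @[t --> F] --> (0 : R) ->
    ip (u t - w) v @[t --> F] --> (0 : R).
  move=> uw; apply: norm_cvg0.
  apply: (@squeeze_cvgr _ _ _ _ (cst 0) (fun t => `|u t - w| * `|v|)).
  - by apply: nearW => t; rewrite normr_ge0/= ip_CS.
  - exact: cvg_cst.
  - by rewrite -[0](mul0r `|v|); apply: cvgM => //; exact: cvg_cst.
have -> : ip x y = 0 + 0 + (0 + ip y x) by rewrite !add0r ipC.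
apply: cvgD; first apply: cvgD.
- apply: norm_cvg0.
  apply: (@squeeze_cvgr _ _ _ _ (cst 0) (fun t => `|f t - x| * `|g t - y|)).
  - by apply: nearW => t; rewrite normr_ge0/= ip_CS.
  - exact: cvg_cst.
  - by rewrite -[0](mul0r 0); apply: cvgM.
- exact: lin.
- have -> : (fun t => ip x (g t)) = (fun t => ip (g t - y) x + ip y x).
    by apply/funext => t; rewrite ipBl subrK ipC.
  by apply: cvgD; [exact: lin|exact: cvg_cst].
Qed.

End NormIp.

(** * Subspaces, Riesz representation and bounded operators *)

Lemma harmonic_lt (R : realType) (e : R) : 0 < e ->
  exists N : nat, forall n, (N <= n)%N -> n.+1%:R^-1 < e.
Proof.
move=> e0; have /cvgrPdist_lt/(_ e e0)[N _ hN] := @cvg_harmonic R.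
by exists N => n Nn; have := hN n Nn; rewrite /= sub0r normrN ger0_norm.
Qed.

Section Subspaces.
Context {R : realType} {k : scalar_kind} {H : hilbertType R k}.
Implicit Types (x y z : H) (M : set H).

Definition real_subspace M :=
  M 0 /\ forall (r : R) x y, M x -> M y -> M (r *: x + y).

Definition subspace M :=
  M 0 /\ forall a x y, M x -> M y -> M (act a x + y).

Lemma subspace_real M : subspace M -> real_subspace M.
Proof. by case=> M0 Ml; split=> // r x y Mx My; rewrite -act_real; exact: Ml. Qed.

Definition norm_dense M := forall x (e : R), 0 < e -> exists2 y, M y & `|x - y| < e.

Lemma real_subspaceD M x y : real_subspace M -> M x -> M y -> M (x + y).
Proof. by case=> _ Ml Mx My; rewrite -[x]scale1r; exact: Ml. Qed.

Lemma real_subspaceZ M (r : R) x : real_subspace M -> M x -> M (r *: x).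
Proof. by case=> M0 Ml Mx; rewrite -[_ *: _]addr0; exact: Ml. Qed.

Lemma real_subspaceB M x y : real_subspace M -> M x -> M y -> M (x - y).
Proof.
by move=> sM Mx My; rewrite -scaleN1r; apply: real_subspaceD => //; exact: real_subspaceZ.
Qed.

Lemma norm_dense_seq M x : norm_dense M ->
  exists2 u : nat -> H, forall n, M (u n) & u n @[n --> \oo] --> x.
Proof.
move=> dM; have /choice[u hu] : forall n : nat, exists y, M y /\ `|x - y| < n.+1%:R^-1.
  by move=> n; have [|y My xy] := dM x n.+1%:R^-1; [rewrite invr_gt0|exists y].
exists u => [n|]; first by have [] := hu n.
apply/cvgrPdist_lt => e e0.
have [N hN] := harmonic_lt e0.
by exists N => // n Nn; have [_ h] := hu n; apply: (lt_trans h); exact: hN.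
Qed.

Lemma norm_dense_ip_le M x (c : R) : norm_dense M -> 0 <= c ->
  (forall y, M y -> ip y x <= c * `|y|) -> `|x| <= c.
Proof.
move=> dM c0 h; apply: norm_le_ip => // y; have [u Mu uy] := norm_dense_seq y dM.
have h1 : ip (u n) x @[n --> \oo] --> ip y x by apply: cvg_ip => //; exact: cvg_cst.
have h2 : c * `|u n| @[n --> \oo] --> c * `|y|.
  by apply: cvgM; [exact: cvg_cst|exact: cvg_norm].
by apply: (ler_cvg_to h1 h2); apply: nearW => n; exact: h.
Qed.

Lemma norm_dense_ip_inj M x y : norm_dense M ->
  (forall z, M z -> ip z x = ip z y) -> x = y.
Proof.
move=> dM h; apply/eqP; rewrite -subr_eq0 -normr_le0; apply: (norm_dense_ip_le dM) => // z Mz.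
by rewrite ipBr h// subrr mul0r.
Qed.

Lemma cauchy_seq_cvg (V : completeNormedModType R) (u : nat -> V) :
  (forall e : R, 0 < e -> exists N : nat, forall n m, (N <= n)%N -> (N <= m)%N ->
     `|u n - u m| < e) -> exists w : V, u n @[n --> \oo] --> w.
Proof.
move=> h; suff : cvgn u by move=> ?; exists (limn u).
apply/cauchy_cvgP/cauchy_exP => e e0; have [N hN] := h e e0.
by exists (u N); exists N => // n Nn; rewrite -ball_normE /=; exact: hN.
Qed.

(** The common core of the theorems of Riesz and Lax-Milgram, by the direct method: a
  minimizing sequence in M of [a x x - 2 * l x] is Cauchy by coercivity, and its limit
  satisfies the Euler equation.  As M need not be closed, the limit is only in its
  closure; [orthogonal_dense] relies on this. *)
Lemma coercive_form_represents M (a : H -> H -> R) (l : H -> R) (c C L : R) :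
    real_subspace M ->
    (forall r x y z, a (r *: x + y) z = r * a x z + a y z) ->
    (forall x y, a x y = a y x) ->
    (forall x y, `|a x y| <= C * `|x| * `|y|) ->
    0 < c -> (forall x, c * `|x| ^+ 2 <= a x x) ->
    (forall r x y, M x -> M y -> l (r *: x + y) = r * l x + l y) ->
    (forall x, M x -> `|l x| <= L * `|x|) ->
  exists w, (exists2 u : nat -> H, forall n, M (u n) & u n @[n --> \oo] --> w) /\
    forall x, M x -> a x w = l x.
Proof.
move=> sM al asym aC c0 ac ll lL; have [M0 Ml] := sM.
have aD x y z : a (x + y) z = a x z + a y z by rewrite -{1}[x]scale1r al mul1r.
have a0 z : a 0 z = 0 by have := aD 0 0 z; rewrite addr0; lra.
have aZ r x z : a (r *: x) z = r * a x z by rewrite -[_ *: _]addr0 al a0 addr0.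
have aDr x y z : a z (x + y) = a z x + a z y by rewrite asym aD ![a _ z]asym.
have aZr r x z : a z (r *: x) = r * a z x by rewrite asym aZ asym.
have aN x z : a (- x) z = - a x z by rewrite -scaleN1r aZ mulN1r.
have aNr x z : a z (- x) = - a z x by rewrite asym aN asym.
have l0 : l 0 = 0 by have := lL 0 M0; rewrite normr0 mulr0 normr_le0 => /eqP.
have lZ r x : M x -> l (r *: x) = r * l x.
  by move=> Mx; rewrite -[_ *: _]addr0 ll// l0 addr0.
have lD x y : M x -> M y -> l (x + y) = l x + l y.
  by move=> Mx My; rewrite -{1}[x]scale1r ll// mul1r.
pose J x := a x x - 2 * l x.
have Jlow x : M x -> - (L ^+ 2 / c) <= J x.
  move=> Mx; have h1 := ac x; have := lL x Mx; rewrite ler_norml => /andP[_ h2].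
  have : 0 <= (c * `|x| - L) ^+ 2 / c by rewrite divr_ge0 ?sqr_ge0 ?ltW.
  have -> : (c * `|x| - L) ^+ 2 / c = c * `|x| ^+ 2 - 2 * (L * `|x|) + L ^+ 2 / c.
    by field; rewrite gt_eqF.
  by rewrite /J; lra.
have hinf : has_inf (J @` M).
  split; first by exists (J 0), 0.
  by exists (- (L ^+ 2 / c)) => _ [x Mx <-]; exact: Jlow.
pose m := inf (J @` M).
have mJ x : M x -> m <= J x by move=> Mx; apply: ge_inf; [case: hinf|exists x].
have /choice[u hu] : forall n : nat, exists x, M x /\ J x < m + n.+1%:R^-1.
  move=> n; have n0 : 0 < n.+1%:R^-1 :> R by rewrite invr_gt0.
  by have [_ [x Mx <-] hx] := inf_adherent n0 hinf; exists x.
have Mu n : M (u n) by have [] := hu n.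
have Ju n : J (u n) < m + n.+1%:R^-1 by have [] := hu n.
(* [u n] and [u p] are compared with their midpoint, as in the parallelogram identity. *)
have cau n p : c * `|u n - u p| ^+ 2 <= 2 * n.+1%:R^-1 + 2 * p.+1%:R^-1.
  apply: le_trans (ac _) _.
  have Mh : M (2^-1 *: (u n + u p)) by apply: real_subspaceZ => //; exact: real_subspaceD.
  have := mJ _ Mh; rewrite /J lZ ?lD//; last exact: real_subspaceD.
  rewrite !(aZ, aZr, aN, aNr, aD, aDr) (asym (u p) (u n)).
  have := Ju n; have := Ju p; rewrite /J; move: n.+1%:R^-1 p.+1%:R^-1 => r s.
  move: (a _ _) (a _ _) (a _ _) (l _) (l _) => x1 x2 x3 x4 x5.
  have aux (m' : R) : x3 - 2 * x5 < m' + s -> x2 - 2 * x4 < m' + r ->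
    m' <= 2^-1 * (2^-1 * (x2 + x1) + 2^-1 * (x1 + x3)) - 2 * (2^-1 * (x4 + x5)) ->
    x2 - x1 - (x1 - x3) <= 2 * r + 2 * s by lra.
  exact: aux.
have [w uw] : exists w : H, u n @[n --> \oo] --> w.
  apply: cauchy_seq_cvg => e e0.
  have ce : 0 < c * e ^+ 2 / 4 by rewrite divr_gt0// mulr_gt0// exprn_gt0.
  have [N hN] := harmonic_lt ce.
  exists N => n p Nn Np; rewrite -(@ltr_pXn2r _ 2) ?nnegrE// ?(ltW e0)//.
  rewrite -(ltr_pM2l c0); apply: le_lt_trans (cau n p) _.
  have := hN n Nn; have := hN p Np; move: (c * e ^+ 2) n.+1%:R^-1 p.+1%:R^-1 => r s t; lra.
exists w; split; first by exists u.
move=> x Mx.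
(* The first-order condition: [u n] moved by [r *: x] stays above the infimum. *)
have key r : 0 <= 2 * r * (a x w - l x) + r ^+ 2 * a x x.
  have lim : (fun n => - n.+1%:R^-1 : R) @ \oo --> (- 0 : R) by apply: cvgN; exact: cvg_harmonic.
  have axu : a x (u n) @[n --> \oo] --> a x w.
    apply/cvgrPdist_le => e e0.
    have K1 : 0 < `|C| * `|x| + 1 by rewrite ltr_wpDl// mulr_ge0.
    have d0 : 0 < e / (`|C| * `|x| + 1) by rewrite divr_gt0.
    move/cvgrPdist_le : uw => /(_ _ d0); apply: filterS => n hn.
    have -> : a x w - a x (u n) = a x (w - u n) by rewrite aDr aNr.
    apply: le_trans (aC _ _) _.
    apply: (@le_trans _ _ ((`|C| * `|x| + 1) * `|w - u n|)).
      apply: ler_wpM2r => //; apply: (@le_trans _ _ (`|C| * `|x|)); last by rewrite lerDl.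
      by apply: ler_wpM2r => //; exact: ler_norm.
    by rewrite mulrC -ler_pdivlMr.
  have lim2 : 2 * r * (a x (u n) - l x) + r ^+ 2 * a x x @[n --> \oo] -->
      2 * r * (a x w - l x) + r ^+ 2 * a x x.
    apply: cvgD; last exact: cvg_cst.
    apply: cvgM; first exact: cvg_cst.
    by apply: cvgB => //; exact: cvg_cst.
  rewrite -[0]oppr0; apply: (ler_cvg_to lim lim2); apply: nearW => n.
  have : M (r *: x + u n) by exact: Ml.
  move/mJ; rewrite /J lD ?lZ//; last exact: real_subspaceZ.
  rewrite !(aZ, aZr, aD, aDr) (asym (u n) x); have := Ju n; rewrite /J.
  by set t := n.+1%:R^-1; lra.
apply/eqP; rewrite -subr_eq0; apply/eqP; set d := a x w - l x in key *.
have axx : 0 <= a x x by apply: le_trans (ac x); rewrite mulr_ge0 ?(ltW c0)// sqr_ge0.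
(* For this r the right-hand side is negative unless d = 0. *)
have := key (- d / (a x x + 1)).
have -> : 2 * (- d / (a x x + 1)) * d + (- d / (a x x + 1)) ^+ 2 * a x x =
  - (d ^+ 2 * (a x x + 2) / (a x x + 1) ^+ 2) by field; rewrite gt_eqF// ltr_wpDl.
rewrite oppr_ge0 pmulr_lle0 ?invr_gt0 ?exprn_gt0 ?ltr_wpDl//.
rewrite pmulr_lle0; last by rewrite ltr_wpDl.
by move=> h; apply/eqP; rewrite -sqrf_eq0 eq_le h sqr_ge0.
Qed.

(** The functional <., x0> restricted to M is represented by a limit w of elements of M,
  and x0 - w is orthogonal to M, so that x0 = w. *)
Lemma orthogonal_dense M : real_subspace M ->
  (forall x, (forall y, M y -> ip y x = 0) -> x = 0) -> norm_dense M.
Proof.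
move=> sM h x0.
have [|||||||w [[u Mu uw] hw]] := @coercive_form_represents M ip (fun x => ip x x0) 1 1 `|x0| sM.
- by move=> r x y z; rewrite ipDl ipZl.
- exact: ipC.
- by move=> x y; rewrite mul1r ip_CS.
- exact: ltr01.
- by move=> x; rewrite mul1r ip_norm.
- by move=> r x y _ _; rewrite ipDl ipZl.
- by move=> x _; rewrite mulrC ip_CS.
have -> : x0 = w.
  by apply/eqP; rewrite -subr_eq0; apply/eqP/h => y My; rewrite ipBr hw// subrr.
move=> e e0; move/cvgrPdist_lt : uw => /(_ e e0)[N _ hN].
by exists (u N) => //; apply: hN => /=.
Qed.

Lemma riesz_dense M (l : H -> R) (L : R) : real_subspace M -> norm_dense M ->
    (forall r x y, M x -> M y -> l (r *: x + y) = r * l x + l y) ->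
    0 <= L -> (forall x, M x -> `|l x| <= L * `|x|) ->
  exists2 w, forall x, M x -> ip x w = l x & `|w| <= L.
Proof.
move=> sM dM ll L0 lL.
have [|||||||w [_ hw]] := @coercive_form_represents M ip l 1 1 L sM => //.
- by move=> r x y z; rewrite ipDl ipZl.
- exact: ipC.
- by move=> x y; rewrite mul1r ip_CS.
- by move=> x; rewrite mul1r ip_norm.
exists w => //; apply: (norm_dense_ip_le dM) => // y My.
by rewrite hw// (le_trans (ler_norm _))// lL.
Qed.

Lemma setT_subspace : subspace [set: H].
Proof. by []. Qed.

Lemma setT_norm_dense : norm_dense [set: H].
Proof. by move=> x e e0; exists x => //; rewrite subrr normr0. Qed.

Lemma riesz (l : H -> R) (L : R) :
    (forall r x y, l (r *: x + y) = r * l x + l y) ->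
    0 <= L -> (forall x, `|l x| <= L * `|x|) ->
  exists2 w, forall x, ip x w = l x & `|w| <= L.
Proof.
move=> ll L0 lL.
have [|w hw wL] := riesz_dense (subspace_real setT_subspace) setT_norm_dense _ L0 (fun x _ => lL x).
  by move=> r x y _ _; exact: ll.
by exists w => // x; exact: hw.
Qed.

End Subspaces.

Section BoundedOperators.
Context {R : realType} {k : scalar_kind} {H U : hilbertType R k}.
Implicit Types (f : H -> U).

Lemma klinearD f x y : klinear f -> f (x + y) = f x + f y.
Proof. by move=> kf; rewrite -[x in LHS]act1 kf act1. Qed.

Lemma klinear0 f : klinear f -> f 0 = 0.
Proof.
by move=> kf; have h := klinearD 0 0 kf; rewrite addr0 in h; apply: (addrI (f 0)); rewrite -h addr0.
Qed.

Lemma klinear_act f a x : klinear f -> f (act a x) = act a (f x).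
Proof. by move=> kf; rewrite -[act a x]addr0 kf klinear0// addr0. Qed.

Lemma klinearZ f (r : R) x : klinear f -> f (r *: x) = r *: f x.
Proof. by move=> kf; rewrite -!act_real klinear_act. Qed.

Lemma klinearB f x y : klinear f -> f (x - y) = f x - f y.
Proof. by move=> kf; rewrite klinearD// -scaleN1r klinearZ// scaleN1r. Qed.

Lemma klinear_linear f : klinear f -> linear f.
Proof. by move=> kf r x y; rewrite klinearD// klinearZ. Qed.

Lemma bounded_operator_bound f : bounded_operator f ->
  exists2 C : R, 0 < C & forall x, `|f x| <= C * `|x|.
Proof.
case=> kf cf; have /cvgrPdist_lt/(_ 1 ltr01) := cf 0.
rewrite klinear0// => /nbhs_ballP[d /= d0 hd].
exists (2 / d) => [|x]; first by rewrite divr_gt0.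
have [->|x0] := eqVneq x 0; first by rewrite klinear0// !normr0 mulr0.
have nx : 0 < `|x| by rewrite normr_gt0.
have : ball 0 d ((d / 2 / `|x|) *: x).
  rewrite -ball_normE /= sub0r normrN normrZ ger0_norm ?divr_ge0 ?(ltW d0)//.
  by rewrite divfK ?gt_eqF// ltr_pdivrMr// ltr_pMr// ltr1n.
move/hd => /=; rewrite sub0r normrN klinearZ// normrZ ger0_norm ?divr_ge0 ?(ltW d0)//.
move=> h.
have -> : `|f x| = d / 2 / `|x| * `|f x| * (2 / d * `|x|) by field; rewrite !gt_eqF.
by rewrite -[leRHS]mul1r ler_pM2r ?mulr_gt0 ?invr_gt0// ltW.
Qed.

Lemma klinear_bounded_operator f (C : R) : klinear f ->
  (forall x, `|f x| <= C * `|x|) -> bounded_operator f.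
Proof.
move=> kf fC; split => // x; apply/cvgrPdist_le => e e0.
have C1 : 0 < `|C| + 1 by rewrite ltr_wpDl.
have d0 : 0 < e / (`|C| + 1) by rewrite divr_gt0.
near=> y; rewrite -klinearB//; apply: le_trans (fC _) _.
have : `|x - y| <= e / (`|C| + 1).
  by near: y; apply: cvgr_dist_le => //; exact: cvg_id.
rewrite ler_pdivlMr// mulrC => h; apply: le_trans h; apply: ler_wpM2r => //.
by rewrite (le_trans (ler_norm _))// lerDl.
Unshelve. all: by end_near. Qed.

Lemma bounded_operator_cvg f {T : Type} {F : set_system T} {FF : Filter F} (u : T -> H) x :
  bounded_operator f -> u @ F --> x -> f (u t) @[t --> F] --> f x.
Proof. by case=> _ cf ux; apply: continuous_cvg => //; exact: cf. Qed.

End BoundedOperators.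

Section Adjoints.
Context {R : realType} {k : scalar_kind} {H : hilbertType R k}.
Implicit Types (f : H -> H).

(** [badjoint] is a choice with default value 0; for a bounded operator Riesz
  representation shows that there is something to choose. *)
Lemma badjoint_inner f x y : bounded_operator f -> inner (f x) y = inner x (badjoint f y).
Proof.
move=> bf; have [kf _] := bf; have [C C0 fC] := bounded_operator_bound bf.
have [|||w hw _] := @riesz R k H (fun x => ip (f x) y) (C * `|y|).
- by move=> r u v; rewrite klinearD// klinearZ// ipDl ipZl.
- by rewrite mulr_ge0// ltW.
- move=> u; apply: le_trans (ip_CS _ _) _; rewrite mulrAC.
  by apply: ler_wpM2r.
have hw' u : inner (f u) y = inner u w.
  apply: inner_eq; rewrite -?/(ip u w) ?hw//.
  by rewrite Im_inner !ip_actr hw klinear_act.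
have : [set z | forall x, setT x -> inner (f x) y = inner x z] (badjoint f y).
  rewrite /badjoint /adjoint /=; set P := [set z | _]; exact: (@xgetI _ 0 P w (fun u _ => hw' u)).
by apply.
Qed.

Lemma badjoint_ip f x y : bounded_operator f -> ip (f x) y = ip x (badjoint f y).
Proof. by move=> bf; rewrite /ip badjoint_inner. Qed.

Lemma ip_badjoint f x y : bounded_operator f -> ip (badjoint f x) y = ip x (f y).
Proof. by move=> bf; rewrite ipC -badjoint_ip// ipC. Qed.

Lemma badjoint_klinear f : bounded_operator f -> klinear (badjoint f).
Proof.
move=> bf a x y; have [kf _] := bf; apply: ip_inj => z.
by rewrite ipDr ip_actr -!badjoint_ip// ipDr ip_actr klinear_act.
Qed.

Lemma badjoint_bound f (C : R) : bounded_operator f -> 0 <= C ->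
  (forall x, `|f x| <= C * `|x|) -> forall x, `|badjoint f x| <= C * `|x|.
Proof.
move=> bf C0 fC x; apply: norm_le_ip; first by rewrite mulr_ge0.
move=> y; rewrite -badjoint_ip//; apply: le_trans (ip_le _ _) _.
by rewrite mulrAC; apply: ler_wpM2r.
Qed.

Lemma badjoint_bounded f : bounded_operator f -> bounded_operator (badjoint f).
Proof.
move=> bf; have [C C0 fC] := bounded_operator_bound bf.
apply: (@klinear_bounded_operator _ _ _ _ _ C); first exact: badjoint_klinear.
by apply: badjoint_bound => //; exact: ltW.
Qed.

Lemma symmetric_ip f : klinear f -> (forall x y, ip (f x) y = ip x (f y)) ->
  symmetric_operator f.
Proof.
move=> kf h x y; apply: inner_eq; first by rewrite -/(ip x (f y)) h.
by rewrite Im_inner -klinear_act// h.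
Qed.

(** Riesz representation on M gives an operator Q0 defined on M only; a second
  application, to x |-> <Q0 x, y>, extends it to H. *)
Lemma extend_bounded_form (M : set H) (q : H -> H -> R) (C : R) :
    subspace M -> norm_dense M -> 0 <= C ->
    (forall r x y z, M x -> M y -> M z -> q (r *: x + y) z = r * q x z + q y z) ->
    (forall x y, M x -> M y -> q x y = q y x) ->
    (forall a x y, M x -> M y -> q (act a x) y = q x (act (scalar_conj a) y)) ->
    (forall x y, M x -> M y -> `|q x y| <= C * `|x| * `|y|) ->
  exists Q : H -> H, [/\ bounded_operator Q, forall x y, ip (Q x) y = ip x (Q y) &
    forall x y, M x -> M y -> ip (Q x) y = q x y].
Proof.
move=> sM dM C0 ql qsym qact qC; have rM := subspace_real sM.
have Mact a x : M x -> M (act a x).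
  by move=> Mx; rewrite -[act a x]addr0; apply: sM.2 => //; exact: sM.1.
have /choice[Q0 hQ0] : forall y, exists w, M y ->
    (forall x, M x -> ip x w = q x y) /\ `|w| <= C * `|y|.
  move=> y; have [My|nMy] := pselect (M y); last by exists 0.
  have [| | |w h1 h2] := @riesz_dense R k H M (q^~ y) (C * `|y|) rM dM.
  - by move=> r x z Mx Mz; exact: ql.
  - by rewrite mulr_ge0.
  - by move=> x Mx; rewrite mulrAC; exact: qC.
  by exists w.
have Q0q x y : M x -> M y -> ip (Q0 x) y = q x y.
  by move=> Mx My; rewrite ipC (hQ0 _ Mx).1// qsym.
have /choice[Q hQ] : forall y, exists w,
    (forall x, M x -> ip x w = ip (Q0 x) y) /\ `|w| <= C * `|y|.
  move=> y.
  have [| | |w h1 h2] := @riesz_dense R k H M (fun x => ip (Q0 x) y) (C * `|y|) rM dM.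
  - move=> r x z Mx Mz; rewrite -ipZl -ipDl; congr (ip _ _).
    apply: (norm_dense_ip_inj dM) => v Mv.
    have Mrz : M (r *: x + z) by exact: rM.2.
    by rewrite ipDr ipZr (hQ0 _ Mrz).1// (hQ0 _ Mx).1// (hQ0 _ Mz).1// qsym// ql// ![q v _]qsym.
  - by rewrite mulr_ge0.
  - move=> x Mx; apply: le_trans (ip_CS _ _) _; rewrite mulrAC.
    by apply: ler_wpM2r => //; have [] := hQ0 _ Mx.
  by exists w.
have Qq x y : M x -> M y -> ip (Q x) y = q x y.
  by move=> Mx My; rewrite ipC (hQ _).1// Q0q// qsym.
have QQ0 x : M x -> Q x = Q0 x.
  by move=> Mx; apply: (norm_dense_ip_inj dM) => v Mv; rewrite (hQ _).1// (hQ0 _ Mx).1// Q0q.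
have kQ : klinear Q.
  move=> a x y; apply: (norm_dense_ip_inj dM) => v Mv.
  have Mav : M (act (scalar_conj a) v) by exact: Mact.
  rewrite ipDr ip_actr !(hQ _).1// ipDr ip_actr; congr (ip _ _ + _).
  apply: (norm_dense_ip_inj dM) => t Mt.
  rewrite (hQ0 _ Mav).1// ip_actr scalar_conjK (hQ0 _ Mv).1 ?qact//; exact: Mact.
have bQ : bounded_operator Q.
  by apply: (@klinear_bounded_operator _ _ _ _ _ C) => // x; have [] := hQ x.
exists Q; split => // x y.
have [u Mu ux] := norm_dense_seq x dM.
have h1 : ip (Q (u n)) y @[n --> \oo] --> ip (Q x) y.
  by apply: cvg_ip; [exact: bounded_operator_cvg|exact: cvg_cst].
have h2 : ip (u n) (Q y) @[n --> \oo] --> ip x (Q y).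
  by apply: cvg_ip => //; exact: cvg_cst.
suff e : (fun n => ip (Q (u n)) y) = (fun n => ip (u n) (Q y)).
  by move: h1; rewrite e => h1; exact: (cvg_unique _ h1 h2).
by apply/funext => n; rewrite (hQ y).1// QQ0.
Qed.

(** Surjectivity is [coercive_form_represents] for the form <Q ., .>, and coercivity
  bounds the inverse. *)
Lemma positive_operator_inverse (Q : H -> H) :
  bounded_operator Q -> (forall x y, ip (Q x) y = ip x (Q y)) ->
  positive_operator Q ->
  exists Qinv, [/\ bounded_operator Qinv, cancel Q Qinv & cancel Qinv Q].
Proof.
move=> bQ sQ [c c0 Qc]; have [kQ _] := bQ; have [C C0 QC] := bounded_operator_bound bQ.
have sT := subspace_real (@setT_subspace R k H).
have /choice[P hP] : forall y, exists w, Q w = y.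
  move=> y.
  have [| | | | |w [_ hw]] := @coercive_form_represents R k H setT (fun u v => ip (Q u) v)
    (fun x => ip x y) c C `|y| sT _ _ _ c0 Qc.
  - by move=> r u v z; rewrite klinearD// klinearZ// ipDl ipZl.
  - by move=> u v; rewrite sQ ipC.
  - move=> u v; apply: le_trans (ip_CS _ _) _.
    by apply: ler_wpM2r.
  - by move=> r u v _ _; rewrite ipDl ipZl.
  - by move=> u _; rewrite mulrC ip_CS.
  by exists w; apply: ip_inj => z; rewrite -sQ hw.
have injQ x : Q x = 0 -> x = 0.
  move=> Qx; have := Qc x; rewrite Qx -/(ip 0 x) ip0l => h.
  have : `|x| ^+ 2 <= 0 by rewrite -(ler_pM2l c0) mulr0.
  by move=> h2; apply/eqP; rewrite -normr_eq0 -sqrf_eq0 eq_le h2 sqr_ge0.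
have QP : cancel P Q by [].
have PQ : cancel Q P.
  by move=> x; apply/eqP; rewrite -subr_eq0; apply/eqP/injQ; rewrite klinearB// QP subrr.
exists P; split => //; apply: (@klinear_bounded_operator _ _ _ _ _ c^-1).
  by move=> a x y; rewrite -{1}[x]QP -{1}[y]QP -kQ PQ.
move=> x; have [->|Px0] := eqVneq (P x) 0.
  by rewrite normr0 mulr_ge0// invr_ge0 ltW.
have nP : 0 < `|P x| by rewrite normr_gt0.
rewrite ler_pdivlMl// -(ler_pM2r nP) -mulrA -expr2; apply: le_trans (Qc _) _.
by rewrite QP; exact: ip_le.
Qed.

End Adjoints.

(** * Real functions on an interval *)

Section Continuity.
Context {R : realType} {V : normedModType R}.
Implicit Types (f : R -> V) (a b : R).

Lemma within_itv_continuousP f a b : {within `[a, b], continuous f} <->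
  forall x, a <= x <= b -> forall e : R, 0 < e -> exists2 d : R, 0 < d &
    forall y, a <= y <= b -> `|x - y| < d -> `|f x - f y| < e.
Proof.
split=> [/subspace_continuousP cf x xab e e0|h].
  have /cvgrPdist_lt/(_ e e0) : f @ within `[a, b] (nbhs x) --> f x.
    by apply: cf; rewrite /= in_itv.
  rewrite near_withinE => /nbhs_ballP[d /= d0 hd].
  exists d => // y yab xy; apply: hd; last by rewrite /= in_itv.
  by rewrite -ball_normE.
apply/subspace_continuousP => x; rewrite /= in_itv /= => xab.
apply/cvgrPdist_lt => e e0; have [d d0 hd] := h x xab e e0.
rewrite near_withinE; apply/nbhs_ballP; exists d => // y /=.
by rewrite -ball_normE /= in_itv /= => xy yab; exact: hd.
Qed.

(** Composition with [clamp] extends a function continuous on an interval to one that is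
  continuous on R, which keeps subspace topologies out of the proofs. *)
Definition clamp a b (t : R) : R := Num.max a (Num.min b t).

Lemma clamp_itv a b t : a <= b -> a <= clamp a b t <= b.
Proof. by move=> ab; rewrite /clamp le_max lexx /= ge_max ab ge_min lexx. Qed.

Lemma clamp_id a b t : a <= t <= b -> clamp a b t = t.
Proof. by move=> /andP[at_ tb]; rewrite /clamp (min_idPr tb); apply/max_idPr. Qed.

Lemma clamp_lip a b s t : `|clamp a b s - clamp a b t| <= `|s - t|.
Proof.
have h1 := ler_norm (s - t); have h2 := ler_norm (t - s); rewrite distrC in h2.
have h3 := normr_ge0 (s - t); rewrite /clamp.
have aux x y : `|Num.max a x - Num.max a y| <= `|x - y|.
  have k1 := ler_norm (x - y); have k2 := ler_norm (y - x); rewrite distrC in k2.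
  case: (leP a x) => ?; case: (leP a y) => ?; rewrite ler_norml; apply/andP; split; lra.
apply: le_trans (aux _ _) _.
case: (leP b s) => ?; case: (leP b t) => ?; rewrite ler_norml; apply/andP; split; lra.
Qed.

Lemma clamp_continuous f a b : a <= b -> {within `[a, b], continuous f} ->
  continuous (f \o clamp a b).
Proof.
move=> ab /within_itv_continuousP cf x; apply/cvgrPdist_lt => e e0.
have [d d0 hd] := cf _ (clamp_itv x ab) e e0.
apply/nbhs_ballP; exists d => // y /= xy.
apply: hd; first exact: clamp_itv.
exact: le_lt_trans (clamp_lip _ _ _ _) xy.
Qed.

Lemma continuous_within_itv f a b : continuous f -> {within `[a, b], continuous f}.
Proof. by move=> cf; apply: continuous_subspaceT. Qed.

Lemma unif_continuous_itv f a b : continuous f -> forall e : R, 0 < e ->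
  exists2 d : R, 0 < d & forall s t, a <= s <= b -> `|s - t| < d -> `|f s - f t| < e.
Proof.
move=> cf e e0.
have /compact_near_coveringP := @segment_compact R a b.
have F0 : Filter (0 : R)^'+ by exact: at_right_proper_filter.
move=> /(_ R (0^'+) (fun d x => forall y, `|x - y| < d -> `|f x - f y| < e) F0).
case=> [x _|d /= d0 hd].
  have e2 : 0 < e / 2 by rewrite divr_gt0.
  have /cvgrPdist_lt/(_ _ e2)/nbhs_ballP[d /= d0 hd] := cf x.
  have d2 : 0 < d / 2 by rewrite divr_gt0.
  exists (ball x (d / 2), `]0, (d / 2)[%classic).
    split => /=; first exact: nbhsx_ballx.
    exists (d / 2) => //= y yd y0; rewrite in_itv /= y0 /=.
    by move: yd; rewrite /ball_ /= sub0r normrN gtr0_norm.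
  move=> [x' i] [/= xx']; rewrite in_itv /= => /andP[i0 id] y x'y.
  rewrite -ball_normE /= in xx'.
  have h1 : `|f x - f x'| < e / 2.
    by apply: hd; rewrite -ball_normE /=; apply: (lt_trans xx'); rewrite ltr_pdivrMr// ltr_pMr// ltr1n.
  have h2 : `|f x - f y| < e / 2.
    apply: hd; rewrite -ball_normE /=.
    have -> : x - y = (x - x') + (x' - y) by ring.
    apply: le_lt_trans (ler_normD _ _) _; rewrite [d]splitr; apply: ltrD => //.
    exact: lt_trans id.
  have -> : f x' - f y = (f x - f y) - (f x - f x') by rewrite opprB [RHS]addrC addrA subrK.
  apply: le_lt_trans (ler_normB _ _) _; rewrite [e]splitr; exact: ltrD.
exists (d / 2) => [|s t sab st]; first by rewrite divr_gt0.
apply: (hd (d / 2)) => //=; rewrite ?in_itv ?divr_gt0//=.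
by rewrite sub0r normrN gtr0_norm ?divr_gt0// ltr_pdivrMr// ltr_pMr// ltr1n.
Qed.

Lemma continuous_bounded_itv f a b : continuous f ->
  exists2 C : R, 0 < C & forall t, a <= t <= b -> `|f t| <= C.
Proof.
move=> cf; have /compact_bounded[M [_ hM]] : compact (f @` `[a, b]).
  by apply: continuous_compact; [exact: continuous_subspaceT|exact: segment_compact].
exists (Num.max 1 (M + 1)) => [|t tab]; first by rewrite lt_max ltr01.
apply: (@le_trans _ _ (M + 1)); last by rewrite le_max lexx orbT.
by apply: (hM (M + 1)); [rewrite ltrDl|exists t => //; rewrite /= in_itv].
Qed.

End Continuity.

Section Integrals.
Context {R : realType}.
Implicit Types (f g F G : R -> R) (a b c : R).
Local Notation mu := (@lebesgue_measure R).

Definition itg a b f : R := \int[mu]_(x in `]a, b[) f x.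

Definition itgb a b f : Prop := mu.-integrable `]a, b[ (EFin \o f).

Lemma itgb_within f a b : {within `[a, b], continuous f} -> itgb a b f.
Proof.
move=> cf; apply: (@integrableS _ _ _ mu `[a, b]) => //.
  exact: subset_itv_oo_cc.
by apply: continuous_compact_integrable => //; exact: segment_compact.
Qed.

Lemma itgb_continuous f a b : continuous f -> itgb a b f.
Proof. by move=> cf; apply: itgb_within; exact: continuous_subspaceT. Qed.

Lemma itgb_measurable f a b : itgb a b f -> measurable_fun `]a, b[ f.
Proof. by move=> /measurable_int/measurable_EFinP. Qed.

Lemma itgb_dominated f g a b : measurable_fun `]a, b[ f -> itgb a b g ->
  (forall x, a < x < b -> `|f x| <= g x) -> itgb a b f.
Proof.
move=> mf ig fg; apply: (le_integrable _ _ _ ig) => //.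
  exact/measurable_EFinP.
move=> x; rewrite /= in_itv /= => xab; rewrite lee_fin (le_trans (fg x xab))//.
exact: ler_norm.
Qed.

Lemma eq_itg f g a b : (forall x, a < x < b -> f x = g x) -> itg a b f = itg a b g.
Proof. by move=> fg; apply: eq_Rintegral => x; rewrite inE /= in_itv /=; exact: fg. Qed.

Lemma eq_itgb f g a b : (forall x, a < x < b -> f x = g x) -> itgb a b f -> itgb a b g.
Proof.
move=> fg; apply: eq_integrable => // x; rewrite inE /= in_itv /= => xab.
by rewrite /= fg.
Qed.

Lemma itgbD f g a b : itgb a b f -> itgb a b g -> itgb a b (fun x => f x + g x).
Proof. by move=> hf hg; rewrite /itgb; apply: integrableD hf hg. Qed.

Lemma itgbZ r f a b : itgb a b f -> itgb a b (fun x => r * f x).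
Proof. by move=> hf; rewrite /itgb; apply: integrableZl hf. Qed.

Lemma itgbN f a b : itgb a b f -> itgb a b (fun x => - f x).
Proof.
by move=> /(itgbZ (-1)); apply: eq_itgb => x _; rewrite mulN1r.
Qed.

Lemma itgbB f g a b : itgb a b f -> itgb a b g -> itgb a b (fun x => f x - g x).
Proof. by move=> hf /itgbN hg; exact: itgbD. Qed.

Lemma itgb_norm f a b : itgb a b f -> itgb a b (fun x => `|f x|).
Proof.
move=> hf; apply: (itgb_dominated (g := fun x => `|f x|)).
- by apply: measurableT_comp => //; exact: itgb_measurable.
- exact: integrable_norm hf.
- by move=> x _; rewrite normr_id.
Qed.

Lemma itgb_cst r a b : itgb a b (fun=> r).
Proof. by apply: itgb_continuous => x; exact: cvg_cst. Qed.

Lemma itgb_subitv f a b a' b' : a <= a' -> b' <= b -> itgb a b f -> itgb a' b' f.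
Proof.
by move=> aa bb; apply: integrableS => //; apply: subset_itvW => //; rewrite bnd_simp.
Qed.

Lemma itgD f g a b : itgb a b f -> itgb a b g ->
  itg a b (fun x => f x + g x) = itg a b f + itg a b g.
Proof. by move=> hf hg; rewrite /itg RintegralD. Qed.

Lemma itgB f g a b : itgb a b f -> itgb a b g ->
  itg a b (fun x => f x - g x) = itg a b f - itg a b g.
Proof. by move=> hf hg; rewrite /itg RintegralB. Qed.

Lemma itgZ r f a b : itgb a b f -> itg a b (fun x => r * f x) = r * itg a b f.
Proof. by move=> hf; rewrite /itg RintegralZl. Qed.

Lemma itgN f a b : itgb a b f -> itg a b (fun x => - f x) = - itg a b f.
Proof.
move=> hf; rewrite -mulN1r -itgZ//; apply: eq_itg => x _; by rewrite mulN1r.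
Qed.

Lemma le_itg f g a b : itgb a b f -> itgb a b g ->
  (forall x, a < x < b -> f x <= g x) -> itg a b f <= itg a b g.
Proof.
by move=> hf hg fg; apply: le_Rintegral => // x; rewrite /= in_itv /=; exact: fg.
Qed.

Lemma itg_ge0 f a b : (forall x, a < x < b -> 0 <= f x) -> 0 <= itg a b f.
Proof. by move=> hf; apply: Rintegral_ge0 => x; rewrite /= in_itv /=; exact: hf. Qed.

Lemma norm_itg f a b : itgb a b f -> `|itg a b f| <= itg a b (fun x => `|f x|).
Proof. by move=> hf; exact: le_normr_Rintegral. Qed.

Lemma itg_cst r a b : a <= b -> itg a b (fun=> r) = r * (b - a).
Proof.
move=> ab; have e : fine (mu `]a, b[%classic) = b - a.
  rewrite lebesgue_measure_itv /= lte_fin.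
  by case: ltgtP ab => //= -> _; rewrite subrr.
by rewrite /itg Rintegral_cst//; congr (r * _); exact: e.
Qed.

Lemma norm_itg_le f C a b : a <= b -> itgb a b f ->
  (forall x, a < x < b -> `|f x| <= C) -> `|itg a b f| <= C * (b - a).
Proof.
move=> ab hf fC; apply: le_trans (norm_itg hf) _; rewrite -itg_cst//.
by apply: le_itg => //; [exact: itgb_norm|exact: itgb_cst].
Qed.

Lemma itg_refl f a : itg a a f = 0.
Proof. by rewrite /itg set_itvoo0// Rintegral_set0. Qed.

Lemma itg_chasles f a b c : a <= b -> b <= c -> itgb a c f ->
  itg a c f = itg a b f + itg b c f.
Proof.
move=> ab bc hf; apply/eqP; rewrite addrC -subr_eq; apply/eqP.
move: ab bc; rewrite le_eqVlt => /predU1P[<-|ab]; first by rewrite itg_refl subr0.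
rewrite le_eqVlt => /predU1P[->|bc]; first by rewrite subrr itg_refl.
rewrite /itg [X in _ - X]Rintegral_itv_bndo_bndc; last first.
  by apply: itgb_subitv hf => //; exact: ltW.
by apply: Rintegral_itvB => //; rewrite bnd_simp ?ltW.
Qed.

Lemma itg_FTC2 F f a b : a <= b -> {within `[a, b], continuous F} ->
  {within `[a, b], continuous f} ->
  (forall x, a < x < b -> is_derive x (1 : R) F (f x)) -> itg a b f = F b - F a.
Proof.
rewrite le_eqVlt => /predU1P[->|ab]; first by rewrite itg_refl subrr.
move=> cF cf dF; rewrite /itg Rintegral_itv_bndo_bndc; last exact: itgb_within.
rewrite Rintegral_itv_obnd_cbnd; last first.
  apply: (@integrableS _ _ _ mu `[a, b]) => //.
    exact: subset_itv_oc_cc.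
  by apply: continuous_compact_integrable => //; exact: segment_compact.
rewrite /Rintegral (@continuous_FTC2 _ f F)//.
- move/(continuous_within_itvP _ ab) : cF => [_ Fa Fb]; split => //.
  by move=> x; rewrite in_itv /= => /dF [].
- by move=> x; rewrite in_itv /= => /dF dx; rewrite derive1E; apply: derive_val.
Qed.

Lemma itg_FTC1 f a x : continuous f -> a < x -> is_derive x (1 : R) (fun t => itg a t f) (f x).
Proof.
move=> cf ax.
have [] := @continuous_FTC1 R f (BRight a) x (x + 1) _ _ _ (cf x).
- by rewrite ltrDl.
- apply: (@integrableS _ _ _ mu `[a, x + 1]) => //.
    exact: subset_itv_oc_cc.
  by apply: continuous_compact_integrable; [exact: segment_compact|exact: continuous_subspaceT].
- by first [exact: ax | rewrite /Order.lt /=; exact: ax].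
move=> dF Ff.
have e : (fun t => itg a t f) = (fun t => \int[mu]_(x in `]a, t]) f x).
  by apply/funext => t; rewrite /itg Rintegral_itv_bndo_bndc//; exact: itgb_continuous.
by rewrite e; apply: DeriveDef; [exact: dF|rewrite -derive1E; exact: Ff].
Qed.

Lemma itg_sub f a b c : a <= b -> b <= c -> continuous f ->
  itg a c f - itg a b f = itg b c f.
Proof. by move=> ab bc cf; rewrite (itg_chasles ab bc); [rewrite addrAC subrr add0r|exact: itgb_continuous]. Qed.

Lemma itg_shift f a b c : continuous f -> a <= b ->
  itg (a + c) (b + c) f = itg a b (fun t => f (t + c)).
Proof.
move=> cf ab; pose F t := itg (a + c - 1) (t + c) f.
have dF x : a - 1 < x -> is_derive x (1 : R) F (f (x + c)).
  move=> ax; have h := @itg_FTC1 f (a + c - 1) (x + c) cf.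
  have {}h : is_derive (x + c) (1 : R) (fun t => itg (a + c - 1) t f) (f (x + c)).
    by apply: h; lra.
  have h2 : is_derive x (1 : R) (fun t : R => t + c) 1.
    by rewrite -[X in is_derive _ _ _ X]addr0; apply: is_deriveD.
  by have := @is_derive1_comp _ (fun t => itg (a + c - 1) t f) (fun t : R => t + c) _ _ _ h h2; rewrite mulr1.
have cf' : continuous (fun t => f (t + c)).
  move=> x; apply: continuous_comp; last exact: cf.
  by apply: cvgD; [exact: cvg_id|exact: cvg_cst].
rewrite [RHS](@itg_FTC2 F)//.
- rewrite /F itg_sub//; lra.
- apply: derivable_within_continuous => x; rewrite in_itv /= => /andP[ax _].
  by have [] := dF x; first by lra.
- exact: continuous_subspaceT.
- by move=> x /andP[ax _]; apply: dF; lra.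
Qed.

(** Over N equal steps the increments of F add up to at most e * (G b - G a), whatever
  e > 0.  This replaces differentiation when G is only the primitive of an integrable
  function. *)
Lemma small_increments F G a b : a <= b ->
  (forall e, 0 < e -> exists2 d, 0 < d & forall s t, a <= s -> s <= t -> t <= b ->
     t - s <= d -> `|F t - F s| <= e * (G t - G s)) -> F b = F a.
Proof.
rewrite le_eqVlt => /predU1P[->//|ab] h.
have key e : 0 < e -> `|F b - F a| <= e * (G b - G a).
  move=> e0; have [d d0 hd] := h e e0.
  have [N hN] : exists N : nat, (b - a) / N.+1%:R <= d.
    have db : 0 < d / (b - a) by rewrite divr_gt0// subr_gt0.
    have [N hN] := harmonic_lt db; exists N.
    by have /ltW := hN N (leqnn N); rewrite ler_pdivlMr ?subr_gt0// mulrC.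
  pose x n := a + (b - a) / N.+1%:R * n%:R.
  have xs n : x n.+1 = x n + (b - a) / N.+1%:R.
    by rewrite /x -natr1; ring.
  have st0 : 0 <= (b - a) / N.+1%:R by rewrite divr_ge0// subr_ge0 ltW.
  have xb n : (n <= N.+1)%N -> x n <= b.
    move=> nN; have : (n%:R : R) <= N.+1%:R by rewrite ler_nat.
    move/(ler_wpM2l st0); by rewrite divfK ?pnatr_eq0// /x -lerBrDl.
  have ind n : (n <= N.+1)%N -> `|F (x n) - F a| <= e * (G (x n) - G a).
    elim: n => [_|n IH nN]; first by rewrite /x mulr0 addr0 !subrr normr0 mulr0.
    have -> : F (x n.+1) - F a = (F (x n.+1) - F (x n)) + (F (x n) - F a) by ring.
    apply: le_trans (ler_normD _ _) _.
    have -> : e * (G (x n.+1) - G a) = e * (G (x n.+1) - G (x n)) + e * (G (x n) - G a) by ring.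
    apply: lerD; last by apply: IH; exact: ltnW.
    apply: hd; [|by rewrite xs lerDl|exact: xb|by rewrite xs addrAC subrr add0r].
    by rewrite /x lerDl mulr_ge0.
  have := ind N.+1 (leqnn _).
  by have -> : x N.+1 = b by rewrite /x divfK ?pnatr_eq0// addrC subrK.
apply/eqP; rewrite -subr_eq0 -normr_le0; apply/ler_addgt0Pl => e e0; rewrite addr0.
have [GG|GG] := leP (G b - G a) 0.
  apply: le_trans (key 1 ltr01) _; rewrite mul1r; apply: (le_trans GG); exact: ltW.
by have := key (e / (G b - G a)) (divr_gt0 e0 GG); rewrite divfK// gt_eqF.
Qed.

End Integrals.

(** * Derivatives and weak integrals of curves *)

Section Derivatives.
Context {R : realType} {V : normedModType R}.
Implicit Types (F : R -> V).

Lemma cvg_dnbhs0P F l : F @ (0 : R)^' --> l <->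
  forall e : R, 0 < e -> exists2 d : R, 0 < d &
    forall h, h != 0 -> `|h| < d -> `|l - F h| < e.
Proof.
split=> [/cvgrPdist_lt Fl e e0|hF].
  have := Fl e e0; rewrite near_withinE => /nbhs_ballP[d /= d0 hd].
  by exists d => // h h0 hd'; apply: hd => //; rewrite -ball_normE /= sub0r normrN.
apply/cvgrPdist_lt => e e0; have [d d0 hd] := hF e e0.
rewrite near_withinE; apply/nbhs_ballP; exists d => // h /=.
by rewrite -ball_normE /= sub0r normrN => hd' h0; exact: hd.
Qed.

(** Without a quotient, and with h = 0 allowed, the estimate is easily added, composed
  and restricted. *)
Lemma is_derive_littleoP F x l : is_derive x (1 : R) F l <->
  forall e : R, 0 < e -> exists2 d : R, 0 < d &
    forall h, `|h| < d -> `|F (x + h) - F x - h *: l| <= e * `|h|.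
Proof.
have quot h : h != 0 -> `|F (x + h) - F x - h *: l| =
    `|l - h^-1 *: (F (h *: (1 : R) + x) - F x)| * `|h|.
  move=> h0; rewrite mulrC -normrZ scalerBr scalerA divff// scale1r.
  by rewrite [h *: 1]mulr1 [h + x]addrC distrC.
split=> [dF e e0|hF].
  have /cvg_dnbhs0P/(_ e e0)[d d0 hd] :
      (fun h : R => h^-1 *: (F (h *: (1 : R) + x) - F x)) @ (0 : R)^' --> l.
    by case: dF => dF <-; exact: dF.
  exists d => // h hd'; have [->|h0] := eqVneq h 0.
    by rewrite addr0 scale0r subrr subr0 !normr0 mulr0.
  by rewrite quot// ler_wpM2r// ltW// hd.
suff cl : (fun h : R => h^-1 *: (F (h *: (1 : R) + x) - F x)) @ (0 : R)^' --> l.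
  by apply: DeriveDef; [apply/cvg_ex; exists l; exact: cl|exact: (cvg_lim _ cl)].
apply/cvg_dnbhs0P => e e0; have e2 : 0 < e / 2 by rewrite divr_gt0.
have [d d0 hd] := hF _ e2; exists d => // h h0 hd'.
have h0' : 0 < `|h| by rewrite normr_gt0.
have := hd h hd'; rewrite quot// ler_pM2r// => /le_lt_trans; apply.
by rewrite ltr_pdivrMr// ltr_pMr// ltr1n.
Qed.

Lemma is_derive_origin F z : is_derive (0 : R) (1 : R) F z <->
  (fun h : R => h^-1 *: (F h - F 0)) @ (0 : R)^' --> z.
Proof.
have quot t : t != 0 -> `|F t - F 0 - t *: z| = `|t| * `|z - t^-1 *: (F t - F 0)|.
  by move=> t0; rewrite -normrZ scalerBr scalerA divff// scale1r distrC.
split=> [/is_derive_littleoP h|/cvg_dnbhs0P h].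
  apply/cvg_dnbhs0P => e e0; have e2 : 0 < e / 2 by rewrite divr_gt0.
  have [d d0 hd] := h _ e2; exists d => // t t0 td.
  have t0' : 0 < `|t| by rewrite normr_gt0.
  have := hd t td; rewrite add0r quot// mulrC ler_pM2r// => /le_lt_trans; apply.
  by rewrite ltr_pdivrMr// ltr_pMr// ltr1n.
apply/is_derive_littleoP => e e0; have [d d0 hd] := h e e0; exists d => // t td; rewrite add0r.
have [->|t0] := eqVneq t 0; first by rewrite scale0r subrr subr0 !normr0 mulr0.
by rewrite quot// mulrC ler_wpM2r// ltW// hd.
Qed.

Lemma is_derive_near F G x l : (exists2 d : R, 0 < d & forall h, `|h| < d -> F (x + h) = G (x + h)) ->
  is_derive x (1 : R) G l -> is_derive x (1 : R) F l.
Proof.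
move=> [d0 d00 FG] /is_derive_littleoP dG; apply/is_derive_littleoP => e /dG[d d1 hd].
have F0 : F x = G x by rewrite -[x]addr0 FG// normr0.
exists (Num.min d d0) => [|h]; first by rewrite lt_min d1.
by rewrite lt_min => /andP[hd1 hd2]; rewrite FG// F0; exact: hd.
Qed.

Lemma is_derive_shift F x c l : is_derive (c + x) (1 : R) F l ->
  is_derive x (1 : R) (fun t => F (c + t)) l.
Proof.
move=> /is_derive_littleoP dF; apply/is_derive_littleoP => e /dF[d d0 hd].
by exists d => // h /hd; rewrite addrA.
Qed.

Lemma is_derive_continuous F x l : is_derive x (1 : R) F l -> {for x, continuous F}.
Proof.
by move=> [dF _]; apply/differentiable_continuous/derivable1_diffP.
Qed.

End Derivatives.

Section DerivativeIp.
Context {R : realType} {k : scalar_kind} {H : hilbertType R k}.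
Implicit Types (F G : R -> H).

Lemma is_derive_ip F G x l m : is_derive x (1 : R) F l -> is_derive x (1 : R) G m ->
  is_derive x (1 : R) (fun t => ip (F t) (G t)) (ip l (G x) + ip (F x) m).
Proof.
move=> dF dG.
have cG := is_derive_continuous dG.
move: dF dG => [dF <-] [dG <-].
suff cl : (fun h : R => h^-1 *: (ip (F (h *: (1 : R) + x)) (G (h *: (1 : R) + x)) - ip (F x) (G x)))
    @ (0 : R)^' --> (ip ('D_1 F x) (G x) + ip (F x) ('D_1 G x)).
  by apply: DeriveDef; [apply/cvg_ex; eexists; exact: cl|exact: (cvg_lim _ cl)].
have -> : (fun h : R => h^-1 *: (ip (F (h *: (1 : R) + x)) (G (h *: (1 : R) + x)) - ip (F x) (G x))) =
  (fun h : R => ip (h^-1 *: (F (h *: (1 : R) + x) - F x)) (G (h *: (1 : R) + x)) +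
    ip (F x) (h^-1 *: (G (h *: (1 : R) + x) - G x))).
  apply/funext => h; rewrite ipZl ipZr -mulrDr; congr (_ * _).
  by rewrite ipBl ipBr; ring.
apply: cvgD; apply: cvg_ip => //; last exact: cvg_cst.
have -> : G x = G (0 *: (1 : R) + x) by rewrite scale0r add0r.
apply: cvg_within_filter; apply: continuous_cvg; first by rewrite scale0r add0r.
apply: cvgD; last exact: cvg_cst.
by apply: cvgZr_tmp; exact: cvg_id.
Qed.

Lemma is_derive_ipl F x l v : is_derive x (1 : R) F l ->
  is_derive x (1 : R) (fun t => ip (F t) v) (ip l v).
Proof.
move=> dF; have := is_derive_ip dF (is_derive_cst v x (1 : R)).
by rewrite ip0r addr0.
Qed.

Lemma is_derive_ipr F x l v : is_derive x (1 : R) F l ->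
  is_derive x (1 : R) (fun t => ip v (F t)) (ip v l).
Proof.
move=> dF; have := is_derive_ip (is_derive_cst v x (1 : R)) dF.
by rewrite ip0l add0r.
Qed.

Lemma is_derive_operator (K : H -> H) F x l : bounded_operator K ->
  is_derive x (1 : R) F l -> is_derive x (1 : R) (K \o F) (K l).
Proof.
move=> bK; have [C C0 KC] := bounded_operator_bound bK; have [kK _] := bK.
move=> /is_derive_littleoP dF; apply/is_derive_littleoP => e e0.
have [d d0 hd] := dF (e / C) (divr_gt0 e0 C0).
exists d => // h /hd {}hd; rewrite /= -klinearZ// -!klinearB//.
apply: le_trans (KC _) _; rewrite -ler_pdivlMl//; apply: le_trans hd _.
by rewrite mulrA [C^-1 * e]mulrC.
Qed.

Lemma is_derive_scale (r : R -> R) F x (r' : R) l : is_derive x (1 : R) r r' ->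
  is_derive x (1 : R) F l ->
  is_derive x (1 : R) (fun t => r t *: F t) (r' *: F x + r x *: l).
Proof.
move=> dr dF; have cF := is_derive_continuous dF.
move: dr dF => [dr <-] [dF <-].
suff cl : (fun h : R => h^-1 *: (r (h *: (1 : R) + x) *: F (h *: (1 : R) + x) - r x *: F x))
    @ (0 : R)^' --> ('D_1 r x *: F x + r x *: 'D_1 F x).
  by apply: DeriveDef; [apply/cvg_ex; eexists; exact: cl|exact: (cvg_lim _ cl)].
have -> : (fun h : R => h^-1 *: (r (h *: (1 : R) + x) *: F (h *: (1 : R) + x) - r x *: F x)) =
  (fun h : R => (h^-1 *: (r (h *: (1 : R) + x) - r x)) *: F (h *: (1 : R) + x) +
    r x *: (h^-1 *: (F (h *: (1 : R) + x) - F x))).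
  apply/funext => h; rewrite [r x *: (_ *: _)]scalerA [r x * _]mulrC -[(_ * r x) *: _]scalerA.
  rewrite -[h^-1 *: (_ - r x)]/(h^-1 * (_ - r x)) -scalerA -scalerDr; congr (_ *: _).
  by rewrite scalerBl scalerBr addrA subrK.
apply: cvgD; last by apply: cvgZ; [exact: cvg_cst|exact: dF].
apply: cvgZ; first exact: dr.
have -> : F x = F (0 *: (1 : R) + x) by rewrite scale0r add0r.
apply: cvg_within_filter; apply: continuous_cvg; first by rewrite scale0r add0r.
apply: cvgD; last exact: cvg_cst.
by apply: cvgZr_tmp; exact: cvg_id.
Qed.

End DerivativeIp.

Section WeakIntegral.
Context {R : realType} {k : scalar_kind} {H : hilbertType R k}.
Implicit Types (f : R -> H) (a b : R).

(** The weak (Pettis) integral; for a continuous curve Riesz representation shows that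
  there is something to choose. *)
Definition wint a b f : H :=
  xget 0 [set w | forall x, ip x w = itg a b (fun t => ip x (f t))].

Lemma continuous_ip (f g : R -> H) : continuous f -> continuous g ->
  continuous (fun t => ip (f t) (g t)).
Proof. by move=> cf cg t; apply: cvg_ip; [exact: cf|exact: cg]. Qed.

Lemma continuous_ipr x f : continuous f -> continuous (fun t => ip x (f t)).
Proof. by move=> cf; apply: continuous_ip => // t; exact: cvg_cst. Qed.

Lemma continuous_normr_fun f : continuous f -> continuous (fun t => `|f t|).
Proof. by move=> cf t; apply: cvg_norm; exact: cf. Qed.

Lemma wint_ip f a b x : continuous f ->
  ip x (wint a b f) = itg a b (fun t => ip x (f t)).
Proof.
move=> cf; rewrite /wint; set P := [set w | _].
have ci y : itgb a b (fun t => ip y (f t)) by apply: itgb_continuous; exact: continuous_ipr.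
have cn : itgb a b (fun t => `|f t|) by apply: itgb_continuous; exact: continuous_normr_fun.
have [|||w hw _] := @riesz R k H (fun y => itg a b (fun t => ip y (f t))) (itg a b (fun t => `|f t|)).
- move=> r y z; rewrite -itgZ// -itgD//; last exact: itgbZ.
  by apply: eq_itg => t _; rewrite ipDl ipZl.
- exact: itg_ge0.
- move=> y; apply: le_trans (norm_itg (ci y)) _; rewrite mulrC -itgZ//.
  by apply: le_itg; [exact: itgb_norm|exact: itgbZ|move=> t _; exact: ip_CS].
exact: (@xgetI _ 0 P w hw).
Qed.

Lemma wint_norm_le f a b : continuous f -> `|wint a b f| <= itg a b (fun t => `|f t|).
Proof.
move=> cf.
have cn : itgb a b (fun t => `|f t|) by apply: itgb_continuous; exact: continuous_normr_fun.
apply: norm_le_ip => [|y]; first exact: itg_ge0.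
rewrite wint_ip// mulrC -itgZ//; apply: le_itg.
- by apply: itgb_continuous; exact: continuous_ipr.
- exact: itgbZ.
- by move=> t _; exact: ip_le.
Qed.

Lemma wint_norm_le_cst f a b (C : R) : a <= b -> continuous f ->
  (forall t, a < t < b -> `|f t| <= C) -> `|wint a b f| <= C * (b - a).
Proof.
move=> ab cf fC; apply: le_trans (wint_norm_le _ _ cf) _; rewrite -itg_cst//.
apply: le_itg => //; last exact: itgb_cst.
by apply: itgb_continuous; exact: continuous_normr_fun.
Qed.

Lemma wint_operator (K : H -> H) f a b : bounded_operator K -> continuous f ->
  K (wint a b f) = wint a b (K \o f).
Proof.
move=> bK cf; have cKf : continuous (K \o f).
  by move=> t; apply: bounded_operator_cvg => //; exact: cf.
apply: ip_inj => x; rewrite -ip_badjoint// !wint_ip//.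
by apply: eq_itg => t _; rewrite ip_badjoint.
Qed.

Lemma wint_refl f a : wint a a f = 0.
Proof.
rewrite /wint; set P := [set w | _].
have P0 : P 0 by move=> x; rewrite ip0r itg_refl.
have Pw : P (xget 0 P) by exact: xgetI P0.
by apply: ip_eq0 => y; rewrite Pw itg_refl.
Qed.

Lemma wint_chasles f a b c : a <= b -> b <= c -> continuous f ->
  wint a c f = wint a b f + wint b c f.
Proof.
move=> ab bc cf; apply: ip_inj => x; rewrite ipDr !wint_ip//.
by apply: itg_chasles => //; apply: itgb_continuous; exact: continuous_ipr.
Qed.

Lemma eq_wint f g a b : continuous f -> continuous g ->
  (forall t, a < t < b -> f t = g t) -> wint a b f = wint a b g.
Proof.
move=> cf cg fg; apply: ip_inj => x; rewrite !wint_ip//.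
by apply: eq_itg => t tab; rewrite fg.
Qed.

Lemma wint_shift f a b c : a <= b -> continuous f ->
  wint (a + c) (b + c) f = wint a b (fun t => f (t + c)).
Proof.
move=> ab cf; have cf' : continuous (fun t => f (t + c)).
  move=> x; apply: continuous_comp; last exact: cf.
  by apply: cvgD; [exact: cvg_id|exact: cvg_cst].
apply: ip_inj => x; rewrite !wint_ip// itg_shift//.
exact: continuous_ipr.
Qed.

Lemma is_derive_wint f a x : continuous f -> a < x ->
  is_derive x (1 : R) (fun t => wint a t f) (f x).
Proof.
move=> cf ax; apply/is_derive_littleoP => e e0.
have /cvgrPdist_le/(_ e e0)/nbhs_ballP[d /= d0 hd] := cf x.
have near_x t : `|t - x| < d -> `|f t - f x| <= e.
  by move=> tx; rewrite distrC; apply: hd; rewrite -ball_normE /= distrC.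
have inc s t : s <= t -> (s = x \/ t = x) -> `|t - s| < d ->
    `|wint s t f - (t - s) *: f x| <= e * (t - s).
  move=> st sx ts.
  have ci : itgb s t (fun u => ip (f x) (f u - f x)).
    apply: itgb_continuous; apply: continuous_ipr => u; apply: cvgB; [exact: cf|exact: cvg_cst].
  apply: norm_le_ip => [|y]; first by rewrite mulr_ge0 ?subr_ge0// ltW.
  have ciy : itgb s t (fun u => ip y (f u)) by apply: itgb_continuous; exact: continuous_ipr.
  have -> : ip y (wint s t f - (t - s) *: f x) = itg s t (fun u => ip y (f u) - ip y (f x)).
    by rewrite itgB ?itg_cst ?ipBr ?ipZr ?wint_ip// 1?mulrC//; exact: itgb_cst.
  rewrite mulrAC -itg_cst//; apply: le_itg; [|exact: itgb_cst|].
    by apply: itgbB => //; exact: itgb_cst.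
  move=> u /andP[su ut]; rewrite -ipBr; apply: le_trans (ip_le _ _) _.
  rewrite mulrC; apply: ler_wpM2r => //; apply: near_x.
  rewrite ger0_norm ?subr_ge0// in ts.
  by case: sx => sx; rewrite ltr_norml; subst; apply/andP; split; lra.
exists (Num.min d (x - a)) => [|h]; first by rewrite lt_min d0 subr_gt0.
rewrite lt_min => /andP[hd' hxa].
have [h0|h0] := leP 0 h.
  have -> : wint a (x + h) f - wint a x f = wint x (x + h) f.
    by rewrite (wint_chasles (ltW ax) _ cf) ?lerDl// addrAC subrr add0r.
  have hd2 : h < d by rewrite ger0_norm in hd'.
  rewrite (ger0_norm h0); have := inc x (x + h).
  rewrite lerDl h0 [x + h - x]addrAC subrr add0r (ger0_norm h0).
  by apply => //; left.
have axh : a <= x + h by move: hxa; rewrite ltr0_norm//; lra.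
have -> : wint a (x + h) f - wint a x f = - wint (x + h) x f.
  rewrite (@wint_chasles f a (x + h) x)//; last by rewrite gerDl ltW.
  by rewrite opprD addrA subrr sub0r.
rewrite -opprD normrN.
have := inc (x + h) x; rewrite gerDl (ltW h0).
have -> : x - (x + h) = - h by ring.
rewrite scaleNr opprK normrN (ltr0_norm h0); apply => //; first by right.
by rewrite ltr0_norm in hd'.
Qed.

End WeakIntegral.

(** * Strongly continuous groups *)

Section Generator.
Context {R : realType} {k : scalar_kind} {H : hilbertType R k}.
Variables (S : R -> H -> H) (A : operator H).
Hypotheses (hS : strongly_continuous_group S) (hA : generator S A).

Lemma group_bounded t : bounded_operator (S t).
Proof. by case: hS. Qed.

Lemma group_klinear t : klinear (S t).
Proof. by case: (group_bounded t). Qed.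

Lemma group0 x : S 0 x = x.
Proof. by case: hS => _ -> _ _. Qed.

Lemma groupD s t x : S (s + t) x = S s (S t x).
Proof. by case: hS. Qed.

Lemma group_cont x : continuous (fun t => S t x).
Proof. by case: hS. Qed.

Lemma groupVK t x : S (- t) (S t x) = x.
Proof. by rewrite -groupD addNr group0. Qed.

Lemma groupKV t x : S t (S (- t) x) = x.
Proof. by rewrite -groupD subrr group0. Qed.

(** Banach-Steinhaus: an orbit is continuous, hence bounded on [- T, T]. *)
Lemma group_local_bound (T : R) : exists2 M : R, 1 <= M &
  forall t x, `|t| <= T -> `|S t x| <= M * `|x|.
Proof.
have [|x|M hM] := @Banach_Steinhauss R H H [set f | exists2 t, `|t| <= T & f = S t] _ _ 1.
- move=> _ [t tT ->]; have [C C0 hC] := bounded_operator_bound (group_bounded t).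
  split; last exact: klinear_linear (group_klinear t).
  by move=> r; exists (C * r) => x xr; apply: le_trans (hC x) _; rewrite ler_pM2l.
- have [C C0 hC] := continuous_bounded_itv (- T) T (group_cont (x := x)).
  by exists C => _ [t tT ->]; apply: hC; rewrite -ler_norml.
exists (Num.max 1 M) => [|t x tT]; first by rewrite le_max lexx.
have [->|x0] := eqVneq x 0.
  by rewrite klinear0 ?normr0 ?mulr0//; exact: group_klinear.
have nx : 0 < `|x| by rewrite normr_gt0.
apply: (@le_trans _ _ (M * `|x|)); last by rewrite ler_pM2r// le_max lexx orbT.
have := hM (S t) (ex_intro2 _ _ t tT erefl) (`|x|^-1 *: x).
rewrite normrZ normfV normr_id mulVf ?gt_eqF// => /(_ (lexx _)).
rewrite klinearZ; last exact: group_klinear.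
by rewrite normrZ normfV normr_id mulrC ler_pdivrMr.
Qed.

(** Each step of length at most 1 costs a factor M. *)
Lemma group_growth : exists M w : R, [/\ 1 <= M, 0 <= w &
  forall t x, `|S t x| <= M * expR (w * `|t|) * `|x|].
Proof.
have [M M1 hM] := group_local_bound 1.
have M0 : 0 < M by apply: lt_le_trans M1.
exists M, (ln M); split => //; first exact: ln_ge0.
have pow (n : nat) : forall t x, `|t| <= n%:R -> `|S t x| <= M ^+ n * `|x|.
  elim: n => [|n IH] t x; first by rewrite normr_le0 => /eqP ->; rewrite group0 expr0 mul1r.
  move=> tn; have n0 : (0 : R) < n.+1%:R by rewrite ltr0n.
  have -> : t = t / n.+1%:R + t * (n%:R / n.+1%:R).
    have -> : (n%:R : R) = n.+1%:R - 1 by rewrite -natr1 addrK.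
    by field; rewrite gt_eqF.
  rewrite groupD exprS -mulrA; apply: le_trans (hM _ _ _) _.
    by rewrite normrM normfV [`|n.+1%:R|]gtr0_norm// ler_pdivrMr// mul1r.
  rewrite ler_pM2l//; apply: IH.
  rewrite normrM [`|n%:R / _|]ger0_norm ?divr_ge0//.
  rewrite mulrA ler_pdivrMr// mulrC ler_wpM2l//.
move=> t x; have tn : `|t| <= (Num.truncn `|t|).+1%:R by rewrite ltW// truncnS_gt.
apply: le_trans (pow _ _ _ tn) _; rewrite ler_wpM2r// exprS ler_pM2l//.
rewrite -[X in X ^+ _](lnK (_ : M \is Num.pos))// -expRM_natl ler_expR.
by rewrite mulrC ler_wpM2l ?ln_ge0// truncn_le.
Qed.

(** Joint continuity, from strong continuity in t and the local bound in x. *)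
Lemma group_cvg {T : Type} {F : set_system T} {FF : Filter F} (s : T -> R) (f : T -> H) t x :
  s @ F --> t -> f @ F --> x -> S (s u) (f u) @[u --> F] --> S t x.
Proof.
move=> st fx; have [M M1 hM] := group_local_bound (`|t| + 1).
have M0 : 0 < M by apply: lt_le_trans M1.
have c1 : S (s u) x @[u --> F] --> S t x by exact: (cvg_comp _ _ st (@group_cont x t)).
apply/cvgrPdist_lt => e e0; have e2 : 0 < e / 2 by rewrite divr_gt0.
have eM : 0 < e / 2 / M by rewrite divr_gt0.
near=> u.
have -> : S t x - S (s u) (f u) = (S t x - S (s u) x) + S (s u) (x - f u).
  by rewrite (klinearB _ _ (group_klinear _)) addrA subrK.
apply: le_lt_trans (ler_normD _ _) _; rewrite [e]splitr; apply: ltrD.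
  by near: u; move/cvgrPdist_lt : c1; apply.
have su : `|s u| <= `|t| + 1.
  have : `|t - s u| < 1 by near: u; move/cvgrPdist_lt : st; apply.
  move=> h; have := ler_normB t (t - s u); rewrite opprB addrC subrK => h2.
  by apply: le_trans h2 _; rewrite lerD2l ltW.
apply: le_lt_trans (hM _ _ su) _; rewrite -ltr_pdivlMl// mulrC.
by near: u; move/cvgrPdist_lt : fx; apply.
Unshelve. all: by end_near. Qed.

Lemma group_continuous (s : R -> R) (f : R -> H) : continuous s -> continuous f ->
  continuous (fun t => S (s t) (f t)).
Proof. by move=> cs cf t; apply: group_cvg; [exact: cs|exact: cf]. Qed.

Lemma generator_derive x z : (dom A x /\ A x = z) <->
  is_derive (0 : R) (1 : R) (fun t => S t x) z.
Proof.
have h := is_derive_origin (fun t => S t x) z; rewrite group0 in h.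
by split=> [/hA/h|/h/hA].
Qed.

Lemma generator_group_derive x t : dom A x ->
  is_derive t (1 : R) (fun t => S t x) (S t (A x)).
Proof.
move=> Dx; have /generator_derive h : dom A x /\ A x = A x by [].
have := is_derive_operator (group_bounded t) h.
move=> /is_derive_littleoP h2; apply/is_derive_littleoP => e /h2[d d0 hd].
by exists d => // u /hd; rewrite /= add0r -!groupD addr0.
Qed.

Lemma generator_group x t : dom A x -> dom A (S t x) /\ A (S t x) = S t (A x).
Proof.
move=> Dx; apply/generator_derive.
have /is_derive_littleoP h := generator_group_derive t Dx.
apply/is_derive_littleoP => e /h[d d0 hd].
by exists d => // u /hd; rewrite add0r group0 -groupD [u + t]addrC.
Qed.

Lemma generator_linear a x y : dom A x -> dom A y ->
  dom A (act a x + y) /\ A (act a x + y) = act a (A x) + A y.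
Proof.
move=> Dx Dy; apply/generator_derive.
have /generator_derive hx : dom A x /\ A x = A x by [].
have /generator_derive hy : dom A y /\ A y = A y by [].
have kact : klinear (act a : H -> H).
  move=> b u v; rewrite actDr !actA; congr (act _ _ + _).
  by apply: scalar_eq; rewrite ?scalar_ReM ?scalar_ImM; ring.
have bact : bounded_operator (act a : H -> H).
  apply: (@klinear_bounded_operator _ _ _ _ _ (modulus a)) => // u.
  have m0 : 0 <= modulus a by rewrite sqrtr_ge0.
  by rewrite -(@ler_pXn2r _ 2) ?nnegrE ?mulr_ge0// norm_act exprMn.
have -> : (fun t => S t (act a x + y)) = (act a \o S^~ x) + S^~ y.
  by apply/funext => t; rewrite group_klinear.
exact: is_deriveD (is_derive_operator bact hx) hy.
Qed.

Lemma generator0 : dom A 0.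
Proof.
suff [] : dom A 0 /\ A 0 = 0 by [].
apply/generator_derive/is_derive_littleoP => e e0; exists 1 => // h _.
rewrite add0r !(klinear0 (group_klinear _)) scaler0 !subr0 normr0.
by rewrite mulr_ge0// ltW.
Qed.

Lemma generator0_val : A 0 = 0.
Proof.
have [_] := generator_linear 1 generator0 generator0; rewrite !act1 !addr0 => h.
by apply: (addrI (A 0)); rewrite addr0.
Qed.

Lemma generator_act a x : dom A x -> dom A (act a x) /\ A (act a x) = act a (A x).
Proof.
move=> Dx; have := generator_linear a Dx generator0.
by rewrite generator0_val !addr0.
Qed.

Lemma generator_subspace : subspace (dom A).
Proof. by split; [exact: generator0|move=> a x y Dx Dy; have [] := generator_linear a Dx Dy]. Qed.

(** x is the limit of the means of its orbit over short intervals.  These are in the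
  domain because S t only translates the interval of integration. *)
Lemma generator_dense : norm_dense (dom A).
Proof.
move=> x e e0; pose f t := S t x; have cf : continuous f := group_cont (x := x).
have /cvgrPdist_lt/(_ _ (_ : 0 < e / 2))/nbhs_ballP[|d /= d0 hd] := cf 0.
  by rewrite divr_gt0.
pose h := d / 2; have h0 : 0 < h by rewrite divr_gt0.
pose y := h^-1 *: wint 0 h f.
have Dw : dom A (wint 0 h f).
  suff [] : dom A (wint 0 h f) /\ A (wint 0 h f) = S h x - x by [].
  apply/generator_derive.
  have e1 t : - 1 <= t -> S t (wint 0 h f) = wint (-1) (h + t) f - wint (-1) t f.
    move=> t1; rewrite wint_operator//; last exact: group_bounded.
    have -> : wint 0 h (S t \o f) = wint (0 + t) (h + t) f.
      rewrite wint_shift ?ltW//; apply: eq_wint => //.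
      - by move=> u; apply: group_cvg; [exact: cvg_cst|exact: cf].
      - move=> u; apply: continuous_comp; last exact: cf.
        by apply: cvgD; [exact: cvg_id|exact: cvg_cst].
      - by move=> u _; rewrite /f /= addrC groupD.
    rewrite add0r (@wint_chasles _ _ _ f (-1) t (h + t))//; last by rewrite lerDr ltW.
    by rewrite addrAC subrr add0r.
  apply: (@is_derive_near _ _ _ ((fun t => wint (-1) (h + t) f) - (fun t => wint (-1) t f))).
    exists 1 => // t; rewrite add0r ltr_norml => /andP[/ltW t1 _].
    by rewrite e1.
  have -> : S h x - x = f h - f 0 by rewrite /f group0.
  apply: is_deriveB; last by apply: is_derive_wint => //; rewrite ltrN10.
  apply: (@is_derive_shift _ _ (fun t => wint (-1) t f)).
  by rewrite addr0; apply: is_derive_wint => //; lra.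
exists y; first by apply: real_subspaceZ => //; exact: subspace_real generator_subspace.
have -> : x - y = h^-1 *: (h *: x - wint 0 h f).
  by rewrite scalerBr scalerA mulVf ?scale1r// gt_eqF.
rewrite normrZ ger0_norm ?invr_ge0 ?ltW//.
apply: (@le_lt_trans _ _ (h^-1 * (e / 2 * (h - 0)))).
  rewrite ler_pM2l ?invr_gt0//.
  have -> : h *: x - wint 0 h f = wint 0 h (fun t => x - f t).
    apply: ip_inj => z; rewrite ipBr ipZr !wint_ip//; last first.
      by move=> u; apply: cvgB; [exact: cvg_cst|exact: cf].
    have -> : itg 0 h (fun t => ip z (x - f t)) = itg 0 h (fun t => ip z x - ip z (f t)).
      by apply: eq_itg => t _; rewrite ipBr.
    rewrite itgB ?itg_cst ?subr0 1?mulrC// ?ltW//; first exact: itgb_cst.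
    by apply: itgb_continuous; exact: continuous_ipr.
  apply: wint_norm_le_cst; first exact: ltW.
    by move=> u; apply: cvgB; [exact: cvg_cst|exact: cf].
  move=> t /andP[t0 th]; have := hd t; rewrite /f group0 => h'; apply/ltW/h'.
  rewrite -ball_normE /= sub0r normrN gtr0_norm//; apply: lt_trans th _.
  by rewrite /h ltr_pdivrMr// ltr_pMr// ltr1n.
by rewrite subr0 mulrCA mulVf ?gt_eqF// mulr1 ltr_pdivrMr// ltr_pMr// ltr1n.
Qed.

End Generator.

(** * The adjoint group *)

Section AdjointGroup.
Context {R : realType} {k : scalar_kind} {H : hilbertType R k}.
Variables (S : R -> H -> H) (A : operator H).
Hypotheses (hS : strongly_continuous_group S) (hA : generator S A).
Local Notation S' := (adjoint_group S).
Local Notation A' := (adjoint A).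

Lemma adjoint_ip phi x : dom A' phi -> dom A x -> ip (A x) phi = ip x (A' phi).
Proof.
move=> Dphi Dx; rewrite /ip; congr scalar_Re.
have : [set z | forall x, dom A x -> inner (A x) phi = inner x z] (A' phi).
  by case: Dphi => z hz; rewrite /adjoint /=; set P := [set z | _]; exact: (@xgetI _ 0 P z hz).
by apply.
Qed.

(** Real parts suffice because the domain of A is stable under multiplication by i. *)
Lemma adjoint_domP phi z : (forall x, dom A x -> ip (A x) phi = ip x z) ->
  dom A' phi /\ A' phi = z.
Proof.
move=> h; have Dphi : dom A' phi.
  exists z => x Dx; apply: inner_eq; first exact: h.
  have [Dax Aax] := generator_act hS hA (scalar_conj imaginary_unit) Dx.
  by rewrite Im_inner !ip_actr -h// Aax.
split=> //; apply: (norm_dense_ip_inj (generator_dense hS hA)) => x Dx.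
by rewrite -adjoint_ip// h.
Qed.

Lemma adjoint_klinear t : klinear (S' t).
Proof. exact: badjoint_klinear (group_bounded hS t). Qed.

Lemma adjoint_groupD s t x : S' (s + t) x = S' s (S' t x).
Proof.
apply: ip_inj => y; rewrite /adjoint_group -!badjoint_ip; try exact: group_bounded.
by rewrite -(groupD hS) addrC.
Qed.

Lemma adjoint_group0 x : S' 0 x = x.
Proof.
apply: ip_inj => y; rewrite /adjoint_group -badjoint_ip; last exact: group_bounded.
by rewrite group0.
Qed.

Lemma adjoint_group_local_bound (T : R) : exists2 M : R, 1 <= M &
  forall t x, `|t| <= T -> `|S' t x| <= M * `|x|.
Proof.
have [M M1 hM] := group_local_bound hS T; exists M => // t x tT.
apply: badjoint_bound; [exact: group_bounded|exact: le_trans M1|].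
by move=> y; exact: hM.
Qed.

Lemma adjoint_subspace : subspace (dom A').
Proof.
split; first by have [] : dom A' 0 /\ A' 0 = 0 by apply: adjoint_domP => x _; rewrite !ip0r.
move=> a x y Dx Dy.
suff [] : dom A' (act a x + y) /\ A' (act a x + y) = act a (A' x) + A' y by [].
apply: adjoint_domP => u Du; have [Dau Aau] := generator_act hS hA (scalar_conj a) Du.
by rewrite !ipDr !ip_actr (adjoint_ip Dy Du) -Aau adjoint_ip.
Qed.

Lemma group_increment_itg x phi t : 0 <= t -> dom A x -> dom A' phi ->
  ip x (S' t phi) - ip x phi = itg 0 t (fun s => ip (S s x) (A' phi)).
Proof.
move=> t0 Dx Dphi.
have cS y z : continuous (fun s => ip (S s y) z).
  by apply: continuous_ip => s; [exact: group_cont|exact: cvg_cst].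
have -> : itg 0 t (fun s => ip (S s x) (A' phi)) = ip (S t x) phi - ip (S 0 x) phi.
  apply: (@itg_FTC2 _ (fun s => ip (S s x) phi)) => //.
  - exact: continuous_subspaceT.
  - exact: continuous_subspaceT.
  move=> s _; have [DSx ASx] := generator_group hS hA s Dx.
  by rewrite -adjoint_ip// ASx; apply: is_derive_ipl; exact: generator_group_derive.
by rewrite group0// /adjoint_group -badjoint_ip//; exact: group_bounded.
Qed.

(** If x is orthogonal to the domain of the adjoint, the mean of <S s x, x> over [0, h]
  vanishes, because it is <x, w> for the mean w of the adjoint orbit of x, which is in
  that domain.  But <S s x, x> is close to |x|^2.  As the strong continuity of the
  adjoint group is not yet established, w is defined by Riesz representation. *)
Lemma adjoint_dense : norm_dense (dom A').
Proof.
apply: orthogonal_dense; first exact: subspace_real adjoint_subspace.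
move=> x hx; apply/eqP/negPn/negP => x0.
have n0 : 0 < `|x| ^+ 2 by rewrite exprn_gt0 ?normr_gt0.
have cS : continuous (fun s => ip (S s x) x).
  by apply: continuous_ip => s; [exact: group_cont|exact: cvg_cst].
have /cvgrPdist_lt/(_ (`|x| ^+ 2 / 2) (divr_gt0 n0 (ltr0n _ 2)))/nbhs_ballP[d /= d0 hd] := cS 0.
pose h := d / 2; have h0 : 0 < h by rewrite divr_gt0.
have [M M1 hM] := group_local_bound hS h.
have M0 : 0 <= M by apply: le_trans M1.
have cf y : continuous (fun s => ip (S s y) x).
  by apply: continuous_ip => s; [exact: group_cont|exact: cvg_cst].
have cI y : itgb 0 h (fun s => ip (S s y) x) by exact: itgb_continuous.
have [|||w hw _] := @riesz R k H (fun y => itg 0 h (fun s => ip (S s y) x)) (M * `|x| * h).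
- move=> r y z; rewrite -itgZ// -itgD//; last exact: itgbZ.
  apply: eq_itg => s _; rewrite klinearD ?klinearZ ?ipDl ?ipZl//; exact: group_klinear.
- by rewrite !mulr_ge0// ltW.
- move=> y; have -> : M * `|x| * h * `|y| = M * `|y| * `|x| * (h - 0) by ring.
  apply: norm_itg_le => //; first exact: ltW.
  move=> s /andP[s0 sh]; apply: le_trans (ip_CS _ _) _; apply: ler_wpM2r => //.
  by apply: hM; rewrite gtr0_norm// ltW.
have Dw : dom A' w.
  suff [] : dom A' w /\ A' w = S' h x - x by [].
  apply: adjoint_domP => y Dy; rewrite hw ipBr.
  have -> : itg 0 h (fun s => ip (S s (A y)) x) = ip (S h y) x - ip (S 0 y) x.
    apply: (@itg_FTC2 _ (fun s => ip (S s y) x)); first exact: ltW.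
    - exact: continuous_subspaceT.
    - exact: continuous_subspaceT.
    by move=> s _; apply: is_derive_ipl; exact: generator_group_derive.
  by rewrite group0// /adjoint_group -badjoint_ip//; exact: group_bounded.
have := hx _ Dw; rewrite ipC hw => hh.
have : `|x| ^+ 2 / 2 * (h - 0) <= itg 0 h (fun s => ip (S s x) x).
  have -> : `|x| ^+ 2 / 2 * (h - 0) = itg 0 h (fun=> `|x| ^+ 2 / 2) by rewrite itg_cst// ltW.
  apply: le_itg => //; first exact: itgb_cst.
  move=> s /andP[s0 sh].
  have : ball 0 d s.
    rewrite -ball_normE /= sub0r normrN gtr0_norm//; apply: lt_trans sh _.
    by rewrite /h ltr_pdivrMr// ltr_pMr// ltr1n.
  move/hd => /=; rewrite group0// ip_norm ltr_norml => /andP[_]; lra.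
rewrite hh subr0 => hle; have : 0 < `|x| ^+ 2 / 2 * h by rewrite mulr_gt0// divr_gt0.
by rewrite ltNge hle.
Qed.

(** For phi in the domain, [group_increment_itg] bounds S' t phi - phi by a multiple of
  t; the general case follows by density and the local bound. *)
Lemma adjoint_group_cvg0 x : S' t x @[t --> (0 : R)] --> x.
Proof.
have [M M1 hM] := adjoint_group_local_bound 1; have M0 : 0 < M by apply: lt_le_trans M1.
have [N N1 hN] := group_local_bound hS 1; have N0 : 0 < N by apply: lt_le_trans N1.
have pos phi t : dom A' phi -> 0 <= t <= 1 -> `|S' t phi - phi| <= N * `|A' phi| * t.
  move=> Dphi /andP[t0 t1]; apply: (norm_dense_ip_le (generator_dense hS hA)).
    by rewrite !mulr_ge0// ltW.
  move=> y Dy; rewrite ipBr group_increment_itg//.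
  apply: le_trans (ler_norm _) _.
  have -> : N * `|A' phi| * t * `|y| = N * `|y| * `|A' phi| * (t - 0) by ring.
  apply: norm_itg_le => //.
    by apply: itgb_continuous; apply: continuous_ip => s; [exact: group_cont|exact: cvg_cst].
  move=> s /andP[s0 st]; apply: le_trans (ip_CS _ _) _; apply: ler_wpM2r => //.
  by apply: hN; rewrite gtr0_norm// ltW// (lt_le_trans st).
have all phi t : dom A' phi -> `|t| <= 1 -> `|S' t phi - phi| <= M * (N * `|A' phi| * `|t|).
  move=> Dphi t1; have [t0|t0] := leP 0 t.
    rewrite (ger0_norm t0); apply: le_trans (pos _ _ Dphi _) _.
      by rewrite t0 -(ger0_norm t0).
    by rewrite ler_peMl// !mulr_ge0// ltW.
  have -> : S' t phi - phi = - S' t (S' (- t) phi - phi).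
    rewrite (klinearB _ _ (adjoint_klinear t)) -adjoint_groupD subrr.
    by rewrite adjoint_group0 opprB.
  rewrite normrN; apply: le_trans (hM _ _ t1) _; rewrite ler_pM2l// (ltr0_norm t0).
  by apply: pos => //; rewrite oppr_ge0 ltW//= -(ltr0_norm t0).
apply/cvgrPdist_lt => e e0.
have e3 : 0 < e / 3 by rewrite divr_gt0.
have eM : 0 < e / 3 / M by rewrite divr_gt0.
have [phi Dphi hphi] := adjoint_dense x eM.
pose c := M * (N * `|A' phi|) + 1; have c0 : 0 < c by rewrite ltr_wpDl// !mulr_ge0// ltW.
near=> t.
have t1 : `|t| <= 1.
  by rewrite ltW//; near: t; apply/nbhs_ballP; exists 1 => //= s; rewrite -ball_normE /= sub0r normrN.
have tc : `|t| < e / 3 / c.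
  near: t; apply/nbhs_ballP; exists (e / 3 / c) => /=; first by rewrite divr_gt0.
  by move=> s; rewrite /ball_ /= sub0r normrN.
have -> : x - S' t x = (x - phi) - (S' t phi - phi) - S' t (x - phi).
  rewrite (klinearB _ _ (adjoint_klinear t)) !opprB.
  by rewrite !addrA !subrK.
have -> : e = e / 3 + e / 3 + e / 3 by field.
apply: le_lt_trans (ler_normB _ _) _; apply: ltrD; last first.
  by apply: le_lt_trans (hM _ _ t1) _; rewrite -ltr_pdivlMl// mulrC.
apply: le_lt_trans (ler_normB _ _) _; apply: ltrD.
  apply: lt_le_trans hphi _; rewrite ler_pdivrMr// ler_peMr// ltW//.
apply: le_lt_trans (all _ _ Dphi t1) _; rewrite mulrA.
rewrite ltr_pdivlMr// in tc; apply: le_lt_trans tc; rewrite mulrC; apply: ler_wpM2l => //.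
by rewrite /c lerDl.
Unshelve. all: by end_near. Qed.

Lemma adjoint_strongly_continuous : strongly_continuous_group S'.
Proof.
split; last first.
- move=> x t.
  have bS : bounded_operator (S' t) := badjoint_bounded (group_bounded hS t).
  have e1 : (fun s => S' s x) = (fun s => S' t (S' (s - t) x)).
    by apply/funext => s; rewrite -adjoint_groupD addrC subrK.
  have h : (fun s => S' t (S' (s - t) x)) @ t --> S' t x.
    apply: bounded_operator_cvg => //.
    apply: (cvg_comp (fun s => s - t) (fun s => S' s x) _ (@adjoint_group_cvg0 x)).
    have h0 : (fun s : R => s - t) @ t --> t - t by apply: cvgB; [exact: cvg_id|exact: cvg_cst].
    by rewrite subrr in h0.
  by move: h; rewrite -e1.
- exact: adjoint_groupD.
- by apply/funext => x; exact: adjoint_group0.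
- by move=> t; exact: badjoint_bounded (group_bounded hS t).
Qed.

(** If phi is in the domain of the adjoint, its orbit is the primitive of S' s (A' phi).
  Conversely, differentiate <S t x, phi> = <x, S' t phi> at t = 0. *)
Lemma adjoint_generator : generator S' A'.
Proof.
have sc := adjoint_strongly_continuous.
move=> phi z.
have eqv := is_derive_origin (fun t => S' t phi) z; rewrite adjoint_group0 in eqv.
rewrite -eqv; split=> [[Dphi <-]|dphi].
  pose g s := S' s (A' phi); have cg : continuous g by exact: group_cont sc _.
  have e1 t : 0 <= t -> S' t phi = phi + wint 0 t g.
    move=> t0; apply/eqP; rewrite addrC -subr_eq; apply/eqP.
    apply: (norm_dense_ip_inj (generator_dense hS hA)) => x Dx.
    rewrite ipBr group_increment_itg// wint_ip//; apply: eq_itg => s _.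
    by rewrite /g /adjoint_group -badjoint_ip//; exact: group_bounded.
  (* A primitive based at 0 is differentiable at positive times only, hence the detour
     through time 1. *)
  have dw : is_derive (1 : R) (1 : R) (fun t => phi + wint 0 t g) (g 1).
    have := is_deriveD (is_derive_cst phi (1 : R) (1 : R)) (is_derive_wint cg ltr01).
    by rewrite add0r.
  have {}dw := is_derive_operator (group_bounded sc (-1)) dw.
  have -> : A' phi = S' (-1) (g 1) by rewrite /g -(groupD sc) addNr (group0 sc).
  apply: (@is_derive_near _ _ _ (fun t => (S' (-1) \o (fun t => phi + wint 0 t g)) (1 + t))).
    exists 1 => // t; rewrite add0r ltr_norml => /andP[t1 _].
    by rewrite /= -e1 -?(groupD sc) ?addKr//; lra.
  by apply: (@is_derive_shift _ _ (S' (-1) \o (fun t => phi + wint 0 t g))); rewrite addr0.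
apply: adjoint_domP => x Dx.
have /generator_derive d1 : dom A x /\ A x = A x by [].
have [_ <-] := is_derive_ipl phi (d1 _ hS hA).
have [_ <-] := is_derive_ipr x dphi.
suff -> : (fun t => ip (S t x) phi) = (fun t => ip x (S' t phi)) by [].
apply/funext => t; rewrite /adjoint_group -badjoint_ip//; exact: group_bounded.
Qed.

Lemma adjoint_wint (g : R -> H) a b : continuous g -> continuous (A' \o g) ->
  (forall t, dom A' (g t)) -> dom A' (wint a b g) /\ A' (wint a b g) = wint a b (A' \o g).
Proof.
move=> cg cAg Dg; apply: adjoint_domP => x Dx; rewrite !wint_ip//.
by apply: eq_itg => t _; rewrite adjoint_ip.
Qed.

End AdjointGroup.

(** * Strong measurability and Bochner integrals *)

Section SimpleFunctions.
Context {R : realType} {V : lmodType R}.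
Implicit Types (s : R -> V) (D : set R).

Lemma simple_preimage s (P : set V) : simple_function setT s -> measurable (s @^-1` P).
Proof.
move=> [_ fs ms]; have -> : s @^-1` P = \bigcup_(v in range s `&` P) s @^-1` [set v].
  apply/seteqP; split=> t /=.
    by move=> Pt; exists (s t) => //; split => //; exists t.
  by move=> [v [_ Pv] /= ->].
by apply: fin_bigcup_measurable => //; exact: finite_setIl.
Qed.

Lemma simple_comp2 (W1 W2 : lmodType R) (s : R -> W1) (s' : R -> W2) (g : W1 -> W2 -> V) :
  simple_function setT s -> simple_function setT s' ->
  simple_function setT (fun t => g (s t) (s' t)).
Proof.
move=> [_ fs ms] [_ fs' ms']; split => //.
  apply: (@sub_finite_set _ _ [set g v w | v in range s & w in range s']).
    by move=> _ [t _ <-]; exists (s t); [exists t|exists (s' t) => //; exists t].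
  exact: finite_image2.
move=> u; have -> : (fun t => g (s t) (s' t)) @^-1` [set u] =
   \bigcup_(v in range s) (\bigcup_(w in range s' `&` [set w | g v w = u]) (s @^-1` [set v] `&` s' @^-1` [set w])).
  apply/seteqP; split=> t /=.
    move=> gu; exists (s t); first by exists t.
    by exists (s' t) => //; split => //; exists t.
  by move=> [v _ [w [_ /= <-] [/= <- <-]]].
apply: fin_bigcup_measurable => // v _; apply: fin_bigcup_measurable.
  exact: finite_setIl.
by move=> w _; apply: measurableI.
Qed.

Lemma simple_cst (v : V) : simple_function setT (fun=> v).
Proof.
split => //; first by apply: (@sub_finite_set _ _ [set v]) => // _ [t _ <-].
move=> u; have [->|uv] := pselect (u = v).
  by have -> : (fun=> v) @^-1` [set v] = [set: R] by apply/seteqP; split.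
have -> : (fun=> v) @^-1` [set u] = set0 :> set R by apply/seteqP; split => // t /= vu; apply: uv.
exact: measurable0.
Qed.

Lemma simple_comp (W : lmodType R) (s : R -> W) (g : W -> V) :
  simple_function setT s -> simple_function setT (fun t => g (s t)).
Proof. by move=> hs; apply: (simple_comp2 (fun v _ => g v) hs hs). Qed.

Lemma simple_ite (A : set R) s s' : measurable A -> simple_function setT s ->
  simple_function setT s' -> simple_function setT (fun t => if t \in A then s t else s' t).
Proof.
move=> mA hs hs'; have [_ fs ms] := hs; have [_ fs' ms'] := hs'; split => //.
  apply: (@sub_finite_set _ _ (range s `|` range s')).
    by move=> _ [t _ <-]; case: ifP => _; [left|right]; exists t.
  by rewrite finite_setU.
move=> v; have -> : (fun t => if t \in A then s t else s' t) @^-1` [set v] =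
    (A `&` s @^-1` [set v]) `|` (~` A `&` s' @^-1` [set v]).
  apply/seteqP; split=> t /=.
    by case: ifPn => [/set_mem tA|/negP tA] stv; [left|right]; split => // /mem_set.
  by move=> [[tA <-]|[tA <-]]; [rewrite mem_set|rewrite memNset].
by apply: measurableU; apply: measurableI => //; exact: measurableC.
Qed.

Lemma simple_measurable D s (g : V -> R) : simple_function setT s ->
  measurable_fun D (fun t => g (s t)).
Proof.
move=> hs mD Y mY; apply: measurableI => //.
exact: (simple_preimage (g @^-1` Y) hs).
Qed.

Lemma simple_bounded_norm s (g : V -> R) : simple_function setT s ->
  exists C : R, forall t, `|g (s t)| <= C.
Proof.
move=> [_ /finite_seqP[l hl] _]; exists (\sum_(v <- l) `|g v|) => t.
have : s t \in l by have : range s (s t) by []; rewrite hl.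
elim: l {hl} => // v l IH; rewrite inE big_cons => /predU1P[->|/IH h].
  by rewrite lerDl sumr_ge0.
by apply: le_trans h _; rewrite lerDr.
Qed.

Lemma itgb_simple a b s (g : V -> R) : simple_function setT s -> itgb a b (fun t => g (s t)).
Proof.
move=> hs; have [C hC] := simple_bounded_norm g hs.
apply: (itgb_dominated (g := fun=> C)) => //; first exact: simple_measurable.
exact: itgb_cst.
Qed.

Lemma simple_integral_functional a b s (l : V -> R) : simple_function setT s ->
  (forall r u v, l (r *: u + v) = r * l u + l v) ->
  l (simple_integral `]a, b[ s) = itg a b (fun t => l (s t)).
Proof.
move=> hs ll; have [_ fs ms] := hs.
have l0 : l 0 = 0 by have := ll 1 0 0; rewrite scaler0 add0r mul1r; lra.
have [q0 hq0] := (finite_seqP _).1 fs.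
pose q := undup q0; have hq : range s = [set` q].
  by rewrite hq0; apply/seteqP; split => v /=; rewrite mem_undup.
have uq : uniq q by exact: undup_uniq.
rewrite /simple_integral hq -fsbig_seq//.
pose c v := fine (lebesgue_measure (`]a, b[%classic `&` s @^-1` [set v])).
have lsum (r : seq V) : l (\sum_(v <- r) c v *: v) = \sum_(v <- r) c v * l v.
  elim: r => [|v r IH]; first by rewrite !big_nil.
  by rewrite !big_cons ll IH.
rewrite lsum.
have cE v : c v = itg a b (fun t => \1_(s @^-1` [set v]) t).
  by have mv := ms v; rewrite /c setIC /itg /Rintegral integral_indic.
have ib v : itgb a b (fun t => \1_(s @^-1` [set v]) t).
  pose g (u : V) : R := (u == v)%:R.
  have h : itgb a b (fun t => g (s t)) by exact: itgb_simple.
  apply: eq_itgb h => t _; rewrite /g indicE; congr (nat_of_bool _)%:R.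
  by apply/eqP/idP => [st|/set_mem//]; exact/mem_set.
have -> : itg a b (fun t => l (s t)) = itg a b (fun t => \sum_(v <- q) l v * \1_(s @^-1` [set v]) t).
  apply: eq_itg => t _.
  have sq : s t \in q by have : range s (s t) by []; rewrite hq.
  rewrite (bigD1_seq (s t))//= indicE mem_set//= mulr1 big1 ?addr0// => v vs.
  by rewrite indicE memNset ?mulr0// => /= sv; rewrite sv eqxx in vs.
have ibs (r : seq V) : itgb a b (fun t => \sum_(v <- r) l v * \1_(s @^-1` [set v]) t).
  elim: r => [|v r IH].
    by apply: (eq_itgb (f := fun=> 0)) => [t _|]; [rewrite big_nil|exact: itgb_cst].
  apply: (eq_itgb (f := fun t => l v * \1_(s @^-1` [set v]) t + \sum_(v <- r) l v * \1_(s @^-1` [set v]) t)).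
    by move=> t _; rewrite big_cons.
  by apply: itgbD => //; exact: itgbZ.
elim: q {hq uq} => [|v r IH].
  rewrite big_nil; rewrite -[LHS](mul0r (b - a)).
  rewrite (@eq_itg _ _ (fun=> 0)); last by move=> t _; rewrite big_nil.
  by rewrite /itg Rintegral_cst// !mul0r.
rewrite big_cons IH [RHS](@eq_itg _ _ (fun t => l v * \1_(s @^-1` [set v]) t + \sum_(v <- r) l v * \1_(s @^-1` [set v]) t)); last first.
  by move=> t _; rewrite big_cons.
by rewrite itgD//; [rewrite itgZ// -cE mulrC|exact: itgbZ].
Qed.

End SimpleFunctions.

Section LowerIntegral.
Context {R : realType}.
Local Notation mu := (@lebesgue_measure R).
Implicit Types (D : set R).

(** The dual norm of a strongly measurable function need not be measurable.  Monotonicity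
  still holds, as integrals of nonnegative functions are suprema over simple functions
  below them. *)
Lemma le_lower_integral D (f g : R -> \bar R) :
  (forall t, D t -> (0 <= f t)%E) -> (forall t, D t -> (f t <= g t)%E) ->
  (\int[mu]_(t in D) f t <= \int[mu]_(t in D) g t)%E.
Proof.
move=> f0 fg; have g0 t : D t -> (0 <= g t)%E by move=> Dt; exact: le_trans (f0 t Dt) (fg t Dt).
rewrite !ge0_integralE//; apply: ereal_sup_le => _ [h hf <-].
exists h => // t; apply: le_trans (hf t) _.
by rewrite /patch; case: ifP => // /set_mem; exact: fg.
Qed.

End LowerIntegral.

Section StronglyMeasurable.
Context {R : realType} {k : scalar_kind}.
Implicit Types (X Y : hilbertType R k) (D : set R).

Lemma cvg_enorm X (u : nat -> X) x :
  enorm (x - u n) @[n --> \oo] --> 0%E <-> u n @[n --> \oo] --> x.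
Proof.
split=> h.
  apply/cvgrPdist_lt => e e0.
  have /fine_cvgP[_ /cvgrPdist_lt/(_ e e0)] := h.
  by apply: filterS => n; rewrite /= sub0r normrN normr_id.
have -> : (fun n => enorm (x - u n)) = (EFin \o (fun n => `|x - u n|)) by [].
apply: cvg_EFin; first by apply: nearW.
rewrite -(normr0 X); apply: cvg_norm; rewrite -(subrr x); apply: cvgB => //; exact: cvg_cst.
Qed.

Definition sm X D (f : R -> X) := strongly_measurable setT (@enorm R k X) D f.

Lemma smP X D (f : R -> X) : sm D f <->
  exists2 s : nat -> R -> X, (forall n, simple_function setT (s n)) &
    forall t, D t -> s n t @[n --> \oo] --> f t.
Proof.
by split=> [[s hs h]|[s hs h]]; exists s => // t Dt; apply/cvg_enorm; exact: h.
Qed.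

Lemma sm_measurable X D (f : R -> X) (g : X -> R) : continuous g -> sm D f ->
  measurable_fun D (fun t => g (f t)).
Proof.
move=> cg /smP[s hs sf]; apply: (@measurable_fun_cvg _ _ _ _ (fun n t => g (s n t))).
  by move=> n; exact: simple_measurable.
by move=> t Dt; apply: continuous_cvg; [exact: cg|exact: sf].
Qed.

Lemma sm_norm_sub X D (f : R -> X) x : sm D f -> measurable_fun D (fun t => `|f t - x|).
Proof.
apply: (@sm_measurable _ _ _ (fun y => `|y - x|)) => y.
by apply: cvg_norm; apply: cvgB; [exact: cvg_id|exact: cvg_cst].
Qed.

Lemma sm_norm X D (f : R -> X) : sm D f -> measurable_fun D (fun t => `|f t|).
Proof. by apply: (@sm_measurable _ _ _ (fun y => `|y|)) => y; exact: norm_continuous. Qed.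

Lemma sm_comp X Y D (f : R -> X) (g : X -> Y) : continuous g -> sm D f -> sm D (g \o f).
Proof.
move=> cg /smP[s hs sf]; apply/smP; exists (fun n t => g (s n t)).
  by move=> n; exact: simple_comp.
by move=> t Dt; apply: continuous_cvg; [exact: cg|exact: sf].
Qed.

Lemma smD X D (f g : R -> X) : sm D f -> sm D g -> sm D (fun t => f t + g t).
Proof.
move=> /smP[s hs sf] /smP[s' hs' sf']; apply/smP; exists (fun n t => s n t + s' n t).
  by move=> n; exact: (simple_comp2 (fun u v => u + v)).
by move=> t Dt; apply: cvgD; [exact: sf|exact: sf'].
Qed.

Lemma smZ X D (r : R) (f : R -> X) : sm D f -> sm D (fun t => r *: f t).
Proof.
apply: (@sm_comp _ _ _ f (fun x => r *: x)) => x.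
by apply: cvgZ; [exact: cvg_cst|exact: cvg_id].
Qed.

Lemma smN X D (f : R -> X) : sm D f -> sm D (fun t => - f t).
Proof. by apply: (@sm_comp _ _ _ f (fun x => - x)) => x; apply: cvgN; exact: cvg_id. Qed.

Lemma smB X D (f g : R -> X) : sm D f -> sm D g -> sm D (fun t => f t - g t).
Proof. by move=> hf hg; apply: smD => //; exact: smN. Qed.

Lemma sm_sub X D D' (f : R -> X) : D' `<=` D -> sm D f -> sm D' f.
Proof. by move=> DD /smP[s hs sf]; apply/smP; exists s => // t /DD; exact: sf. Qed.

Lemma eq_sm X D (f g : R -> X) : (forall t, D t -> f t = g t) -> sm D f -> sm D g.
Proof. by move=> fg /smP[s hs sf]; apply/smP; exists s => // t Dt; rewrite -fg//; exact: sf. Qed.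

Lemma sm_ite X D (A : set R) (f : R -> X) : measurable A -> sm D f ->
  sm D (fun t => if t \in A then f t else 0).
Proof.
move=> mA /smP[s hs sf]; apply/smP; exists (fun n t => if t \in A then s n t else 0).
  by move=> n; apply: simple_ite => //; exact: simple_cst.
by move=> t Dt; case: ifP => _; [exact: sf|exact: cvg_cst].
Qed.

Lemma sm_separable X D (f : R -> X) : sm D f ->
  exists v : nat -> X, forall t, D t -> forall e : R, 0 < e -> exists i, `|f t - v i| < e.
Proof.
move=> /smP[s hs sf].
have /choice[l hl] : forall n, exists l : seq X, range (s n) = [set` l].
  by move=> n; have [_ /finite_seqP fs _] := hs n.
pose v i := if unpickle i is Some (n, j) then nth 0 (l n) j else 0.
exists v => t Dt e e0; have /cvgrPdist_lt/(_ e e0)[N _ hN] := sf t Dt.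
exists (pickle (N, index (s N t) (l N))); rewrite /v pickleK nth_index.
  by apply: hN => /=.
by have : range (s N) (s N t) by []; rewrite hl.
Qed.

(** [s n t] is the closest point to f t among 0, v 0, ..., v (n - 1), with ties resolved in
  favour of the first one; measurability of the distances makes it simple. *)
Lemma pettis X D (f : R -> X) (v : nat -> X) : measurable D ->
  (forall t, D t -> forall e : R, 0 < e -> exists i, `|f t - v i| < e) ->
  (forall x, measurable_fun D (fun t => `|f t - x|)) -> sm D f.
Proof.
move=> mD sep mf.
pose A (n : nat) (s : R -> X) := D `&` [set t | `|f t - v n| < `|f t - s t|].
pose s := fix s n := if n is n'.+1 then
  (fun t => if t \in A n' (s n') then v n' else s n' t) else (fun=> 0).
have hs n : simple_function setT (s n) /\ measurable_fun D (fun t => `|f t - s n t|).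
  elim: n => [|n [IH1 IH2]] /=; first by split; [exact: simple_cst|exact: mf].
  have mA : measurable (A n (s n)).
    have mt : measurable [set true] by [].
    have := measurable_fun_ltr (mf (v n)) IH2 mD mt.
    by congr measurable; apply/seteqP; split.
  split; first by apply: simple_ite => //; exact: simple_cst.
  apply: (eq_measurable_fun ((fun t => `|f t - v n|) \min (fun t => `|f t - s n t|))).
    move=> t /set_mem Dt; rewrite /= /Num.min; case: ifP => h.
      by rewrite mem_set.
    by rewrite memNset// => -[_ /=]; rewrite h.
  by apply: measurable_minr.
have dec n m t : D t -> (n <= m)%N -> `|f t - s m t| <= `|f t - s n t|.
  move=> Dt /subnK <-; elim: (m - n)%N => // p IH; rewrite addSn /=.
  by case: ifPn => // /set_mem[_ /= /ltW h]; exact: le_trans h IH.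
have cl n t : D t -> `|f t - s n.+1 t| <= `|f t - v n|.
  move=> Dt /=; case: ifPn => // /negP h; rewrite leNgt; apply/negP => h'.
  by apply: h; rewrite mem_set.
apply/smP; exists s => [n|t Dt]; first by have [] := hs n.
apply/cvgrPdist_lt => e e0; have [i hi] := sep t Dt e e0.
exists i.+1 => // n /= hn; apply: le_lt_trans hi; apply: le_trans (cl i t Dt).
exact: dec.
Qed.

(** The limit takes its values in a separable set, so that [pettis] applies. *)
Lemma sm_lim X D (F : nat -> R -> X) (f : R -> X) : measurable D ->
  (forall n, sm D (F n)) -> (forall t, D t -> F n t @[n --> \oo] --> f t) -> sm D f.
Proof.
move=> mD hF Ff.
have /choice[w hw] : forall n, exists v : nat -> X, forall t, D t ->
    forall e : R, 0 < e -> exists i, `|F n t - v i| < e.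
  by move=> n; exact: sm_separable.
pose v i := if unpickle i is Some (n, j) then w n j else 0.
apply: (@pettis _ _ _ v) => // [t Dt e e0|x].
  have e2 : 0 < e / 2 by rewrite divr_gt0.
  have /cvgrPdist_lt/(_ _ e2)[N _ hN] := Ff t Dt.
  have [j hj] := hw N t Dt _ e2.
  exists (pickle (N, j)); rewrite /v pickleK.
  have -> : f t - w N j = (f t - F N t) + (F N t - w N j) by rewrite addrA subrK.
  apply: le_lt_trans (ler_normD _ _) _; rewrite [e]splitr; apply: ltrD => //.
  by apply: hN => /=.
apply: (@measurable_fun_cvg _ _ _ _ (fun n t => `|F n t - x|)).
  by move=> n; exact: sm_norm_sub.
move=> t Dt; apply: cvg_norm; apply: cvgB; [exact: Ff|exact: cvg_cst].
Qed.

Lemma sm_continuous X (f : R -> X) a b : continuous f -> sm `]a, b[ f.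
Proof.
move=> cf; pose v i := if unpickle i is Some q then f (ratr q) else 0.
apply: (@pettis _ _ _ v) => // [t _ e e0|x].
  have /cvgrPdist_lt/(_ e e0)/nbhs_ballP[d /= d0 hd] := cf t.
  have [q hq] : exists q : rat, ratr q \in `]t, (t + d)[ by apply: rat_in_itvoo; rewrite ltrDl.
  exists (pickle q); rewrite /v pickleK; apply: hd; rewrite -ball_normE /=.
  move: hq; rewrite in_itv /= => /andP[h1 h2]; rewrite ltr_norml; apply/andP; split; lra.
apply: measurable_funTS; apply: continuous_measurable_fun => t; apply: cvg_norm; apply: cvgB; [exact: cf|exact: cvg_cst].
Qed.

Lemma sm_within X (f : R -> X) a b : a <= b -> {within `[a, b], continuous f} -> sm `]a, b[ f.
Proof.
move=> ab cf; apply: (eq_sm (f := f \o clamp a b)) => [t /=|].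
  by rewrite in_itv /= => /andP[/ltW at_ /ltW tb]; rewrite clamp_id// at_.
by apply: sm_continuous; exact: clamp_continuous.
Qed.

Lemma sm_ip X D (f g : R -> X) : sm D f -> sm D g -> measurable_fun D (fun t => ip (f t) (g t)).
Proof.
move=> /smP[s hs sf] /smP[s' hs' sf'].
apply: (@measurable_fun_cvg _ _ _ _ (fun n t => ip (s n t) (s' n t))).
  move=> n; have h := @simple_comp2 R R^o X X (s n) (s' n) (fun u v => ip u v) (hs n) (hs' n).
  exact: (simple_measurable (fun x => x) h).
by move=> t Dt; apply: cvg_ip; [exact: sf|exact: sf'].
Qed.

End StronglyMeasurable.

Section Bochner.
Context {R : realType}.
Local Notation mu := (@lebesgue_measure R).

Lemma integral_itg (a b : R) (f : R -> R) : itgb a b f ->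
  (\int[mu]_(t in `]a, b[) (f t)%:E)%E = (itg a b f)%:E.
Proof. by move=> hf; rewrite /itg /Rintegral fineK//; exact: integrable_fin_num. Qed.

Lemma itgb_lty (a b : R) (f : R -> R) : measurable_fun `]a, b[ f ->
  (\int[mu]_(t in `]a, b[) `|f t|%:E < +oo)%E -> itgb a b f.
Proof. by move=> mf fo; apply/integrableP; split => //; exact/measurable_EFinP. Qed.

Lemma cvge0_lt (u : nat -> \bar R) (e : R) : u @ \oo --> 0%E -> 0 < e ->
  \forall n \near \oo, (u n < e%:E)%E.
Proof.
move=> u0 e0.
have [h /cvgrPdist_lt/(_ e e0) h2] := (fine_cvgP _ _).1 u0.
apply: filterS2 h h2 => n /= un; rewrite sub0r normrN => h.
by rewrite -(fineK un) lte_fin; apply: le_lt_trans h; exact: ler_norm.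
Qed.

(** A functional dominated by N commutes with the Bochner integral.  Integrals in H and in
  the dual of the domain are turned into real integrals in this way. *)
Lemma bochner_functional (V : lmodType R) (E : set V) (N : V -> \bar R) (a b : R)
    (f : R -> V) (v : V) (l : V -> R) :
  (forall r u w, l (r *: u + w) = r * l u + l w) ->
  (forall w, (`|l w|%:E <= N w)%E) ->
  bochner_integral E N `]a, b[ f v ->
  itgb a b (fun t => l (f t)) /\ l v = itg a b (fun t => l (f t)).
Proof.
move=> ll lN [[s hs sf] [s' [hs' sf' sv']]].
have weak (u : R -> V) : simple_function E u -> simple_function setT u.
  by move=> [_ h1 h2]; split.
have lN1 w : l (- w) = - l w.
  have l0 : l 0 = 0 by have := ll 1 0 0; rewrite scaler0 add0r mul1r; lra.
  by have := ll (-1) w 0; rewrite addr0 scaleN1r l0 addr0 mulN1r.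
have lB u w : l (u - w) = l u - l w by rewrite -[u]scale1r ll mul1r lN1 scale1r.
have mf : measurable_fun `]a, b[ (fun t => l (f t)).
  apply: (@measurable_fun_cvg _ _ _ _ (fun n t => l (s n t))).
    by move=> n; apply: simple_measurable; exact: weak.
  move=> t Dt; apply/cvgrPdist_lt => e e0.
  have e0' : (0 < e%:E)%E by rewrite lte_fin.
  have : \forall n \near \oo, (N (f t - s n t)%R < e%:E)%E by exact: (cvge0_lt (sf t Dt)).
  apply: filterS => n h; rewrite -lB -lte_fin; exact: le_lt_trans (lN _) h.
have is' n : itgb a b (fun t => l (s' n t)) by apply: itgb_simple; exact: weak.
have md n : measurable_fun `]a, b[ (fun t => l (f t) - l (s' n t)).
  by apply: measurable_funB => //; apply: itgb_measurable.
have le n : (\int[mu]_(t in `]a, b[) `|l (f t) - l (s' n t)|%R%:E <=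
    \int[mu]_(t in `]a, b[) N (f t - s' n t)%R)%E.
  by apply: le_lower_integral => // t _; rewrite -lB; exact: lN.
have small e : 0 < e -> \forall n \near \oo,
    (\int[mu]_(t in `]a, b[) `|l (f t) - l (s' n t)|%R%:E < e%:E)%E.
  move=> e0; have e0' : (0 < e%:E)%E by rewrite lte_fin.
  have : \forall n \near \oo, (\int[mu]_(t in `]a, b[) N (f t - s' n t)%R < e%:E)%E.
    by exact: (cvge0_lt sf').
  by apply: filterS => n; exact: le_lt_trans.
have id n : (\int[mu]_(t in `]a, b[) `|l (f t) - l (s' n t)|%R%:E < +oo)%E ->
    itgb a b (fun t => l (f t) - l (s' n t)).
  by move=> h; exact: itgb_lty.
have ilf : itgb a b (fun t => l (f t)).
  have [n _ hn] := small 1 ltr01.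
  have /id hd := lt_le_trans (hn n (leqnn n)) (leey _).
  apply: (eq_itgb (f := fun t => (l (f t) - l (s' n t)) + l (s' n t))).
    by move=> t _; rewrite subrK.
  exact: itgbD.
split => //; apply/eqP; rewrite -subr_eq0 -normr_le0; apply/ler_addgt0Pl => e e0; rewrite addr0.
have e2 : 0 < e / 2 by rewrite divr_gt0.
have e2' : (0 < (e / 2)%:E)%E by rewrite lte_fin.
have h1 := small _ e2.
have h2 : \forall n \near \oo, (N (v - simple_integral `]a, b[ (s' n))%R < (e / 2)%:E)%E.
  by exact: (cvge0_lt sv').
have [n _ hn] := filterI h1 h2; have [k1 k2] := hn n (leqnn n).
have -> : l v - itg a b (fun t => l (f t)) = (l v - l (simple_integral `]a, b[ (s' n))) -
   (itg a b (fun t => l (f t)) - itg a b (fun t => l (s' n t))).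
  by rewrite (simple_integral_functional _ _ (weak _ (hs' n)) ll); ring.
apply: le_trans (ler_normB _ _) _; rewrite [e]splitr; apply: lerD.
  by rewrite -lB -lee_fin; apply: le_trans (lN _) (ltW k2).
rewrite -itgB//; have idn := id n (lt_le_trans k1 (leey _)).
apply: le_trans (norm_itg idn) _; rewrite -lee_fin -integral_itg; last exact: itgb_norm.
exact: ltW.
Qed.

Context {k : scalar_kind} {X : hilbertType R k}.

(** The simple functions are replaced by 0 where they exceed 1 + |f|, which gives a
  dominating function. *)
Lemma approx_simple (f : R -> X) (a b : R) : sm `]a, b[ f -> itgb a b (fun t => `|f t|) ->
  exists s : nat -> R -> X, [/\ forall n, simple_function setT (s n),
    forall n, itgb a b (fun t => `|f t - s n t|) &
    itg a b (fun t => `|f t - s n t|) @[n --> \oo] --> 0].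
Proof.
move=> smf ifn; have /smP[s hs sf] := smf.
pose A n := `]a, b[%classic `&` [set t | `|s n t| <= 1 + `|f t|].
have mn n : measurable_fun `]a, b[ (fun t => `|s n t|) by exact: simple_measurable.
have mA n : measurable (A n).
  have mt : measurable [set true] by [].
  have m1 : measurable_fun `]a, b[ (fun t => 1 + `|f t|).
    by apply: measurable_funD; [exact: measurable_cst|exact: sm_norm].
  have mD : measurable `]a, b[%classic by exact: measurable_itv.
  have := measurable_fun_ler (mn n) m1 mD mt.
  by congr measurable; apply/seteqP; split.
pose r n t := if t \in A n then s n t else 0.
have hr n : simple_function setT (r n) by apply: simple_ite => //; exact: simple_cst.
have rb n t : a < t < b -> `|f t - r n t| <= 1 + 2 * `|f t|.
  move=> tab; rewrite /r; case: ifPn => [/set_mem[_ /= h]|_].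
    by apply: le_trans (ler_normB _ _) _; lra.
  by rewrite subr0; have := normr_ge0 (f t); lra.
have rf t : a < t < b -> `|f t - r n t| @[n --> \oo] --> 0.
  move=> tab; have Dt : `]a, b[%classic t by rewrite /= in_itv.
  have sft : `|f t - s n t| @[n --> \oo] --> (0 : R).
    by rewrite -(normr0 X); apply: cvg_norm; rewrite -(subrr (f t)); apply: cvgB; [exact: cvg_cst|exact: sf].
  apply: cvg_trans sft; apply: near_eq_cvg.
  have /cvgrPdist_le/(_ 1 ltr01) := sf t Dt; apply: filterS => n h.
  rewrite /r mem_set//; split => //=.
  have -> : s n t = f t - (f t - s n t) by rewrite opprB addrC subrK.
  by apply: le_trans (ler_normB _ _) _; rewrite addrC lerD2r.
have smd n : measurable_fun `]a, b[ (fun t => `|f t - r n t|).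
  by apply: sm_norm; apply: smB => //; apply/smP; exists (fun _ => r n) => // t _; exact: cvg_cst.
have ib : itgb a b (fun t => 1 + 2 * `|f t|) by apply: itgbD; [exact: itgb_cst|exact: itgbZ].
have ir n : itgb a b (fun t => `|f t - r n t|).
  by apply: (itgb_dominated (g := fun t => 1 + 2 * `|f t|)) => // t tab; rewrite normr_id; exact: rb.
exists r; split => //.
have [|||||_ _] := @dominated_convergence _ _ _ mu `]a, b[%classic (measurable_itv _)
   (fun n t => (`|f t - r n t|)%:E) (cst 0%E) (fun t => (1 + 2 * `|f t|)%:E).
- by move=> n; apply/measurable_EFinP; exact: smd.
- exact: measurable_cst.
- apply/aeW => t; rewrite /= in_itv /= => tab; apply: cvg_EFin; first exact: nearW.
  exact: rf.
- exact: ib.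
- apply/aeW => t n; rewrite /= in_itv /= => tab; rewrite normr_id lee_fin; exact: rb.
rewrite integral0 => h.
have e1 : (fun n => \int[mu]_(x in `]a, b[) `|f x - r n x|%:E)%E = EFin \o (fun n => itg a b (fun t => `|f t - r n t|)).
  by apply/funext => n /=; rewrite integral_itg.
move: h; rewrite e1 => /fine_cvgP[_]; exact.
Qed.

(** For strongly measurable functions of integrable norm the weak integral is the Bochner
  integral. *)
Lemma bochner_weak (f : R -> X) (v : X) (a b : R) : sm `]a, b[ f -> itgb a b (fun t => `|f t|) ->
  (forall x, ip v x = itg a b (fun t => ip (f t) x)) -> bochner `]a, b[ f v.
Proof.
move=> smf ifn hv; split => //; have [s [hs ids lim]] := approx_simple smf ifn.
exists s; split => //.
  have -> : (fun n => \int[mu]_(t in `]a, b[) enorm (f t - s n t)%R)%E =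
      EFin \o (fun n => itg a b (fun t => `|f t - s n t|)).
    by apply/funext => n /=; rewrite -integral_itg.
  by apply: cvg_EFin; first exact: nearW.
have if_ x : itgb a b (fun t => ip (f t) x).
  apply: (itgb_dominated (g := fun t => `|x| * `|f t|)); last by move=> t _; rewrite mulrC; exact: ip_CS.
    by apply: sm_ip => //; apply/smP; exists (fun _ _ => x) => [_|t _]; [exact: simple_cst|exact: cvg_cst].
  exact: itgbZ.
have le n : `|v - simple_integral `]a, b[ (s n)| <= itg a b (fun t => `|f t - s n t|).
  apply: norm_le_ip => [|x]; first exact: itg_ge0.
  have is_ : itgb a b (fun t => ip (s n t) x) by exact: (@itgb_simple _ _ _ _ _ (fun u => ip u x)).
  rewrite ipC ipBl hv (@simple_integral_functional _ _ _ _ _ (fun u => ip u x))//; last first.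
    by move=> r u w; rewrite ipDl ipZl.
  rewrite -itgB// mulrC -itgZ//; apply: le_itg; [exact: itgbB|exact: itgbZ|].
  by move=> t _; rewrite -ipBl mulrC; exact: ip_le.
rewrite (_ : (fun n => enorm _) = EFin \o (fun n => `|v - simple_integral `]a, b[ (s n)|))//.
apply: cvg_EFin; first exact: nearW.
apply: (@squeeze_cvgr _ _ _ _ (cst 0) (fun n => itg a b (fun t => `|f t - s n t|))) => //.
  by apply: nearW => n; rewrite normr_ge0 le.
exact: cvg_cst.
Qed.

End Bochner.

(** * Square-integrable functions *)

Section SquareIntegrable.
Context {R : realType} {k : scalar_kind} {X : hilbertType R k}.
Local Notation mu := (@lebesgue_measure R).
Implicit Types (f g : R -> X) (a b : R).

Definition L2 a b f := sm `]a, b[ f /\ itgb a b (fun t => `|f t| ^+ 2).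

(** The squared norm of L^2(a, b). *)
Definition sqn a b f : R := itg a b (fun t => `|f t| ^+ 2).

Lemma Lp_class_itgb (p : nat) (T : R) f : (0 < p)%N ->
  Lp_class p T f <-> sm `]0, T[ f /\ itgb 0 T (fun t => `|f t| ^+ p).
Proof.
move=> p0; split=> [[sf fo]|[sf fi]]; split => //.
  have mf : measurable_fun `]0, T[ (fun t => `|f t| ^+ p).
    by apply: measurable_funX; exact: sm_norm.
  apply: itgb_lty => //; apply: le_lt_trans fo.
  by apply: ge0_le_integral => //=;
    [do 2 apply: measurableT_comp => //|apply: measurableT_comp => //|move=> t _; rewrite ger0_norm].
by rewrite integral_itg// ltry.
Qed.

Lemma Lp_class2P (T : R) f : Lp_class 2 T f <-> L2 0 T f.
Proof. exact: Lp_class_itgb. Qed.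

Lemma Lp_class1P (T : R) f : Lp_class 1 T f <-> sm `]0, T[ f /\ itgb 0 T (fun t => `|f t|).
Proof.
have e : (fun t => `|f t| ^+ 1) = (fun t => `|f t|) by apply/funext => t; rewrite expr1.
by rewrite -e; exact: Lp_class_itgb.
Qed.

Lemma sqn_ge0 a b f : 0 <= sqn a b f.
Proof. by apply: itg_ge0 => t _; rewrite sqr_ge0. Qed.

Lemma L2Z a b r f : L2 a b f -> L2 a b (fun t => r *: f t).
Proof.
move=> [sf fi]; split; first exact: smZ.
apply: (eq_itgb (f := fun t => r ^+ 2 * `|f t| ^+ 2)); last exact: itgbZ.
by move=> t _; rewrite normrZ exprMn real_normK ?num_real.
Qed.

Lemma sqnZ a b r f : L2 a b f -> sqn a b (fun t => r *: f t) = r ^+ 2 * sqn a b f.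
Proof.
move=> [sf fi]; rewrite /sqn -itgZ//; apply: eq_itg => t _.
by rewrite normrZ exprMn real_normK ?num_real.
Qed.

Lemma normD_sqr_le (x y : X) : `|x + y| ^+ 2 <= 2 * `|x| ^+ 2 + 2 * `|y| ^+ 2.
Proof. by rewrite normD_sqr; have := ip_AMGM x y; lra. Qed.

Lemma L2D a b f g : L2 a b f -> L2 a b g -> L2 a b (fun t => f t + g t).
Proof.
move=> [sf fi] [sg gi]; have s := smD sf sg; split => //.
apply: (itgb_dominated (g := fun t => 2 * `|f t| ^+ 2 + 2 * `|g t| ^+ 2)).
- by apply: measurable_funX; exact: sm_norm.
- by apply: itgbD; exact: itgbZ.
- by move=> t _; rewrite ger0_norm ?sqr_ge0//; exact: normD_sqr_le.
Qed.

Lemma L2N a b f : L2 a b f -> L2 a b (fun t => - f t).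
Proof.
move=> [sf fi]; split; first exact: smN.
by apply: eq_itgb fi => t _; rewrite normrN.
Qed.

Lemma sqnN a b f : sqn a b (fun t => - f t) = sqn a b f.
Proof. by apply: eq_itg => t _; rewrite normrN. Qed.

Lemma L2B a b f g : L2 a b f -> L2 a b g -> L2 a b (fun t => f t - g t).
Proof. by move=> hf hg; apply: L2D => //; exact: L2N. Qed.

Lemma sqnD_le a b f g : L2 a b f -> L2 a b g ->
  sqn a b (fun t => f t + g t) <= 2 * sqn a b f + 2 * sqn a b g.
Proof.
move=> hf hg; have [_ hfg] := L2D hf hg; case: hf hg => [sf fi] [sg gi].
rewrite /sqn -!itgZ// -itgD; [|exact: itgbZ|exact: itgbZ].
apply: le_itg => //; first by apply: itgbD; exact: itgbZ.
by move=> t _; exact: normD_sqr_le.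
Qed.

Lemma sqnB_le a b f g : L2 a b f -> L2 a b g ->
  sqn a b (fun t => f t - g t) <= 2 * sqn a b f + 2 * sqn a b g.
Proof. by move=> hf hg; rewrite -(sqnN _ _ g); apply: sqnD_le => //; exact: L2N. Qed.

Lemma L2_ip a b f g : L2 a b f -> L2 a b g -> itgb a b (fun t => ip (f t) (g t)).
Proof.
move=> [sf fi] [sg gi]; apply: (itgb_dominated (g := fun t => `|f t| ^+ 2 + `|g t| ^+ 2)).
- exact: sm_ip.
- exact: itgbD.
- move=> t _; rewrite ler_norml; apply/andP; split.
    have := ip_AMGM (f t) (- g t); rewrite ipNr normrN.
    by have := sqr_ge0 `|f t|; have := sqr_ge0 `|g t|; lra.
  have := ip_AMGM (f t) (g t).
  by have := sqr_ge0 `|f t|; have := sqr_ge0 `|g t|; lra.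
Qed.

Lemma L2_L1 a b f : L2 a b f -> itgb a b (fun t => `|f t|).
Proof.
move=> [sf fi]; apply: (itgb_dominated (g := fun t => 1 + `|f t| ^+ 2)).
- exact: sm_norm.
- by apply: itgbD => //; exact: itgb_cst.
- by move=> t _; rewrite normr_id; have := sqr_ge0 (`|f t| - 2^-1); rewrite sqrrB; lra.
Qed.

Lemma L2_continuous a b f : continuous f -> L2 a b f.
Proof.
move=> cf; split; first exact: sm_continuous.
apply: itgb_continuous => t; apply: (@cvg_comp _ _ _ (fun t => `|f t|) (fun x : R => x ^+ 2)).
  by apply: cvg_norm; exact: cf.
exact: exprn_continuous.
Qed.

Lemma eq_L2 a b f g : (forall t, a < t < b -> f t = g t) -> L2 a b f -> L2 a b g.
Proof.
move=> fg [sf fi]; split.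
  by apply: eq_sm sf => t; rewrite /= in_itv /=; exact: fg.
by apply: eq_itgb fi => t /fg ->.
Qed.

Lemma L2_CS a b f g : L2 a b f -> L2 a b g ->
  itg a b (fun t => ip (f t) (g t)) ^+ 2 <= sqn a b f * sqn a b g.
Proof.
move=> hf hg; set c := itg a b _.
have pos r : 0 <= sqn a b f - 2 * r * c + r ^+ 2 * sqn a b g.
  have h := L2_ip hf hg; case: (hf) (hg) => [_ fi] [_ gi].
  rewrite /c /sqn -!itgZ// -itgB//; last exact: itgbZ.
  rewrite -itgD; [|by apply: itgbB => //; exact: itgbZ|exact: itgbZ].
  apply: itg_ge0 => t _; have := sqr_ge0 `|f t - r *: g t|.
  by rewrite normB_sqr ipZr normrZ exprMn real_normK ?num_real// mulrA.
have n0 := sqn_ge0 a b g.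
have [g0|g0] := eqVneq (sqn a b g) 0.
  have [->|c0] := eqVneq c 0; first by rewrite g0 mulr0 expr0n.
  have := pos ((sqn a b f + 1) / (2 * c)); rewrite g0 mulr0 addr0.
  have -> : 2 * ((sqn a b f + 1) / (2 * c)) * c = sqn a b f + 1 by field.
  lra.
have gp : 0 < sqn a b g by rewrite lt_def g0.
have := pos (c / sqn a b g).
have -> : sqn a b f - 2 * (c / sqn a b g) * c + (c / sqn a b g) ^+ 2 * sqn a b g =
  (sqn a b f * sqn a b g - c ^+ 2) / sqn a b g by field.
by rewrite pmulr_lge0 ?invr_gt0// subr_ge0.
Qed.

Lemma geometric_le_harmonic (n : nat) : (10^-1 : R) ^+ n <= n.+1%:R^-1.
Proof.
elim: n => [|n IH]; first by rewrite expr0 invr1.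
rewrite exprS; apply: le_trans (ler_wpM2l _ IH) _; first by rewrite invr_ge0.
by rewrite -invfM lef_pV2 ?posrE ?mulr_gt0// -natrM ler_nat mulnS -[n.+2]/(2 + n)%N leq_add// leq_pmull.
Qed.

(** Completeness of L^2.  The squared increments are weighted by 10^i: the weighted series
  has an integrable sum, and where it is finite the sequence is Cauchy.  Squared
  increments of size 100^-n are increments of size 10^-n, and 100 / 81 is the square of
  the sum of the powers of 1 / 10. *)
Lemma riesz_fischer a b (F : nat -> R -> X) (c : R) : 0 <= c ->
  (forall n, L2 a b (F n)) ->
  (forall n, sqn a b (fun t => F n.+1 t - F n t) <= c * 100^-1 ^+ n) ->
  exists f, L2 a b f /\ forall n, sqn a b (fun t => f t - F n t) <= c * 100^-1 ^+ n * (100 / 81).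
Proof.
move=> c0 LF hF; pose q : R := 10^-1; have q0 : 0 < q by rewrite invr_gt0.
have q1 : q < 1 by rewrite invf_lt1// ltr1n.
have e100 n : (100^-1 : R) ^+ n = q ^+ n * q ^+ n.
  by rewrite -exprMn /q -invfM -natrM.
pose d (n : nat) t := `|F n.+1 t - F n t| ^+ 2 * 10 ^+ n.
have d0 n t : 0 <= d n t by rewrite mulr_ge0 ?sqr_ge0// exprn_ge0.
have q10 n : q ^+ n * 10 ^+ n = 1 by rewrite -exprMn mulVf// expr1n.
have part n m t : (n <= m)%N ->
    `|F m t - F n t| ^+ 2 <= 10 / 9 * q ^+ n * \sum_(n <= i < m) d i t.
  move=> /subnK <-; move: (m - n)%N => {m} p; elim: p n => [|p IH] n.
    by rewrite add0n subrr normr0 expr0n/= big_geq// mulr0.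
  rewrite big_ltn; last by rewrite addSn ltnS leq_addl.
  have -> : F (p.+1 + n)%N t - F n t = (F n.+1 t - F n t) + (F (p + n.+1)%N t - F n.+1 t).
    by rewrite addnS -addSn [RHS]addrC addrA subrK.
  set x := F n.+1 t - F n t; set y := F (p + n.+1)%N t - F n.+1 t.
  apply: (@le_trans _ _ (10 / 9 * `|x| ^+ 2 + 10 * `|y| ^+ 2)).
    (* |x + y|^2 <= (10 / 9) |x|^2 + 10 |y|^2 amounts to |x - 9 y|^2 >= 0. *)
    have := sqr_ge0 `|x - 9 *: y|; rewrite normB_sqr normD_sqr ipZr normrZ exprMn.
    by rewrite (ger0_norm (_ : 0 <= 9))//; lra.
  rewrite mulrDr; apply: lerD.
    have -> : 10 / 9 * q ^+ n * d n t = 10 / 9 * `|x| ^+ 2 * (q ^+ n * 10 ^+ n) by rewrite /d -/x; ring.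
    by rewrite q10 mulr1.
  have := IH n.+1; rewrite -/y addSnnS => h.
  apply: le_trans (ler_wpM2l (ler0n _ 10) h) _.
  by rewrite exprS /q le_eqVlt; apply/orP; left; apply/eqP; field.
pose G n t : \bar R := (\sum_(n <= i <oo) (d i t)%:E)%E.
have dE0 n t : (0 <= (d n t)%:E)%E by rewrite lee_fin.
have psum n m t : ((\sum_(n <= i < m) d i t)%:E <= G n t)%E.
  by rewrite -sumEFin; exact: nneseries_lim_ge.
have smF n : sm `]a, b[ (fun t => F n.+1 t - F n t).
  by apply: smB; [exact: (LF n.+1).1|exact: (LF n).1].
have md n : measurable_fun `]a, b[ (d n).
  by apply: measurable_funM => //; apply: measurable_funX; exact: sm_norm.
have GE n t : G n t = (\sum_(i <oo) (d (i + n)%N t)%:E)%E.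
  by rewrite /G -(@nneseries_addn _ (fun i => (d i t)%:E)).
have mG n : measurable_fun `]a, b[ (G n).
  rewrite (_ : G n = fun t => (\sum_(i <oo | i \in xpredT) (d (i + n)%N t)%:E)%E); last first.
    by apply/funext => t; rewrite GE.
  by apply: ge0_emeasurable_sum => // i _; apply/measurable_EFinP.
pose Good := `]a, b[%classic `&` [set t | (G 0%N t < +oo)%E].
have mGood : measurable Good by apply: emeasurable_fun_infty_o.
have cau t : Good t -> exists w : X, F n t @[n --> \oo] --> w.
  move=> [_ /= Gt]; have Gf : G 0%N t \is a fin_num.
    by rewrite ge0_fin_numE// nneseries_ge0.
  pose r := fine (G 0%N t).
  have r0 : 0 <= r by rewrite fine_ge0// nneseries_ge0.
  have hr n m : (n <= m)%N -> `|F m t - F n t| ^+ 2 <= 10 / 9 * q ^+ n * r.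
    move=> nm; apply: le_trans (part n m t nm) _; apply: ler_wpM2l.
      by rewrite mulr_ge0// exprn_ge0// ltW.
    rewrite -lee_fin /r fineK//; apply: le_trans (psum 0%N m t).
    by rewrite lee_fin (big_cat_nat (n := n) (m := 0%N))//= lerDr sumr_ge0.
  apply: cauchy_seq_cvg => e e0.
  have er : 0 < e ^+ 2 / (10 / 9 * r + 1) by rewrite divr_gt0 ?exprn_gt0// ltr_wpDl// mulr_ge0.
  have [N hN] := harmonic_lt er; exists N.
  have main n m : (N <= n)%N -> (n <= m)%N -> `|F m t - F n t| < e.
    move=> Nn nm; rewrite -(@ltr_pXn2r _ 2) ?nnegrE ?(ltW e0)//.
    apply: le_lt_trans (hr n m nm) _.
    have h1 : q ^+ n < e ^+ 2 / (10 / 9 * r + 1).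
      by apply: le_lt_trans (geometric_le_harmonic n) (hN n Nn).
    rewrite ltr_pdivlMr in h1; last by rewrite ltr_wpDl// mulr_ge0.
    by apply: le_lt_trans h1; rewrite mulrAC mulrC; apply: ler_wpM2l;
      [rewrite exprn_ge0// ltW|rewrite lerDl].
  move=> n m Nn Nm; have [nm|/ltnW mn] := leqP n m; last exact: main.
  by rewrite distrC; exact: main.
have /choice[w hw] : forall t, exists w : X, Good t -> F n t @[n --> \oo] --> w.
  move=> t; have [/cau[w ?]|nG] := pselect (Good t); [by exists w|by exists 0].
pose f t := if t \in Good then w t else 0.
have smf : sm `]a, b[ f.
  apply: (@sm_lim _ _ _ _ (fun n t => if t \in Good then F n t else 0)) => //.
    by move=> n; apply: sm_ite => //; exact: (LF n).1.
  by move=> t _; rewrite /f; case: ifPn => [/set_mem/hw|_] //; exact: cvg_cst.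
have point n t : `]a, b[%classic t ->
    ((`|f t - F n t| ^+ 2)%:E <= (10 / 9 * q ^+ n)%:E * G n t)%E.
  move=> Dt; have Gn0 : (0 <= G n t)%E by rewrite nneseries_ge0.
  have K0 : 0 < 10 / 9 * q ^+ n by rewrite mulr_gt0// exprn_gt0.
  case Gnt : (G n t) Gn0 => [r| |]//; last first.
    move=> _. rewrite gt0_muley ?lte_fin//. exact: leey.
  move=> _; have Gt : Good t.
    split=> //=; rewrite /G (nneseries_split 0%N n)// add0n -/(G n t) Gnt.
    by rewrite sumEFin -EFinD ltry.
  rewrite -EFinM lee_fin /f mem_set//.
  have lim : `|F m t - F n t| ^+ 2 @[m --> \oo] --> `|w t - F n t| ^+ 2.
    apply: (@cvg_comp _ _ _ (fun m => `|F m t - F n t|) (fun x : R => x ^+ 2)).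
      by apply: cvg_norm; apply: cvgB; [exact: hw|exact: cvg_cst].
    exact: exprn_continuous.
  apply: (ler_cvg_to lim (cvg_cst (10 / 9 * q ^+ n * r))); exists n => // m /= nm.
  apply: le_trans (part n m t nm) _; apply: ler_wpM2l; first exact: ltW.
  by rewrite -lee_fin -Gnt.
have intG n : (\int[mu]_(t in `]a, b[) G n t <= (c * q ^+ n * (10 / 9))%:E)%E.
  under eq_integral do rewrite GE.
  rewrite integral_nneseries//; last by move=> i; apply/measurable_EFinP; exact: md.
  apply: lime_le; first by apply: is_cvg_nneseries => i _ _; exact: integral_ge0.
  apply: nearW => m.
  apply: (@le_trans _ _ (\sum_(0 <= i < m) (c * q ^+ n * q ^+ i)%:E)%E).
    apply: lee_sum => i _; rewrite integral_itg; last first.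
      by have := itgbZ (10 ^+ (i + n)) (L2B (LF (i + n).+1) (LF (i + n)%N)).2; apply: eq_itgb => t _; rewrite mulrC.
    rewrite lee_fin.
    have -> : itg a b (d (i + n)%N) = 10 ^+ (i + n) * sqn a b (fun t => F (i + n).+1 t - F (i + n)%N t).
      rewrite /sqn -itgZ; last exact: (L2B (LF (i + n).+1) (LF (i + n)%N)).2.
      by apply: eq_itg => t _; rewrite mulrC.
    apply: le_trans (ler_wpM2l _ (hF _)) _; first by rewrite exprn_ge0.
    rewrite e100.
    have -> : 10 ^+ (i + n) * (c * (q ^+ (i + n) * q ^+ (i + n))) = c * q ^+ (i + n) * (q ^+ (i + n) * 10 ^+ (i + n)) by ring.
    by rewrite q10 mulr1 exprD; rewrite [q ^+ i * _]mulrC mulrA.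
  rewrite sumEFin lee_fin.
  have geo : \sum_(0 <= i < m) (c * q ^+ n * q ^+ i) = c * q ^+ n * (10 / 9) * (1 - q ^+ m).
    elim: m => [|m IH]; first by rewrite big_geq// expr0 subrr mulr0.
    by rewrite big_nat_recr//= IH exprS /q; field.
  rewrite geo ler_piMr//; last by rewrite gerBl exprn_ge0// ltW.
  by rewrite !mulr_ge0// exprn_ge0// ltW.
have bound n : (\int[mu]_(t in `]a, b[) (`|f t - F n t| ^+ 2)%:E <=
    (c * 100^-1 ^+ n * (100 / 81))%:E)%E.
  have K0 : 0 <= 10 / 9 * q ^+ n by rewrite mulr_ge0// exprn_ge0// ltW.
  apply: (@le_trans _ _ (\int[mu]_(t in `]a, b[) ((10 / 9 * q ^+ n)%:E * G n t))%E).
    apply: ge0_le_integral => //.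
    - by apply/measurable_EFinP; apply: measurable_funX; apply: sm_norm; apply: smB => //; exact: (LF n).1.
    - by apply: measurable_funeM; exact: mG.
    - exact: point.
  rewrite ge0_integralZl; try exact: mG; try (by rewrite lee_fin);
    try (by move=> t _; rewrite nneseries_ge0); try exact: measurable_itv.
  apply: (@le_trans _ _ ((10 / 9 * q ^+ n)%:E * (c * q ^+ n * (10 / 9))%:E)%E).
    by apply: lee_wpmul2l; [rewrite lee_fin|exact: intG].
  by rewrite -EFinM lee_fin e100 le_eqVlt; apply/orP; left; apply/eqP; field.
have if_ n : itgb a b (fun t => `|f t - F n t| ^+ 2).
  apply: itgb_lty.
    by apply: measurable_funX; apply: sm_norm; apply: smB => //; exact: (LF n).1.
  under eq_integral do rewrite ger0_norm ?sqr_ge0//.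
  exact: le_lt_trans (bound n) (ltry _).
exists f; split.
  split => //; apply: (itgb_dominated (g := fun t => 2 * `|f t - F 0%N t| ^+ 2 + 2 * `|F 0%N t| ^+ 2)).
  - by apply: measurable_funX; exact: sm_norm.
  - by apply: itgbD; apply: itgbZ => //; exact: (LF 0%N).2.
  - move=> t _; rewrite ger0_norm ?sqr_ge0//.
    by have := normD_sqr_le (f t - F 0%N t) (F 0%N t); rewrite subrK.
by move=> n; rewrite -lee_fin /sqn -integral_itg.
Qed.

End SquareIntegrable.

(** * Test functions *)

Section SmoothFunctions.
Context {R : realType}.
Implicit Types (f g : R -> R).

Definition smooth f := forall n t, derivable (derive1n n f) t 1.

(** Smoothness in a recursive form that goes through products. *)
Fixpoint times_derivable (n : nat) f : Prop :=
  (forall t, derivable f t 1) /\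
  (if n is n'.+1 then times_derivable n' (derive1 f) else True).

Lemma itg_void f (a b : R) : b <= a -> itg a b f = 0.
Proof. by move=> ba; rewrite /itg set_itv_ge ?Rintegral_set0// -leNgt bnd_simp. Qed.

Lemma is_derive_constant (c x : R) : is_derive x (1 : R) (fun=> c) (0 : R).
Proof.
apply/is_derive_littleoP => e e0; exists 1 => // h _.
by rewrite subrr scaler0 subr0 normr0 mulr_ge0// ltW.
Qed.

Lemma times_derivable_smooth f : (forall n, times_derivable n f) -> smooth f.
Proof.
move=> hf n; have := hf n; clear hf; elim: n f => [|n IH] f [df hf] t; first exact: df.
by rewrite /derive1n iterSr; exact: IH.
Qed.

Lemma times_derivableW n f : times_derivable n.+1 f -> times_derivable n f.
Proof.
elim: n f => [|n IH] f [df hf]; split; [exact: df|exact: I|exact: df|].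
by apply: IH; exact: hf.
Qed.

Lemma times_derivableD n f g : times_derivable n f -> times_derivable n g ->
  times_derivable n (fun t => f t + g t).
Proof.
elim: n f g => [|n IH] f g [df hf] [dg hg]; split.
- by move=> t; apply: derivableD; [exact: df|exact: dg].
- exact: I.
- by move=> t; apply: derivableD; [exact: df|exact: dg].
have -> : derive1 (fun t => f t + g t) = (fun t => derive1 f t + derive1 g t).
  by apply/funext => t; rewrite !derive1E; exact: (deriveD (df t) (dg t)).
by apply: IH; [exact: hf|exact: hg].
Qed.

Lemma times_derivableM n f g : times_derivable n f -> times_derivable n g ->
  times_derivable n (fun t => f t * g t).
Proof.
elim: n f g => [|n IH] f g hf hg; have [df hf'] := hf; have [dg hg'] := hg; split.
- by move=> t; apply: derivableM; [exact: df|exact: dg].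
- exact: I.
- by move=> t; apply: derivableM; [exact: df|exact: dg].
have -> : derive1 (fun t => f t * g t) = (fun t => f t * derive1 g t + g t * derive1 f t).
  by apply/funext => t; rewrite !derive1E; exact: (deriveM (df t) (dg t)).
apply: times_derivableD; apply: IH.
- exact: times_derivableW hf.
- exact: hg'.
- exact: times_derivableW hg.
- exact: hf'.
Qed.

Lemma is_derive_affine f (a b x l : R) : is_derive (a * x + b) (1 : R) f l ->
  is_derive x (1 : R) (fun t => f (a * t + b)) (a * l).
Proof.
move=> h; have h2 : is_derive x (1 : R) (fun t : R => a * t + b) a.
  have := is_deriveD (is_deriveZ a (is_derive_id x (1 : R))) (is_derive_cst b x (1 : R)).
  by rewrite /GRing.scale /= mulr1 addr0.
by have := @is_derive1_comp _ f (fun t : R => a * t + b) _ _ _ h h2; rewrite mulrC.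
Qed.

Lemma derivable_is_derive f x : derivable f x 1 -> is_derive x (1 : R) f (derive1 f x).
Proof. by move=> df; apply: DeriveDef => //; rewrite derive1E. Qed.

Lemma times_derivable_cst n (c : R) : times_derivable n (fun=> c).
Proof.
have dc c' t : derivable (fun=> c' : R) t (1 : R) by have [] := is_derive_constant c' t.
elim: n c => [|n IH] c; split; [exact: dc|exact: I|exact: dc|].
have -> : derive1 (fun=> c) = (fun=> 0) :> (R -> R).
  by apply/funext => t; rewrite derive1E; have [_ ->] := is_derive_constant c t.
exact: IH.
Qed.

Lemma times_derivable_affine n f (a b : R) : times_derivable n f ->
  times_derivable n (fun t => f (a * t + b)).
Proof.
have aux g t : derivable g (a * t + b) 1 -> derivable (fun t => g (a * t + b)) t 1.
  by move=> dg; have [] := is_derive_affine (derivable_is_derive dg).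
elim: n f => [|n IH] f [df hf]; split.
- by move=> t; apply: aux; exact: df.
- exact: I.
- by move=> t; apply: aux; exact: df.
have -> : derive1 (fun t => f (a * t + b)) = (fun t => a * derive1 f (a * t + b)).
  apply/funext => t; rewrite derive1E.
  by have [_ ->] := is_derive_affine (derivable_is_derive (df (a * t + b))).
by apply: times_derivableM; [exact: times_derivable_cst|apply: IH; exact: hf].
Qed.

(** p(1/x) exp(-1/x) for x > 0, extended by 0. *)
Definition flat (p : {poly R}) (x : R) : R :=
  if 0 < x then p.[x^-1] * expR (- x^-1) else 0.

Definition flat_deriv (p : {poly R}) : {poly R} := 'X^2 * (p - p^`()).

(** (y / m.+1)^m.+1 <= exp y, as u <= exp u. *)
Lemma expRN_pow_le (m : nat) (y : R) : 0 < y ->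
  y ^+ m * expR (- y) <= m.+1%:R ^+ m.+1 / y.
Proof.
move=> y0; have m0 : (0 : R) < m.+1%:R by rewrite ltr0n.
have h : (y / m.+1%:R) ^+ m.+1 <= expR y.
  have ye : y = m.+1%:R * (y / m.+1%:R) by rewrite mulrC divfK// gt_eqF.
  rewrite [in expR y]ye expRM_natl.
  rewrite ler_pXn2r ?nnegrE ?expR_ge0//; last by apply: divr_ge0; exact: ltW.
  by apply: le_trans (expR_ge1Dx _); rewrite lerDr.
rewrite expRN ler_pdivrMr ?expR_gt0// mulrAC ler_pdivlMr// -exprSr.
move: h; rewrite exprMn exprVn ler_pdivrMr ?exprn_gt0//.
by rewrite mulrC.
Qed.

Lemma poly_le_pow (p : {poly R}) : exists2 C : R, 0 <= C &
  forall y, 1 <= y -> `|p.[y]| <= C * y ^+ size p.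
Proof.
exists (\sum_(i < size p) `|p`_i|) => [|y y1]; first by rewrite sumr_ge0.
rewrite horner_coef mulr_suml; apply: le_trans (ler_norm_sum _ _ _) _.
apply: ler_sum => i _; rewrite normrM ler_wpM2l// ger0_norm ?exprn_ge0//; last by lra.
by rewrite ler_weXn2l// ltnW.
Qed.

(** The derivative is again of the form [flat], also at 0, where [expRN_pow_le] makes the
  difference quotient vanish; hence [flat] is smooth. *)
Lemma is_derive_flat p x : is_derive x (1 : R) (flat p) (flat (flat_deriv p) x).
Proof.
have [x0|x0|->] := ltgtP x 0.
- rewrite /flat [X in is_derive _ _ _ X](_ : _ = 0); last by case: ifP => //; lra.
  apply: (is_derive_near _ (is_derive_constant 0 x)).
  exists (- x) => [|h]; first by rewrite oppr_gt0.
  by rewrite ltr_norml => /andP[h1 h2]; case: ifP => //; lra.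
- have dinv : is_derive x (1 : R) (fun t : R => t^-1) (- x ^- 2).
    have := @is_deriveV _ (fun t : R => t) x 1 1 (lt0r_neq0 x0) (is_derive_id x (1 : R)).
    by rewrite /GRing.scale /= mulr1.
  have dp := @is_derive1_comp _ (horner p) (fun t : R => t^-1) _ _ _ (is_derive_poly p x^-1) dinv.
  have dN := is_deriveN dinv.
  have de := @is_derive1_comp _ expR (fun t : R => - t^-1) _ _ _ (is_derive_expR (- x^-1)) dN.
  have dM := is_deriveM dp de.
  apply: (@is_derive_near _ _ _ (fun t => p.[t^-1] * expR (- t^-1))).
    exists x => // h; rewrite ltr_norml => /andP[h1 h2].
    by rewrite /flat; case: ifP => //; lra.
  suff -> : flat (flat_deriv p) x = p.[x^-1] *: (expR (- x^-1) * - - x ^- 2) +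
      expR (- x^-1) *: (p^`().[x^-1] * - x ^- 2) by exact: dM.
  rewrite /flat x0 /flat_deriv hornerM hornerXn hornerD hornerN /GRing.scale /=.
  by rewrite exprVn; ring.
- have -> : flat (flat_deriv p) 0 = 0 by rewrite /flat ltxx.
  apply/is_derive_littleoP => e e0; have [C C0 hC] := poly_le_pow p.
  pose m := (size p).+1; pose K := C * m.+1%:R ^+ m.+1 + 1.
  have K0 : 0 < K by rewrite ltr_wpDl// mulr_ge0// exprn_ge0.
  exists (Num.min 1 (e / K)) => [|h]; first by rewrite lt_min ltr01 divr_gt0.
  rewrite lt_min => /andP[h1 he]; rewrite add0r scaler0 subr0 {2}/flat ltxx subr0 /flat.
  case: ifPn => [h0|_]; last by rewrite normr0 mulr_ge0// ltW.
  rewrite (gtr0_norm h0) in h1 he *.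
  have y0 : 0 < h^-1 by rewrite invr_gt0.
  have y1 : 1 <= h^-1 by rewrite -invr1 lef_pV2 ?posrE ?ltW.
  rewrite normrM (ger0_norm (expR_ge0 _)).
  apply: (@le_trans _ _ (C * (h^-1 ^+ size p * expR (- h^-1)))).
    by rewrite mulrA ler_wpM2r ?expR_ge0// hC.
  have := expRN_pow_le m y0; rewrite /m exprS -mulrA invrK mulrC.
  rewrite ler_pdivrMr// => hh; apply: le_trans (ler_wpM2l C0 hh) _.
  have hK : K * h <= e by rewrite -ler_pdivlMl// mulrC ltW.
  rewrite mulrA; apply: ler_wpM2r; first exact: ltW.
  apply: le_trans hK; rewrite mulrA; apply: ler_wpM2r; first exact: ltW.
  by rewrite /K lerDl.
Qed.

Lemma times_derivable_flat n p : times_derivable n (flat p).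
Proof.
have df p' t : derivable (flat p') t 1 by have [] := is_derive_flat p' t.
elim: n p => [|n IH] p; split; [exact: df|exact: I|exact: df|].
have -> : derive1 (flat p) = flat (flat_deriv p); last exact: IH.
by apply/funext => t; rewrite derive1E; have [_ ->] := is_derive_flat p t.
Qed.

Lemma times_derivable_continuous n f : times_derivable n f -> continuous f.
Proof.
by case: n => [|n] [df _] t; apply/differentiable_continuous/derivable1_diffP.
Qed.

(** Supported in [1/3, 2/3]. *)
Definition bump (x : R) : R := flat 1 (x - 3^-1) * flat 1 (2 / 3 - x).

Lemma flat1_ge0 x : 0 <= flat 1 x.
Proof. by rewrite /flat hornerC mul1r; case: ifP => // _; exact: expR_ge0. Qed.

Lemma flat1_gt0 x : 0 < x -> 0 < flat 1 x.
Proof. by move=> x0; rewrite /flat x0 hornerC mul1r expR_gt0. Qed.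

Lemma bump_ge0 x : 0 <= bump x.
Proof. by rewrite mulr_ge0// flat1_ge0. Qed.

Lemma bump_l x : x <= 3^-1 -> bump x = 0.
Proof. by move=> h; rewrite /bump {1}/flat subr_gt0 ltNge h mul0r. Qed.

Lemma bump_r x : 2 / 3 <= x -> bump x = 0.
Proof. by move=> h; rewrite /bump {2}/flat subr_gt0 ltNge h mulr0. Qed.

Lemma times_derivable_bump n : times_derivable n bump.
Proof.
apply: times_derivableM.
  have -> : (fun t => flat 1 (t - 3^-1)) = (fun t => flat 1 (1 * t + - 3^-1)).
    by apply/funext => t; rewrite mul1r.
  by apply: times_derivable_affine; exact: times_derivable_flat.
have -> : (fun t => flat 1 (2 / 3 - t)) = (fun t => flat 1 (- 1 * t + 2 / 3)).
  by apply/funext => t; rewrite mulN1r addrC.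
by apply: times_derivable_affine; exact: times_derivable_flat.
Qed.

Lemma bump_continuous : continuous bump.
Proof. exact: times_derivable_continuous (times_derivable_bump 0). Qed.

Definition bump_mass : R := itg (-1) 1 bump.

Lemma bump_mass_gt0 : 0 < bump_mass.
Proof.
have h0 : 0 < bump 2^-1 by rewrite /bump mulr_gt0// flat1_gt0//; lra.
have /cvgrPdist_lt/(_ _ (divr_gt0 h0 (ltr0n _ 2)))/nbhs_ballP[d /= d0 hd] := @bump_continuous 2^-1.
pose e := Num.min d 2^-1; have e0 : 0 < e by rewrite lt_min d0 invr_gt0 ltr0n.
have ed : e <= d by rewrite ge_min lexx.
have e2 : e <= 2^-1 by rewrite ge_min lexx orbT.
have ib a b : itgb a b bump by apply: itgb_continuous; exact: bump_continuous.
rewrite /bump_mass (@itg_chasles _ _ _ 2^-1)//; [|lra|lra].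
rewrite (@itg_chasles _ _ 2^-1 (2^-1 + e))//; [|lra|lra].
apply: ltr_wpDl; first by apply: itg_ge0 => t _; exact: bump_ge0.
apply: ltr_pwDl; last by apply: itg_ge0 => t _; exact: bump_ge0.
apply: (@lt_le_trans _ _ (bump 2^-1 / 2 * (2^-1 + e - 2^-1))).
  by rewrite mulr_gt0 ?divr_gt0//; lra.
rewrite -itg_cst; last by lra.
apply: le_itg => //; first exact: itgb_cst.
move=> t /andP[t1 t2]; have : ball (2^-1 : R) d t.
  by rewrite -ball_normE /= ltr_norml; apply/andP; split; lra.
by move/hd => /=; rewrite ltr_norml => /andP[_]; lra.
Qed.

Definition step (x : R) : R := itg (-1) x bump / bump_mass.

Lemma step_l x : x <= 3^-1 -> step x = 0.
Proof.
move=> h; rewrite /step; have [x1|x1] := leP (-1) x; last first.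
  by rewrite itg_void ?mul0r//; lra.
rewrite (@eq_itg _ _ (fun=> 0)) ?itg_cst ?mul0r// => t /andP[_ tx].
by apply: bump_l; lra.
Qed.

Lemma step_r x : 2 / 3 <= x -> step x = 1.
Proof.
move=> h; have b0 := bump_mass_gt0; rewrite /step.
have ib a b : itgb a b bump by apply: itgb_continuous; exact: bump_continuous.
have two y : 2 / 3 <= y -> itg (-1) y bump = itg (-1) (2 / 3) bump.
  move=> hy; rewrite (@itg_chasles _ _ _ (2 / 3))//; last by lra.
  rewrite [X in _ + X](@eq_itg _ _ (fun=> 0)) ?itg_cst ?mul0r ?addr0// => t /andP[t1 _].
  by apply: bump_r; lra.
by rewrite two// -(two 1) ?divff// ?gt_eqF//; lra.
Qed.

Lemma step_itv x : 0 <= step x <= 1.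
Proof.
have b0 := bump_mass_gt0.
have ib a b : itgb a b bump by apply: itgb_continuous; exact: bump_continuous.
apply/andP; split.
  by rewrite divr_ge0 ?(ltW b0)//; apply: itg_ge0 => t _; exact: bump_ge0.
have [x1|x1] := leP (2 / 3) x; first by rewrite step_r.
rewrite /step ler_pdivrMr// mul1r /bump_mass.
have [x2|x2] := leP (-1) x; last first.
  rewrite [leLHS]itg_void; last by lra.
  by apply: itg_ge0 => t _; exact: bump_ge0.
rewrite [leRHS](@itg_chasles _ _ _ x)//; last by lra.
by rewrite lerDl; apply: itg_ge0 => t _; exact: bump_ge0.
Qed.

Lemma is_derive_step x : is_derive x (1 : R) step (bump x / bump_mass).
Proof.
have [x0|x0] := ltP x 0.
  rewrite bump_l ?mul0r; last by lra.
  apply: (is_derive_near _ (is_derive_constant 0 x)).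
  exists (- x) => [|h]; first by rewrite oppr_gt0.
  by rewrite ltr_norml => /andP[h1 h2]; apply: step_l; lra.
have h : is_derive x (1 : R) (fun t => itg (-1) t bump) (bump x).
  by apply: itg_FTC1; [exact: bump_continuous|lra].
have := is_deriveZ bump_mass^-1 h.
rewrite /GRing.scale /= mulrC; congr is_derive.
by apply/funext => t; rewrite /step mulrC.
Qed.

Lemma times_derivable_step n : times_derivable n step.
Proof.
have df t : derivable step t 1 by have [] := is_derive_step t.
case: n => [|n]; split; [exact: df|exact: I|exact: df|].
have -> : derive1 step = (fun t => bump t * bump_mass^-1).
  by apply/funext => t; rewrite derive1E; have [_ ->] := is_derive_step t.
by apply: times_derivableM; [exact: times_derivable_bump|exact: times_derivable_cst].
Qed.

(** It rises from 0 to 1 on [s, s + e] and falls back on [t - e, t]. *)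
Definition plateau (s t e x : R) : R :=
  step (e^-1 * x + - (s / e)) + - 1 * step (e^-1 * x + (1 - t / e)).

Lemma plateau_test (T s t e : R) : 0 < e -> 0 <= s -> s + 2 * e <= t -> t <= T ->
  test_function T (plateau s t e).
Proof.
move=> e0 s0 st tT; split.
  apply: times_derivable_smooth => n; apply: times_derivableD.
    by apply: times_derivable_affine; exact: times_derivable_step.
  apply: times_derivableM; first exact: times_derivable_cst.
  by apply: times_derivable_affine; exact: times_derivable_step.
exists (s + e / 3), (t - e / 3); split; [lra|lra|] => x.
apply: contraNT; rewrite negb_and -!ltNge => /orP[h|h]; apply/eqP.
  have h1 : e^-1 * x - s / e <= 3^-1.
    have -> : e^-1 * x - s / e = (x - s) / e by field; rewrite gt_eqF.
    by rewrite ler_pdivrMr//; lra.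
  rewrite /plateau !step_l ?mulr0 ?addr0//.
  have -> : e^-1 * x + (1 - t / e) = (x + e - t) / e by field; rewrite gt_eqF.
  by rewrite ler_pdivrMr//; lra.
have h1 : 2 / 3 <= e^-1 * x + (1 - t / e).
  have -> : e^-1 * x + (1 - t / e) = (x + e - t) / e by field; rewrite gt_eqF.
  by rewrite ler_pdivlMr//; lra.
rewrite /plateau !step_r ?mulr1 ?subrr// ?mulN1r ?subrr//.
have -> : e^-1 * x - s / e = (x - s) / e by field; rewrite gt_eqF.
by rewrite ler_pdivlMr//; lra.
Qed.

End SmoothFunctions.

(** * The lemma of du Bois-Reymond *)

Section DuBoisReymond.
Context {R : realType}.
Local Notation mu := (@lebesgue_measure R).

Lemma itg_dominated_cvg (F : nat -> R -> R) (f g : R -> R) (a b : R) :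
  (forall n, itgb a b (F n)) -> itgb a b g ->
  (forall n x, a < x < b -> `|F n x| <= g x) ->
  (forall x, a < x < b -> F n x @[n --> \oo] --> f x) ->
  itg a b (F n) @[n --> \oo] --> itg a b f.
Proof.
move=> iF ig Fg Ff.
have mf : measurable_fun `]a, b[ f.
  apply: (@measurable_fun_cvg _ _ _ _ F); first by move=> n; exact: itgb_measurable.
  by move=> x; rewrite /= in_itv /=; exact: Ff.
have [|||||if_ _] := @dominated_convergence _ _ _ mu `]a, b[%classic (measurable_itv _)
   (fun n t => (F n t)%:E) (EFin \o f) (fun t => (g t)%:E).
- by move=> n; apply/measurable_EFinP; exact: itgb_measurable.
- by apply/measurable_EFinP.
- apply/aeW => t; rewrite /= in_itv /= => tab; apply: cvg_EFin; first exact: nearW.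
  exact: Ff.
- exact: ig.
- apply/aeW => t n; rewrite /= in_itv /= => tab; rewrite lee_fin; exact: Fg.
move=> h; have e1 : (fun n => \int[mu]_(x in `]a, b[) (F n x)%:E)%E = EFin \o (fun n => itg a b (F n)).
  by apply/funext => n /=; rewrite integral_itg.
have e2 : (\int[mu]_(x in `]a, b[) (EFin \o f) x)%E = (itg a b f)%:E by exact: integral_itg.
move: h; rewrite e2 e1 => /fine_cvgP[_]; exact.
Qed.

Definition step_deriv (e c x : R) : R := e^-1 * (bump (e^-1 * x + c) / bump_mass).

Lemma is_derive_step_affine (e c x : R) :
  is_derive x (1 : R) (fun t => step (e^-1 * t + c)) (step_deriv e c x).
Proof. by apply: is_derive_affine; exact: is_derive_step. Qed.

Lemma step_deriv_continuous (e c : R) : continuous (step_deriv e c).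
Proof.
move=> x; apply: cvgM; first exact: cvg_cst.
apply: cvgM; last exact: cvg_cst.
apply: continuous_cvg; first exact: bump_continuous.
by apply: cvgD; [apply: cvgM; [exact: cvg_cst|exact: cvg_id]|exact: cvg_cst].
Qed.

Lemma step_affine_continuous (e c : R) : continuous (fun t : R => step (e^-1 * t + c)).
Proof. by move=> x; exact: is_derive_continuous (is_derive_step_affine e c x). Qed.

(** [step_deriv] is an approximate identity supported where e^-1 x + c is in [1/3, 2/3]. *)
Lemma step_deriv_mean (a : R -> R) (T e c p eta : R) : 0 <= T -> 0 < e -> continuous a ->
  e^-1 * T + c >= 2 / 3 -> c <= 3^-1 ->
  (forall x, 3^-1 < e^-1 * x + c < 2 / 3 -> `|a x - a p| <= eta) ->
  `|itg 0 T (fun x => step_deriv e c x * a x) - a p| <= eta.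
Proof.
move=> T0 e0 ca hT h0 heta; have m0 := bump_mass_gt0 (R := R).
have ck := step_deriv_continuous (e := e) (c := c).
have mass : itg 0 T (step_deriv e c) = 1.
  rewrite (_ : 1 = step (e^-1 * T + c) - step (e^-1 * 0 + c)); last first.
    by rewrite mulr0 add0r step_r// step_l// subr0.
  apply: (@itg_FTC2 _ (fun t => step (e^-1 * t + c))) => //.
  - by apply: continuous_subspaceT; exact: step_affine_continuous.
  - by apply: continuous_subspaceT; exact: step_deriv_continuous.
  - by move=> x _; exact: is_derive_step_affine.
have k0 x : 0 <= step_deriv e c x.
  by rewrite /step_deriv mulr_ge0 ?invr_ge0 ?(ltW e0)// divr_ge0 ?(ltW m0)// bump_ge0.
have ik : itgb 0 T (step_deriv e c) by apply: itgb_continuous; exact: step_deriv_continuous.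
have cka : continuous (fun x => step_deriv e c x * a x).
  by move=> x; apply: cvgM; [exact: step_deriv_continuous|exact: ca].
have -> : a p = itg 0 T (fun x => a p * step_deriv e c x) by rewrite itgZ// mass mulr1.
rewrite -itgB; [|exact: itgb_continuous|exact: itgbZ].
rewrite -[leRHS]mulr1 -mass -itgZ//.
have id : itgb 0 T (fun x => step_deriv e c x * a x - a p * step_deriv e c x).
  by apply: itgbB; [exact: itgb_continuous|exact: itgbZ].
apply: le_trans (norm_itg id) _; apply: le_itg; [exact: itgb_norm|exact: itgbZ|].
move=> x _; rewrite [step_deriv e c x * _]mulrC -mulrBl normrM (ger0_norm (k0 x)).
have [->|kx] := eqVneq (step_deriv e c x) 0; first by rewrite !mulr0.
apply: ler_wpM2r => //; apply: heta; apply/andP; split; rewrite ltNge; apply: contra kx => h;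
  apply/eqP; rewrite /step_deriv.
  by rewrite bump_l// mul0r mulr0.
by rewrite bump_r// mul0r mulr0.
Qed.

Lemma plateau_derive1 (s t e x : R) : derive1 (plateau s t e) x =
  step_deriv e (- (s / e)) x - step_deriv e (1 - t / e) x.
Proof.
rewrite derive1E.
have h1 := is_derive_step_affine e (- (s / e)) x.
have h2 := is_deriveZ (-1) (is_derive_step_affine e (1 - t / e) x).
have [_] := is_deriveD h1 h2.
by rewrite scaleN1r.
Qed.

(** Test with plateaus that converge to the indicator function of [s, t]: their
  derivatives are approximate identities at s and at t. *)
Lemma du_bois_reymond (T : R) (a b : R -> R) : continuous a -> itgb 0 T b ->
  (forall psi, test_function T psi ->
     itg 0 T (fun x => derive1 psi x * a x) = - itg 0 T (fun x => psi x * b x)) ->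
  forall s t, 0 <= s -> s <= t -> t <= T -> a t - a s = itg s t b.
Proof.
move=> ca ib weak s t s0; rewrite le_eqVlt => /predU1P[<- _|st tT].
  by rewrite subrr itg_refl.
have T0 : 0 < T by lra.
pose e (n : nat) := (t - s) / 2 / n.+1%:R.
have e0 n : 0 < e n by rewrite /e !divr_gt0// subr_gt0.
have e2 n : s + 2 * e n <= t.
  suff : e n <= (t - s) / 2 by lra.
  rewrite /e ler_pdivrMr// ler_peMr// ?ler1n// divr_ge0//; lra.
have ebound d : 0 < d -> exists N, forall n, (N <= n)%N -> e n < d.
  move=> d0; have d1 : 0 < d / ((t - s) / 2) by rewrite !divr_gt0// subr_gt0.
  have [N hN] := harmonic_lt d1; exists N => n /hN.
  by rewrite ltr_pdivlMr ?divr_gt0 ?subr_gt0// mulrC.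
have hpsi n := plateau_test (e0 n) s0 (e2 n) tT.
have L1 : itg 0 T (fun x => derive1 (plateau s t (e n)) x * a x) @[n --> \oo] --> a s - a t.
  apply/cvgrPdist_le => eta eta0; have eta2 : 0 < eta / 2 by rewrite divr_gt0.
  have /cvgrPdist_le/(_ _ eta2)/nbhs_ballP[d1 /= d10 hd1] := ca s.
  have /cvgrPdist_le/(_ _ eta2)/nbhs_ballP[d2 /= d20 hd2] := ca t.
  have [N1 hN1] := ebound _ d10; have [N2 hN2] := ebound _ d20.
  exists (maxn N1 N2) => // n /=; rewrite geq_max => /andP[/hN1 n1 /hN2 n2].
  have en := e0 n; have e2n := e2 n.
  have -> : itg 0 T (fun x => derive1 (plateau s t (e n)) x * a x) =
     itg 0 T (fun x => step_deriv (e n) (- (s / e n)) x * a x) -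
     itg 0 T (fun x => step_deriv (e n) (1 - t / e n) x * a x).
    rewrite -itgB; last 2 first.
    - by apply: itgb_continuous => x; apply: cvgM; [exact: step_deriv_continuous|exact: ca].
    - by apply: itgb_continuous => x; apply: cvgM; [exact: step_deriv_continuous|exact: ca].
    by apply: eq_itg => x _; rewrite plateau_derive1 mulrBl.
  have A1 : `|itg 0 T (fun x => step_deriv (e n) (- (s / e n)) x * a x) - a s| <= eta / 2.
    apply: step_deriv_mean => //; first exact: ltW.
    - have -> : (e n)^-1 * T + - (s / e n) = (T - s) / e n by field; rewrite gt_eqF.
      by rewrite ler_pdivlMr//; lra.
    - by apply: (@le_trans _ _ 0); rewrite ?invr_ge0// oppr_le0 divr_ge0// ltW.
    move=> x; have -> : (e n)^-1 * x + - (s / e n) = (x - s) / e n by field; rewrite gt_eqF.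
    rewrite ltr_pdivlMr// ltr_pdivrMr// => /andP[x1 x2]; rewrite distrC; apply: hd1.
    by rewrite -ball_normE /= ltr_norml; apply/andP; split; lra.
  have A2 : `|itg 0 T (fun x => step_deriv (e n) (1 - t / e n) x * a x) - a t| <= eta / 2.
    apply: step_deriv_mean => //; first exact: ltW.
    - have -> : (e n)^-1 * T + (1 - t / e n) = (T - t) / e n + 1 by field; rewrite gt_eqF.
      have : 0 <= (T - t) / e n by rewrite divr_ge0 ?(ltW en)//; lra.
      lra.
    - have : 2 <= t / e n by rewrite ler_pdivlMr//; lra.
      lra.
    move=> x; have -> : (e n)^-1 * x + (1 - t / e n) = (x + e n - t) / e n by field; rewrite gt_eqF.
    rewrite ltr_pdivlMr// ltr_pdivrMr// => /andP[x1 x2]; rewrite distrC; apply: hd2.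
    by rewrite -ball_normE /= ltr_norml; apply/andP; split; lra.
  move: A1 A2; set I1 := itg _ _ _; set I2 := itg _ _ _ => A1 A2.
  have -> : a s - a t - (I1 - I2) = (I2 - a t) - (I1 - a s) by ring.
  by apply: le_trans (ler_normB _ _) _; rewrite [eta]splitr; apply: lerD.
have pl n x : s < x < t -> `|plateau s t (e n) x| <= 2.
  move=> _; rewrite /plateau mulN1r; apply: le_trans (ler_normB _ _) _.
  have /andP[h1 h2] := step_itv ((e n)^-1 * x + - (s / e n)).
  have /andP[h3 h4] := step_itv ((e n)^-1 * x + (1 - t / e n)).
  by rewrite !ger0_norm//; lra.
have cpl n : continuous (plateau s t (e n)).
  move=> x; apply: cvgD; first exact: step_affine_continuous.
  by apply: cvgM; [exact: cvg_cst|exact: step_affine_continuous].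
have mpl n a' b' : itgb a' b' b -> itgb a' b' (fun x => plateau s t (e n) x * b x).
  move=> ib'; apply: (itgb_dominated (g := fun x => 2 * `|b x|)).
  - apply: measurable_funM; last exact: itgb_measurable.
    by apply: measurable_funTS; exact: continuous_measurable_fun.
  - by apply: itgbZ; exact: itgb_norm.
  move=> x _; rewrite normrM ler_wpM2r// /plateau mulN1r; apply: le_trans (ler_normB _ _) _.
  have /andP[h1 h2] := step_itv ((e n)^-1 * x + - (s / e n)).
  have /andP[h3 h4] := step_itv ((e n)^-1 * x + (1 - t / e n)).
  by rewrite !ger0_norm//; lra.
have ibst : itgb s t b by apply: itgb_subitv ib => //; lra.
have L2 : itg 0 T (fun x => plateau s t (e n) x * b x) @[n --> \oo] --> itg s t b.
  have -> : (fun n => itg 0 T (fun x => plateau s t (e n) x * b x)) =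
     (fun n => itg s t (fun x => plateau s t (e n) x * b x)).
    apply/funext => n; have en := e0 n; have e2n := e2 n.
    rewrite (@itg_chasles _ _ 0 s T)//; [|lra|exact: mpl].
    rewrite (@itg_chasles _ _ s t T)//; [|lra|apply: mpl; apply: itgb_subitv ib => //; lra].
    rewrite [X in X + _](@eq_itg _ _ (fun=> 0)).
      rewrite [X in _ + (_ + X)](@eq_itg _ _ (fun=> 0)).
        by rewrite !itg_cst ?mul0r ?add0r ?addr0//; lra.
      move=> x /andP[tx _]; rewrite /plateau !step_r ?mulr1 ?subrr ?mul0r//.
      - have -> : (e n)^-1 * x + (1 - t / e n) = (x - t) / e n + 1 by field; rewrite gt_eqF.
        have : 0 <= (x - t) / e n by rewrite divr_ge0 ?(ltW en)//; lra.
        lra.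
      - have -> : (e n)^-1 * x + - (s / e n) = (x - s) / e n by field; rewrite gt_eqF.
        by rewrite ler_pdivlMr//; lra.
    move=> x /andP[_ xs]; rewrite /plateau !step_l ?mulr0 ?addr0 ?mul0r//.
    - have -> : (e n)^-1 * x + (1 - t / e n) = (x + e n - t) / e n by field; rewrite gt_eqF.
      by rewrite ler_pdivrMr//; lra.
    - have -> : (e n)^-1 * x + - (s / e n) = (x - s) / e n by field; rewrite gt_eqF.
      by rewrite ler_pdivrMr//; lra.
  apply: (itg_dominated_cvg (g := fun x => 2 * `|b x|)).
  - by move=> n; exact: mpl.
  - by apply: itgbZ; exact: itgb_norm.
  - by move=> n x xst; rewrite normrM ler_wpM2r// pl.
  move=> x /andP[sx xt].
  have xs0 : 0 < x - s by rewrite subr_gt0.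
  have tx0 : 0 < t - x by rewrite subr_gt0.
  have [N1 hN1] := ebound _ xs0; have [N2 hN2] := ebound _ tx0.
  apply: cvg_near_cst; exists (maxn N1 N2) => // n /=.
  rewrite geq_max => /andP[/hN1 n1 /hN2 n2]; have en := e0 n.
  have s1 : 2 / 3 <= (e n)^-1 * x + - (s / e n).
    have -> : (e n)^-1 * x + - (s / e n) = (x - s) / e n by field; rewrite gt_eqF.
    by rewrite ler_pdivlMr//; lra.
  have s2 : (e n)^-1 * x + (1 - t / e n) <= 3^-1.
    have -> : (e n)^-1 * x + (1 - t / e n) = (x + e n - t) / e n by field; rewrite gt_eqF.
    by rewrite ler_pdivrMr//; lra.
  by rewrite /plateau (step_r s1) (step_l s2) mulr0 addr0 mul1r.
have L2' := cvgN L2.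
have e1 : (fun n => itg 0 T (fun x => derive1 (plateau s t (e n)) x * a x)) =
   - (fun n => itg 0 T (fun x => plateau s t (e n) x * b x)).
  by apply/funext => n; rewrite weak.
rewrite e1 in L1; have h := cvg_unique (@norm_hausdorff _ _) L1 (L2' _).
by rewrite -[itg s t b]opprK -h opprB.
Qed.

End DuBoisReymond.

(** * The operator B^* and the duality formula *)

Section ControlOperator.
Context {R : realType} {k : scalar_kind} {H U : hilbertType R k}.
Variables (S : R -> H -> H) (A : operator H) (B : U -> H -> scalar_field R k).
Hypotheses (hS : strongly_continuous_group S) (hA : generator S A).
Hypothesis (hB : bounded_to_dual (adjoint A) B).
Local Notation S' := (adjoint_group S).
Local Notation A' := (adjoint A).
Local Notation Bs := (control_adjoint B).
Local Notation sS' := (adjoint_strongly_continuous hS hA).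
Local Notation gS' := (adjoint_generator hS hA).

Lemma scalar_ReZ (r : R) (z : scalar_field R k) : scalar_Re (r *: z) = r * scalar_Re z.
Proof. by case: k z => [z|[z1 z2]]. Qed.

Lemma scalar_ImZ (r : R) (z : scalar_field R k) : scalar_Im (r *: z) = r * scalar_Im z.
Proof. by case: k z => [z|[z1 z2]] //=; rewrite mulr0. Qed.

Lemma scalar_ReN (z : scalar_field R k) : scalar_Re (- z) = - scalar_Re z.
Proof. by rewrite -scaleN1r scalar_ReZ mulN1r. Qed.

Lemma Re_le_modulus (z : scalar_field R k) : `|scalar_Re z| <= modulus z.
Proof.
rewrite /modulus -(@ler_pXn2r _ 2) ?nnegrE ?sqrtr_ge0//.
by rewrite sqr_sqrtr ?addr_ge0 ?sqr_ge0// real_normK ?num_real// lerDl sqr_ge0.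
Qed.

Lemma modulusZ (r : R) (z : scalar_field R k) : modulus (r *: z) = `|r| * modulus z.
Proof.
rewrite /modulus scalar_ReZ scalar_ImZ !exprMn -mulrDr sqrtrM ?sqr_ge0//.
by rewrite sqrtr_sqr.
Qed.

Lemma graph_norm_le (phi : H) : graph_norm A' phi <= `|phi| + `|A' phi|.
Proof.
rewrite /graph_norm -(@ler_pXn2r _ 2) ?nnegrE ?sqrtr_ge0 ?addr_ge0//.
rewrite sqr_sqrtr ?addr_ge0 ?sqr_ge0// sqrrD.
have : 0 <= `|phi| * `|A' phi| by rewrite mulr_ge0.
lra.
Qed.

(** u |-> B u phi is bounded by the norm of u times the graph norm of phi, hence B^* phi
  exists by Riesz representation.  The dual norm only sees vectors of graph norm at
  most 1, to which phi is scaled. *)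
Lemma control_adjoint_spec : exists2 C : R, 0 <= C & forall phi, dom A' phi ->
  (forall u, B u phi = inner u (Bs phi)) /\ `|Bs phi| <= C * (`|phi| + `|A' phi|).
Proof.
have [Bdual Blin [C0 hC0]] := hB; pose C := `|C0|.
have hC u : (dual_norm A' (B u) <= (C * `|u|)%:E)%E.
  by apply: le_trans (hC0 u) _; rewrite lee_fin ler_wpM2r// ler_norm.
exists C; first exact: normr_ge0.
move=> phi Dphi.
have dZ (r : R) psi : dom A' psi -> dom A' (r *: psi) /\ A' (r *: psi) = r *: A' psi.
  by move=> Dpsi; have := generator_act sS' gS' (r *: 1) Dpsi; rewrite !act_real.
have BZ u (r : R) psi : dom A' psi -> B u (r *: psi) = r *: B u psi.
  move=> Dpsi; have [Bu _] := Bdual u.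
  have B0 : B u 0 = 0.
    have := Bu 1 0 0 (generator0 sS' gS') (generator0 sS' gS').
    rewrite act1 addr0; have -> : scalar_conj (1 : scalar_field R k) = 1.
      by rewrite -[X in scalar_conj X]scale1r -[RHS]scale1r; apply: scalar_eq;
        rewrite ?scalar_Re_conj// scalar_Im_conj scalar_Im_real oppr0.
    by rewrite mul1r => h; apply: (addrI (B u 0)); rewrite addr0 -h.
  have := Bu (r *: 1) psi 0 Dpsi (generator0 sS' gS').
  rewrite B0 !addr0 act_real => ->.
  have -> : scalar_conj (r *: (1 : scalar_field R k)) = r *: 1.
    by apply: scalar_eq; rewrite ?scalar_Re_conj// scalar_Im_conj scalar_Im_real oppr0.
  by rewrite -scalerAl mul1r.
have bound u : `|scalar_Re (B u phi)| <= C * `|u| * graph_norm A' phi.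
  apply: le_trans (Re_le_modulus _) _.
  pose g := graph_norm A' phi.
  have g0 : 0 <= g by exact: sqrtr_ge0.
  have g2 : g ^+ 2 = `|phi| ^+ 2 + `|A' phi| ^+ 2.
    by rewrite /g /graph_norm sqr_sqrtr// addr_ge0 ?sqr_ge0.
  have [g00|gn0] := eqVneq g 0.
    have phi0 : phi = 0.
      have : `|phi| ^+ 2 <= 0.
        by have := sqr_ge0 `|A' phi|; move: g2; rewrite g00 expr0n /=; lra.
      move=> h; apply/eqP; rewrite -normr_eq0 -sqrf_eq0 eq_le h sqr_ge0//.
    have -> : B u phi = 0 by rewrite phi0 -(scale0r phi) BZ// scale0r.
    have -> : modulus (0 : scalar_field R k) = 0.
      by rewrite -(scale0r (0 : scalar_field R k)) modulusZ normr0 mul0r.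
    by rewrite -/g g00 mulr0.
  have gp : 0 < g by rewrite lt_def gn0.
  pose psi := g^-1 *: phi; have [Dpsi Apsi] := dZ g^-1 phi Dphi.
  have gpsi : graph_norm A' psi <= 1.
    rewrite /graph_norm -(@ler_pXn2r _ 2) ?nnegrE ?sqrtr_ge0//.
    rewrite sqr_sqrtr ?addr_ge0 ?sqr_ge0// Apsi /psi !normrZ !exprMn -mulrDr -g2.
    by rewrite -exprMn normfV (ger0_norm g0) mulVf// expr1n.
  have := hC u; rewrite /dual_norm => h.
  have : ((modulus (B u psi))%:E <= (C * `|u|)%:E)%E.
    by apply: le_trans h; apply: ereal_sup_ubound; exists psi.
  rewrite lee_fin /psi BZ// modulusZ normfV (ger0_norm g0) mulrC ler_pdivrMr//.
have [|||w hw wC] := @riesz R k U (fun u => scalar_Re (B u phi)) (C * graph_norm A' phi).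
- move=> r u v; rewrite -act_real Blin// scalar_ReD; congr (_ + _).
  by rewrite scalar_ReM scalar_Re_real scalar_Im_real mul0r subr0.
- by apply: mulr_ge0; [exact: normr_ge0|rewrite /graph_norm sqrtr_ge0].
- by move=> u; rewrite mulrAC; exact: bound.
have hw' u : B u phi = inner u w.
  apply: scalar_eq; first by rewrite -hw.
  rewrite Im_inner ip_actr hw -[act _ u]addr0 Blin//.
  have -> : B 0 phi = 0.
    have := Blin 1 0 0 phi Dphi; rewrite act1 addr0 mul1r => h.
    by apply: (addrI (B 0 phi)); rewrite addr0 -h.
  rewrite addr0 scalar_ReM scalar_Re_conj scalar_Re_i mul0r sub0r scalar_Im_conj.
  by rewrite mulNr opprK scalar_Im_i.
have Bsw : Bs phi = w.
  rewrite /Bs /control_adjoint; set P := [set w | _].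
  have Pw : P (xget 0 P) by exact: (@xgetI _ 0 P w).
  apply: ip_inj => u; rewrite hw; rewrite /ip -(Pw u)//.
split; first by move=> u; rewrite Bsw.
rewrite Bsw; apply: le_trans wC _; apply: ler_wpM2l; [exact: normr_ge0|exact: graph_norm_le].
Qed.

Lemma control_adjoint_inner u phi : dom A' phi -> B u phi = inner u (Bs phi).
Proof. by move=> Dphi; have [C _ h] := control_adjoint_spec; have [] := h phi Dphi. Qed.

Lemma control_adjoint_linear a phi psi : dom A' phi -> dom A' psi ->
  Bs (act a phi + psi) = act a (Bs phi) + Bs psi.
Proof.
move=> Dphi Dpsi; apply: ip_inj => u.
have [Dl _] := generator_linear sS' gS' a Dphi Dpsi.
have [Bdual _ _] := hB; have [Bu _] := Bdual u.
rewrite {1}/ip -control_adjoint_inner// Bu// !control_adjoint_inner// scalar_ReD ipDr.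
congr (_ + _); rewrite ip_actr /ip inner_actl.
by rewrite -(control_adjoint_inner u).
Qed.

Lemma control_adjointB phi psi : dom A' phi -> dom A' psi ->
  Bs (phi - psi) = Bs phi - Bs psi.
Proof.
move=> Dphi Dpsi; have := control_adjoint_linear ((-1) *: 1) Dpsi Dphi.
by rewrite !act_real !scaleN1r ![- _ + _]addrC.
Qed.

Lemma control_adjoint0 : Bs 0 = 0.
Proof.
have D0 := generator0 sS' gS'.
by have := control_adjointB D0 D0; rewrite !subrr.
Qed.

Lemma control_adjointZ (r : R) phi : dom A' phi -> Bs (r *: phi) = r *: Bs phi.
Proof.
move=> Dphi; have := control_adjoint_linear (r *: 1) Dphi (generator0 sS' gS').
by rewrite !act_real control_adjoint0 !addr0.
Qed.

Lemma control_adjoint_continuous (g : R -> H) : (forall t, dom A' (g t)) ->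
  continuous g -> continuous (A' \o g) -> continuous (Bs \o g).
Proof.
move=> Dg cg cAg t; have [C C0 hC] := control_adjoint_spec.
have rD := subspace_real (generator_subspace sS' gS').
apply/cvgrPdist_lt => e e0.
have eC : 0 < e / (2 * (C + 1)) by rewrite divr_gt0// mulr_gt0// ltr_wpDl.
have h1 : \forall s \near t, `|g t - g s| < e / (2 * (C + 1)).
  by move/cvgrPdist_lt : (cg t); apply.
have h2 : \forall s \near t, `|A' (g t) - A' (g s)| < e / (2 * (C + 1)).
  by move/cvgrPdist_lt : (cAg t); apply.
apply: filterS2 h1 h2 => s h1 h2.
have AB : A' (g t - g s) = A' (g t) - A' (g s).
  have [_] := generator_linear sS' gS' ((-1) *: 1) (Dg s) (Dg t).
  by rewrite !act_real !scaleN1r ![- _ + _]addrC.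
rewrite /= -control_adjointB//; have [_ hh] := hC (g t - g s) (real_subspaceB rD (Dg t) (Dg s)).
apply: le_lt_trans hh _; rewrite AB.
apply: (@le_lt_trans _ _ ((C + 1) * (`|g t - g s| + `|A' (g t) - A' (g s)|))).
  by apply: ler_wpM2r; rewrite ?addr_ge0// lerDl.
have -> : e = (C + 1) * (e / (2 * (C + 1)) + e / (2 * (C + 1))).
  by field; rewrite gt_eqF// ltr_wpDl.
by rewrite ltr_pM2l; [exact: ltrD|by rewrite ltr_wpDl].
Qed.

Lemma control_adjoint_group_continuous (s : R -> R) phi : continuous s -> dom A' phi ->
  continuous (fun t => Bs (S' (s t) phi)).
Proof.
move=> cs Dphi; apply: (@control_adjoint_continuous (fun t => S' (s t) phi)).
- by move=> t; have [] := generator_group sS' gS' (s t) Dphi.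
- by apply: (group_continuous sS') => // t; exact: cvg_cst.
have -> : A' \o (fun t => S' (s t) phi) = (fun t => S' (s t) (A' phi)).
  by apply/funext => t; exact: (generator_group sS' gS' (s t) Dphi).2.
by apply: (group_continuous sS') => // t; exact: cvg_cst.
Qed.

Lemma weak_solution_increment (T : R) u y0 y phi s t : weak_solution A B T u y0 y ->
  dom A' phi -> 0 <= s -> s <= t -> t <= T ->
  ip (y t) phi - ip (y s) phi = itg s t (fun r => ip (y r) (A' phi) + ip (u r) (Bs phi)).
Proof.
move=> [/Lp_class2P Lu cy y00 weak] Dphi s0 st tT.
have T0 : 0 <= T by lra.
pose Y := y \o clamp 0 T; have cY : continuous Y by exact: clamp_continuous.
have YE r : 0 <= r <= T -> Y r = y r by move=> rT; rewrite /Y /= clamp_id.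
have iu : itgb 0 T (fun r => ip (u r) (Bs phi)).
  by apply: L2_ip => //; apply: L2_continuous => r; exact: cvg_cst.
have iy : itgb 0 T (fun r => ip (Y r) (A' phi)).
  by apply: itgb_continuous; apply: continuous_ip => // r; exact: cvg_cst.
have h := @du_bois_reymond R T (fun r => ip (Y r) phi)
  (fun r => ip (Y r) (A' phi) + ip (u r) (Bs phi)) _ _ _ s t s0 st tT.
rewrite -!YE; [|lra|lra]; rewrite h.
- by apply: eq_itg => r /andP[r1 r2]; rewrite YE//; lra.
- by apply: continuous_ip => // r; exact: cvg_cst.
- exact: itgbD.
move=> psi tpsi; have := weak phi psi Dphi tpsi.
move=> /(congr1 (@scalar_Re R k)); rewrite scalar_ReN !scalar_ofK => e.
have -> : itg 0 T (fun x => derive1 psi x * ip (Y x) phi) =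
    \int[lebesgue_measure]_(t in `]0, T[) scalar_Re (derive1 psi t *: inner (y t) phi).
  by apply: eq_itg => r /andP[r1 r2]; rewrite scalar_ReZ YE//; lra.
rewrite e; congr (- _); apply: eq_itg => r /andP[r1 r2].
by rewrite scalar_ReZ scalar_ReD YE//; lra.
Qed.

(** Formally, t |-> <y t, S' (tau - t) phi> has the derivative
  <u t, B^* (S' (tau - t) phi)>.  As y need not be differentiable, the increments over a
  short interval [s, t] are estimated instead: the test vector is frozen at time t,
  where [weak_solution_increment] applies, and the errors are controlled by uniform
  continuity. *)
Lemma weak_solution_duality (T : R) u y0 y phi tau : weak_solution A B T u y0 y ->
  dom A' phi -> 0 <= tau <= T ->
  ip (y tau) phi = ip y0 (S' tau phi) + itg 0 tau (fun s => ip (u s) (Bs (S' (tau - s) phi))).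
Proof.
move=> ws Dphi /andP[tau0 tauT]; have [/Lp_class2P Lu cy y00 _] := ws.
have T0 : 0 <= T by lra.
pose Y := y \o clamp 0 T; have cY : continuous Y by exact: clamp_continuous.
have YE r : 0 <= r <= T -> Y r = y r by move=> rT; rewrite /Y /= clamp_id.
pose p t := S' (tau - t) phi; pose q t := S' (tau - t) (A' phi).
have csub : continuous (fun t : R => tau - t).
  by move=> t; apply: cvgB; [exact: cvg_cst|exact: cvg_id].
have cp : continuous p by apply: (group_continuous sS') => // t; exact: cvg_cst.
have cq : continuous q by apply: (group_continuous sS') => // t; exact: cvg_cst.
have Dp t : dom A' (p t) by have [] := generator_group sS' gS' (tau - t) Dphi.
have Ap t : A' (p t) = q t by have [] := generator_group sS' gS' (tau - t) Dphi.
have cBp : continuous (fun t => Bs (p t)) by exact: control_adjoint_group_continuous.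
have dp t : is_derive t (1 : R) p (- q t).
  have h := generator_group_derive sS' gS' (tau - t) Dphi.
  apply/is_derive_littleoP => e e0; move/is_derive_littleoP : h => /(_ e e0)[d d0 hd].
  exists d => // h hd'; have := hd (- h); rewrite normrN => /(_ hd').
  by rewrite /p /q scaleNr scalerN opprK opprD addrA.
have pinc s t : s <= t -> p t - p s = - wint s t q.
  move=> st; apply: ip_inj => x; rewrite ipBr ipNr wint_ip//.
  rewrite -itgN; last by apply: itgb_continuous; exact: continuous_ipr.
  apply/esym; apply: (@itg_FTC2 _ (fun t => ip x (p t))) => //.
  - by apply: continuous_subspaceT; exact: continuous_ipr.
  - apply: continuous_subspaceT => r; apply: cvgN; exact: continuous_ipr.
  - by move=> r _; rewrite -ipNr; apply: is_derive_ipr.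
have Lu' a b : 0 <= a -> b <= T -> L2 a b u.
  move=> a0 bT; case: Lu => su iu; split; last exact: itgb_subitv iu.
  by apply: sm_sub su; exact: subset_itvW.
have iup a b : 0 <= a -> b <= T -> itgb a b (fun s => ip (u s) (Bs (p s))).
  by move=> a0 bT; apply: L2_ip; [exact: Lu'|exact: L2_continuous].
have iun a b : 0 <= a -> b <= T -> itgb a b (fun s => `|u s|).
  by move=> a0 bT; apply: L2_L1; exact: Lu'.
pose F t := ip (Y t) (p t) - itg 0 t (fun s => ip (u s) (Bs (p s))).
pose G t := t + itg 0 t (fun s => `|u s|).
have [CY CY0 hCY] := continuous_bounded_itv 0 tau cY.
have [Cq Cq0 hCq] := continuous_bounded_itv 0 tau cq.
have FF : F tau = F 0.
  apply: (@small_increments _ F G) => // e e0.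
  have e1 : 0 < e / (2 * Cq) by rewrite divr_gt0// mulr_gt0.
  have e2 : 0 < e / (2 * CY) by rewrite divr_gt0// mulr_gt0.
  have [d1 d10 hd1] := unif_continuous_itv 0 tau cY e1.
  have [d2 d20 hd2] := unif_continuous_itv 0 tau cq e2.
  have [d3 d30 hd3] := unif_continuous_itv 0 tau cBp e0.
  pose d := Num.min d1 (Num.min d2 d3) / 2.
  have m0 : 0 < Num.min d1 (Num.min d2 d3) by rewrite !lt_min d10 d20.
  exists d => [|s t s0 st ttau tsd]; first by rewrite divr_gt0.
  have ts : t - s < Num.min d1 (Num.min d2 d3).
    by apply: le_lt_trans tsd _; rewrite ltr_pdivrMr// ltr_pMr// ltr1n.
  move: ts; rewrite !lt_min => /and3P[t1 t2 t3].
  have tT : t <= T by exact: le_trans ttau tauT.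
  have t0 : 0 <= t by exact: le_trans s0 st.
  have sT : s <= T by exact: le_trans st tT.
  have iuB v : itgb s t (fun r => ip (u r) v).
    by apply: L2_ip; [exact: Lu'|apply: L2_continuous => r; exact: cvg_cst].
  have iY v : itgb s t (fun r => ip (Y r) v).
    by apply: itgb_continuous; apply: continuous_ip => // r; exact: cvg_cst.
  have iYq v : itgb s t (fun r => ip v (q r)).
    by apply: itgb_continuous; exact: continuous_ipr.
  have i0s : itgb 0 s (fun r => ip (u r) (Bs (p r))) by exact: iup.
  have i0t : itgb 0 t (fun r => ip (u r) (Bs (p r))) by exact: iup.
  have ist : itgb s t (fun r => ip (u r) (Bs (p r))) by exact: iup.
  have iun' : itgb s t (fun r => `|u r|) by exact: iun.
  have e1' : ip (Y t) (p t) - ip (Y s) (p t) =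
      itg s t (fun r => ip (Y r) (q t)) + itg s t (fun r => ip (u r) (Bs (p t))).
    rewrite -itgD// !YE; [|by rewrite s0|by rewrite t0].
    rewrite (weak_solution_increment ws (Dp t))//; apply: eq_itg => r /andP[r1 r2].
    by rewrite YE ?Ap//; clear -hB hS hA s0 tT r1 r2; lra.
  have e2' : ip (Y s) (p t) - ip (Y s) (p s) = - itg s t (fun r => ip (Y s) (q r)).
    by rewrite -ipBr pinc// ipNr wint_ip.
  have e3 : F t - F s = itg s t (fun r => (ip (Y r) (q t) - ip (Y s) (q r)) +
      (ip (u r) (Bs (p t)) - ip (u r) (Bs (p r)))).
    rewrite itgD; [|exact: itgbB|exact: itgbB].
    rewrite !itgB// /F (itg_chasles s0 st i0t).
    by clear -hB hS hA e1' e2'; lra.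
  have G3 : e * (G t - G s) = itg s t (fun r => e * (1 + `|u r|)).
    have h1 : itg s t (fun r => 1 + `|u r|) = 1 * (t - s) + itg s t (fun r => `|u r|).
      by rewrite -itg_cst// -itgD//; exact: itgb_cst.
    have -> : itg s t (fun r => e * (1 + `|u r|)) = e * itg s t (fun r => 1 + `|u r|).
      by apply: itgZ; apply: itgbD => //; exact: itgb_cst.
    rewrite h1.
    have iu0 : itgb 0 t (fun r => `|u r|) by exact: iun.
    by rewrite mul1r /G (itg_chasles s0 st iu0); congr (_ * _); clear -hB hS hA; lra.
  rewrite e3 G3; apply: le_trans (norm_itg _) _.
    by apply: itgbD; exact: itgbB.
  apply: le_itg.
  - by apply: itgb_norm; apply: itgbD; exact: itgbB.
  - by apply: itgbZ; apply: itgbD => //; exact: itgb_cst.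
  move=> r /andP[sr rt].
  have -> : ip (Y r) (q t) - ip (Y s) (q r) = ip (Y r - Y s) (q t) + ip (Y s) (q t - q r).
    by rewrite ipBl ipBr; clear -hB hS hA; lra.
  rewrite -ipBr mulrDr mulr1.
  apply: le_trans (ler_normD _ _) _; apply: lerD.
    apply: le_trans (ler_normD _ _) _.
    have -> : e = e / (2 * Cq) * Cq + CY * (e / (2 * CY)).
      by field; rewrite !gt_eqF.
    apply: lerD.
      apply: le_trans (ip_CS _ _) _; apply: ler_pM => //; last by apply: hCq; rewrite t0.
      rewrite distrC; apply: ltW; apply: hd1; first by clear -hB hS hA s0 st ttau; lra.
      by clear -hB hS hA sr rt t1; rewrite distrC ger0_norm; lra.
    apply: le_trans (ip_CS _ _) _; apply: ler_pM => //; first by apply: hCY; clear -hB hS hA s0 st ttau; lra.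
    apply: ltW; apply: hd2; first by rewrite t0.
    by clear -hB hS hA sr rt t2; rewrite ger0_norm; lra.
  apply: le_trans (ip_CS _ _) _; rewrite mulrC; apply: ler_wpM2r => //.
  apply: ltW; apply: hd3; first by rewrite t0.
  by clear -hB hS hA sr rt t3; rewrite ger0_norm; lra.
have YT : Y tau = y tau by rewrite YE//; lra.
have Y0 : Y 0 = y0 by rewrite YE//; lra.
move: FF; rewrite /F itg_refl subr0 YT Y0 /p subrr !subr0 (group0 sS').
by move=> <-; rewrite subrK.
Qed.

Lemma weak_solution_unique (T : R) u y0 y y' : weak_solution A B T u y0 y ->
  weak_solution A B T u y0 y' -> forall t, 0 <= t <= T -> y t = y' t.
Proof.
move=> w w' t tT; apply: (norm_dense_ip_inj (adjoint_dense hS hA)) => phi Dphi.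
by rewrite ipC [RHS]ipC (weak_solution_duality w)// (weak_solution_duality w').
Qed.

End ControlOperator.

(** * Admissibility and observability *)

Section UniformBoundedness.
Context {R : realType} {k : scalar_kind} {X : hilbertType R k}.

(** Banach-Steinhaus for the functionals <., x>. *)
Lemma weakly_bounded (P : set X) : (forall y, exists M : R, forall x, P x -> `|ip y x| <= M) ->
  exists2 C : R, 0 < C & forall x, P x -> `|x| <= C.
Proof.
move=> hP.
have [|x|M hM] := @Banach_Steinhauss R X R^o
    [set f | exists2 x, P x & f = (fun y => ip y x)] _ _ 1.
- move=> _ [x Px ->]; split; last by move=> r u v; rewrite ipDl ipZl.
  move=> r; exists (r * `|x|) => y yr; apply: le_trans (ip_CS _ _) _.
  exact: ler_wpM2r.
- by have [M hM] := hP x; exists M => _ [y Py ->]; exact: hM.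
exists (Num.max 1 M) => [|x Px]; first by rewrite lt_max ltr01.
have [->|x0] := eqVneq x 0; first by rewrite normr0 le_max ler01.
have nx : 0 < `|x| by rewrite normr_gt0.
have := hM (fun y => ip y x) (ex_intro2 _ _ x Px erefl) (`|x|^-1 *: x).
rewrite normrZ normfV normr_id mulVf ?gt_eqF// => /(_ (lexx _)).
rewrite ipZl ip_norm expr2 mulKf ?gt_eqF// normr_id => h.
by rewrite le_max h orbT.
Qed.

(** A gliding hump.  If some f n in P have norms nrm n >= (n + 1) 10^n, let x be the sum of
  the terms +- 10^-n f n / nrm n, with signs such that the partial sum x n satisfies
  |<x n, f n>| >= 10^-n nrm n.  The terms after n change this by at most one ninth, so
  that |<x, f n>| >= (8/9) (n + 1). *)
Lemma L2_uniform_boundedness (a b : R) (P : set (R -> X)) :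
  (forall f, P f -> L2 a b f) ->
  (forall u, L2 a b u -> exists M : R, forall f, P f ->
     `|itg a b (fun t => ip (u t) (f t))| <= M) ->
  exists2 C : R, 0 <= C & forall f, P f -> sqn a b f <= C.
Proof.
move=> PL hP; apply: contrapT => nb.
have ex n : exists f : R -> X, P f /\ (n.+1%:R * 10 ^+ n) ^+ 2 < sqn a b f.
  apply: contrapT => nf; apply: nb; exists ((n.+1%:R * 10 ^+ n) ^+ 2); first exact: sqr_ge0.
  move=> f Pf; rewrite leNgt; apply/negP => h; apply: nf; by exists f.
pose f n := projT1 (cid (ex n)).
have fP n : P (f n) by have [] := projT2 (cid (ex n)).
have fl n : (n.+1%:R * 10 ^+ n) ^+ 2 < sqn a b (f n) by have [] := projT2 (cid (ex n)).
pose nrm n := Num.sqrt (sqn a b (f n)).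
have nrm2 n : nrm n ^+ 2 = sqn a b (f n) by rewrite /nrm sqr_sqrtr// sqn_ge0.
have nl n : n.+1%:R * 10 ^+ n < nrm n.
  rewrite -(@ltr_pXn2r _ 2)// ?nnegrE ?sqrtr_ge0// ?nrm2//; by rewrite mulr_ge0// exprn_ge0.
have n0 n : 0 < nrm n.
  by apply: le_lt_trans (nl n); rewrite mulr_ge0// exprn_ge0.
have q0 n : 0 < (10^-1 : R) ^+ n by rewrite exprn_gt0// invr_gt0.
have qq n : ((10^-1 : R) ^+ n) ^+ 2 = 100^-1 ^+ n.
  by rewrite exprAC; congr (_ ^+ _); field.
pose e n := fun t => (10^-1 ^+ n / nrm n) *: f n t.
have Le n : L2 a b (e n) by apply: L2Z; exact: PL.
have se n : sqn a b (e n) = 100^-1 ^+ n.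
  rewrite sqnZ; last exact: PL.
  have nz : nrm n != 0 by rewrite gt_eqF.
  by rewrite exprMn qq [(nrm n)^-1 ^+ 2]exprVn -nrm2 -mulrA mulVf ?mulr1// expf_neq0.
pose pr (x : R -> X) n := itg a b (fun t => ip (x t) (f n t)).
pose fix x n : R -> X := match n with
  | 0 => e 0
  | m.+1 => fun t => x m t +
      (-1) ^+ (`|pr (x m) m.+1 + pr (e m.+1) m.+1| < 10^-1 ^+ m.+1 * nrm m.+1)%R *: e m.+1 t end.
have Lx n : L2 a b (x n).
  by elim: n => [|n ih] /=; [exact: Le|apply: L2D => //; exact: L2Z].
have pre n : pr (e n) n = 10^-1 ^+ n * nrm n.
  rewrite /pr /e; under eq_fun do rewrite ipZl ip_norm.
  rewrite itgZ; last by have [] := PL _ (fP n).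
  rewrite -/(sqn a b (f n)) -nrm2; field; exact: lt0r_neq0.
have dx n : sqn a b (fun t => x n.+1 t - x n t) <= 100^-1 * 100^-1 ^+ n.
  rewrite -exprS -se /=; set s := (-1) ^+ _.
  have -> : (fun t => x n t + s *: e n.+1 t - x n t) = (fun t => s *: e n.+1 t).
    by apply/funext => t; rewrite addrC addKr.
  by rewrite sqnZ// sqrr_sign mul1r.
have prx n : 10^-1 ^+ n * nrm n <= `|pr (x n) n|.
  case: n => [|n] /=; first by rewrite pre ger0_norm// mulr_ge0// ?ltW.
  set c := _ < _; set s := (-1) ^+ _.
  have -> : pr (fun t => x n t + s *: e n.+1 t) n.+1 = pr (x n) n.+1 + s * pr (e n.+1) n.+1.
    rewrite /pr; under eq_fun do rewrite ipDl ipZl.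
    rewrite itgD ?itgZ//; try apply: itgbZ; try (by apply: L2_ip => //; exact: PL).
  rewrite /s /c; case: ltP => [h|h]; last by rewrite expr0 mul1r.
  rewrite expr1 mulN1r; move: h; rewrite pre; set p := pr _ _; set r := _ * _.
  have r0 : 0 < r by rewrite mulr_gt0.
  rewrite ltr_norml => /andP[h1 h2].
  by rewrite ler0_norm; lra.
have [|w [Lw hw]] := @riesz_fischer R k X a b x 100^-1 _ Lx dx; first by rewrite invr_ge0.
have [M hM] := hP w Lw.
have big n : n.+1%:R * (8 / 9) <= M.
  have Lwx : L2 a b (fun t => w t - x n t) by exact: L2B.
  have e1 : pr w n = pr (x n) n + pr (fun t => w t - x n t) n.
    rewrite /pr -itgD; try (by apply: L2_ip => //; exact: PL).
    by apply: eq_itg => t _; rewrite -ipDl addrC subrK.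
  have e2 : `|pr (fun t => w t - x n t) n| <= 10^-1 ^+ n * nrm n / 9.
    rewrite -(@ler_pXn2r _ 2)// ?nnegrE ?divr_ge0 ?mulr_ge0 ?(ltW (q0 n)) ?(ltW (n0 n))//.
    rewrite real_normK ?num_real//.
    apply: le_trans (L2_CS Lwx (PL _ (fP n))) _.
    apply: le_trans (ler_wpM2r (sqn_ge0 _ _ _) (hw n)) _.
    rewrite -nrm2 !exprMn qq.
    by rewrite le_eqVlt; apply/orP; left; apply/eqP; field.
  have e3 := prx n.
  have e4 : 10^-1 ^+ n * nrm n * (8 / 9) <= `|pr w n|.
    rewrite e1; have := lerB_normD (pr (x n) n) (pr (fun t => w t - x n t) n).
    by move: e2 e3; set p := 10^-1 ^+ n * nrm n; lra.
  apply: le_trans (le_trans e4 (hM _ (fP n))).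
  apply: ler_wpM2r; first by rewrite divr_ge0.
  have := ltW (nl n) => /(ler_wpM2l (ltW (q0 n))); apply: le_trans.
  by rewrite mulrCA -exprMn mulVf// expr1n mulr1.
have M0 : 0 <= M by apply: le_trans (big 0%N); rewrite mulr_ge0// divr_ge0.
have M1 : 0 < M + 1 by rewrite ltr_wpDl.
have c0 : 0 < (8 / 9) / (M + 1) by rewrite divr_gt0// divr_gt0.
have [n hn] := harmonic_lt c0.
have := hn n (leqnn n); rewrite ltr_pdivlMr// mulrC ltr_pdivrMr// => h.
by have := big n; rewrite mulrC; lra.
Qed.

End UniformBoundedness.

Section Traces.
Context {R : realType} {k : scalar_kind} {H U : hilbertType R k}.
Variables (S : R -> H -> H) (A : operator H) (B : U -> H -> scalar_field R k).
Hypotheses (hS : strongly_continuous_group S) (hA : generator S A).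
Hypothesis (hB : bounded_to_dual (adjoint A) B).
Local Notation S' := (adjoint_group S).
Local Notation A' := (adjoint A).
Local Notation Bs := (control_adjoint B).
Local Notation sS' := (adjoint_strongly_continuous hS hA).
Local Notation gS' := (adjoint_generator hS hA).

Let csub (T : R) : continuous (fun t : R => T - t).
Proof. by move=> t; apply: cvgB; [exact: cvg_cst|exact: cvg_id]. Qed.

Let Bs0 : Bs 0 = 0.
Proof. exact: (control_adjoint0 hS hA hB). Qed.

Let BsZ (r : R) phi : dom A' phi -> Bs (r *: phi) = r *: Bs phi.
Proof. exact: (control_adjointZ hS hA hB). Qed.

Lemma trace_back_L2 (T : R) a b phi : dom A' phi -> L2 a b (fun t => Bs (S' (T - t) phi)).
Proof. by move=> D; apply: L2_continuous; exact: control_adjoint_group_continuous. Qed.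

(** Admissibility at the final time, tested with phi. *)
Lemma admissible_functional (T : R) u : admissible S A B -> 0 < T -> L2 0 T u ->
  exists y, forall phi, dom A' phi ->
    ip y phi = itg 0 T (fun s => ip (u s) (Bs (S' (T - s) phi))).
Proof.
move=> hadm T0 /Lp_class2P Lu; have [y _ hy] := hadm T u T0 Lu; exists (y T) => phi Dphi.
have TT : 0 <= T <= T by rewrite lexx ltW.
have := hy T TT.
pose r := (1 + (`|phi| + `|A' phi|))^-1.
have r0 : 0 < r by rewrite invr_gt0 ltr_wpDr// addr_ge0.
have [Drphi Arphi] : dom A' (r *: phi) /\ A' (r *: phi) = r *: A' phi.
  by have := generator_act sS' gS' (r *: 1) Dphi; rewrite !act_real.
have gr : graph_norm A' (r *: phi) <= 1.
  apply: le_trans (graph_norm_le A (r *: phi)) _; rewrite Arphi !normrZ -mulrDr gtr0_norm//.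
  by rewrite mulrC ler_pdivrMr ?mul1r ?lerDr// ltr_wpDr// addr_ge0.
move=> /(@bochner_functional _ _ _ _ _ _ _ _ (fun f => scalar_Re (f (r *: phi)))) [].
- by move=> c f g; rewrite /= scalar_ReD scalar_ReZ.
- move=> f; apply: (@le_trans _ _ (modulus (f (r *: phi)))%:E).
    by rewrite lee_fin Re_le_modulus.
  by apply: ereal_sup_ubound; exists (r *: phi).
move=> _; rewrite -/(ip _ _) ipZr => e.
apply: (mulfI (lt0r_neq0 r0)); rewrite e -itgZ; last first.
  by apply: L2_ip; [exact/Lp_class2P|exact: trace_back_L2].
apply: eq_itg => s _; rewrite /extended_group.
have [Ds _] := generator_group sS' gS' (T - s) Drphi.
rewrite (control_adjoint_inner hS hA hB)// -/(ip _ _) -ipZr; congr (ip _ _).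
have [Ds' _] := generator_group sS' gS' (T - s) Dphi.
rewrite klinearZ; last exact: (group_klinear sS').
have := control_adjoint_linear hS hA hB (r *: 1) Ds' (generator0 sS' gS').
rewrite !act_real !addr0 => ->.
by rewrite Bs0// addr0.
Qed.

(** Pointwise, hence uniformly, the observations of unit vectors are bounded in L^2. *)
Lemma admissible_trace_back (T : R) : admissible S A B -> 0 < T ->
  exists2 C : R, 0 <= C & forall phi, dom A' phi ->
    sqn 0 T (fun t => Bs (S' (T - t) phi)) <= C * `|phi| ^+ 2.
Proof.
move=> hadm T0.
have [||C C0 hC] := @L2_uniform_boundedness R k U 0 T
   [set f | exists phi, [/\ dom A' phi, `|phi| <= 1 & f = (fun t => Bs (S' (T - t) phi))]].
- by move=> _ [phi [Dphi _ ->]]; exact: trace_back_L2.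
- move=> u Lu; have [y hy] := admissible_functional hadm T0 Lu.
  exists `|y| => _ [phi [Dphi phi1 ->]]; rewrite -hy//.
  by apply: le_trans (ip_CS _ _) _; rewrite ler_piMr.
exists C => // phi Dphi.
have [->|phi0] := eqVneq phi 0.
  rewrite normr0 expr0n mulr0 /= le_eqVlt; apply/orP; left; apply/eqP.
  rewrite /sqn -[RHS](mul0r (T - 0)) -itg_cst ?ltW//; apply: eq_itg => t _.
  by rewrite (klinear0 (group_klinear sS' _)) Bs0 normr0 expr0n.
have n0 : 0 < `|phi| by rewrite normr_gt0.
have [Dp _] : dom A' (`|phi|^-1 *: phi) /\ A' (`|phi|^-1 *: phi) = `|phi|^-1 *: A' phi.
  by have := generator_act sS' gS' (`|phi|^-1 *: 1) Dphi; rewrite !act_real.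
have p1 : `| `|phi|^-1 *: phi| <= 1 by rewrite normrZ normfV normr_id mulVf ?gt_eqF.
have := hC _ (ex_intro _ (`|phi|^-1 *: phi) (And3 Dp p1 erefl)).
have -> : (fun t => Bs (S' (T - t) (`|phi|^-1 *: phi))) =
    (fun t => `|phi|^-1 *: Bs (S' (T - t) phi)).
  apply/funext => t; rewrite klinearZ; last exact: (group_klinear sS').
  by rewrite BsZ//; have [] := generator_group sS' gS' (T - t) Dphi.
rewrite sqnZ; last exact: trace_back_L2.
by rewrite exprVn mulrC ler_pdivrMr// exprn_gt0.
Qed.

Lemma trace_shift (T t : R) phi : S' (T - t) (S' (- T) phi) = S' (- t) phi.
Proof. by rewrite -(groupD sS') addrAC subrr sub0r. Qed.

Lemma trace_L2 a b phi : dom A' phi -> L2 a b (fun t => Bs (S' (- t) phi)).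
Proof.
move=> D; have := @trace_back_L2 0 a b phi D.
by apply: eq_L2 => t _; rewrite sub0r.
Qed.

Lemma admissible_trace (T : R) : admissible S A B -> 0 < T ->
  exists2 C : R, 0 <= C & forall phi, dom A' phi ->
    sqn 0 T (fun t => Bs (S' (- t) phi)) <= C * `|phi| ^+ 2.
Proof.
move=> hadm T0; have [C C0 hC] := admissible_trace_back hadm T0.
have [M M1 hM] := group_local_bound sS' T.
exists (C * M ^+ 2) => [|phi Dphi]; first by rewrite mulr_ge0// sqr_ge0.
have [DT _] := generator_group sS' gS' (- T) Dphi.
have := hC _ DT; under eq_fun do rewrite trace_shift.
move=> /le_trans; apply; rewrite -mulrA -exprMn; apply: ler_wpM2l => //.
have M0 : 0 <= M by apply: le_trans M1.
rewrite ler_pXn2r ?nnegrE ?mulr_ge0//; apply: hM.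
by rewrite normrN ger0_norm// ltW.
Qed.

(** If y is reached from 0 with the control u, the duality formula bounds <y, phi> by the
  norm of u times that of the observation of phi.  Hence the vectors phi whose
  observation has norm at most 1 are weakly bounded, and thus bounded. *)
Lemma observability (T : R) : 0 < T -> exactly_controllable A B T ->
  exists2 C : R, 0 < C & forall phi, dom A' phi ->
    `|phi| ^+ 2 <= C * sqn 0 T (fun t => Bs (S' (- t) phi)).
Proof.
move=> T0 hctrl; have TT : 0 <= T <= T by rewrite lexx ltW.
have [y|K K0 hK] := @weakly_bounded R k H
   [set phi | dom A' phi /\ sqn 0 T (fun t => Bs (S' (T - t) phi)) <= 1].
  have [u [z [ws zT]]] := hctrl 0 y; have [/Lp_class2P Lu _ _ _] := ws.
  exists (1 + sqn 0 T u) => phi [Dphi g1].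
  rewrite -zT (weak_solution_duality hS hA hB ws Dphi TT) ip0l add0r.
  rewrite -(@ler_pXn2r _ 2)// ?nnegrE ?addr_ge0 ?sqn_ge0//.
  rewrite real_normK ?num_real//.
  apply: le_trans (L2_CS Lu (trace_back_L2 _ _ _ Dphi)) _.
  have s0 := sqn_ge0 0 T u; apply: (@le_trans _ _ (sqn 0 T u)).
    by rewrite ler_piMr.
  by rewrite sqrrD expr1n mul1r; have := sqr_ge0 (sqn 0 T u); lra.
have hK' phi : dom A' phi -> `|phi| ^+ 2 <= K ^+ 2 * sqn 0 T (fun t => Bs (S' (T - t) phi)).
  move=> Dphi; set s := sqn _ _ _.
  have s0 : 0 <= s by exact: sqn_ge0.
  (* The observation may vanish a priori, so phi is divided by slightly more than its norm. *)
  apply/ler_addgt0Pr => e e0.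
  pose r := Num.sqrt (s + e / K ^+ 2).
  have se : 0 < s + e / K ^+ 2 by rewrite ltr_wpDl// divr_gt0// exprn_gt0.
  have r0 : 0 < r by rewrite sqrtr_gt0.
  have r2 : r ^+ 2 = s + e / K ^+ 2 by rewrite sqr_sqrtr// ltW.
  have [Dp _] : dom A' (r^-1 *: phi) /\ A' (r^-1 *: phi) = r^-1 *: A' phi.
    by have := generator_act sS' gS' (r^-1 *: 1) Dphi; rewrite !act_real.
  have h : `|r^-1 *: phi| <= K.
    apply: hK; split => //.
    have -> : (fun t => Bs (S' (T - t) (r^-1 *: phi))) =
        (fun t => r^-1 *: Bs (S' (T - t) phi)).
      apply/funext => t; rewrite klinearZ; last exact: (group_klinear sS').
      by rewrite BsZ//; have [] := generator_group sS' gS' (T - t) Dphi.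
    rewrite sqnZ; last exact: trace_back_L2.
    rewrite exprVn mulrC ler_pdivrMr ?exprn_gt0// mul1r r2 -/s lerDl.
    by rewrite divr_ge0// ?ltW// exprn_gt0.
  move: h; rewrite normrZ normfV gtr0_norm// mulrC ler_pdivrMr// => h.
  apply: (@le_trans _ _ ((K * r) ^+ 2)).
    by rewrite ler_pXn2r ?nnegrE ?mulr_ge0// ?ltW.
  rewrite exprMn r2 mulrDr mulrCA divff ?mulr1// expf_neq0// gt_eqF//.
have [M M1 hM] := group_local_bound sS' T.
have M0 : 0 < M by apply: lt_le_trans M1.
exists (M ^+ 2 * K ^+ 2) => [|phi Dphi]; first by rewrite mulr_gt0// exprn_gt0.
have [DT _] := generator_group sS' gS' (- T) Dphi.
have := hK' _ DT; under eq_fun do rewrite trace_shift.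
move=> h; rewrite -mulrA; apply: (@le_trans _ _ (M ^+ 2 * `|S' (- T) phi| ^+ 2)); last first.
  by apply: ler_wpM2l => //; exact: sqr_ge0.
rewrite -exprMn ler_pXn2r ?nnegrE ?mulr_ge0 ?(ltW M0)//.
have := hM T (S' (- T) phi); rewrite (groupKV sS'); apply.
by rewrite ger0_norm// ltW.
Qed.

End Traces.

(** * The weighted Gramian *)

Section RightDerivative.
Context {R : realType}.

(** The translation formula for the Gramian is only available for s >= 0. *)
Lemma is_derive_right_unique (F G : R -> R) (l m : R) : is_derive (0 : R) (1 : R) F l ->
  is_derive (0 : R) (1 : R) G m -> (forall s, 0 <= s <= 1 -> F s = G s) -> l = m.
Proof.
move=> /is_derive_littleoP dF /is_derive_littleoP dG FG.
apply/eqP; rewrite -subr_eq0 -normr_le0; apply/ler_addgt0Pr => e e0; rewrite add0r.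
have e2 : 0 < e / 2 by rewrite divr_gt0.
have [d1 d10 h1] := dF _ e2; have [d2 d20 h2] := dG _ e2.
pose h := Num.min 1 (Num.min d1 d2) / 2.
have m0 : 0 < Num.min 1 (Num.min d1 d2) by rewrite !lt_min ltr01 d10 d20.
have h0 : 0 < h by rewrite divr_gt0.
have : h < Num.min 1 (Num.min d1 d2) by rewrite ltr_pdivrMr// ltr_pMr// ltr1n.
rewrite !lt_min => /and3P[ha hb hc].
have := h1 h; rewrite gtr0_norm// => /(_ hb).
have := h2 h; rewrite gtr0_norm// => /(_ hc).
rewrite !add0r !FG ?lexx ?ler01 ?(ltW h0) ?(ltW ha)// /GRing.scale /= => b2 b1.
have : `|h * (l - m)| <= e * h.
  have -> : h * (l - m) = (G h - G 0 - h * m) - (G h - G 0 - h * l) by lra.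
  by apply: le_trans (ler_normB _ _) _; lra.
by rewrite normrM gtr0_norm// mulrC ler_pM2r.
Qed.

End RightDerivative.

Section Gramian.
Context {R : realType} {k : scalar_kind} {H U : hilbertType R k}.
Variables (S : R -> H -> H) (A : operator H) (B : U -> H -> scalar_field R k).
Hypotheses (hS : strongly_continuous_group S) (hA : generator S A).
Hypothesis (hB : bounded_to_dual (adjoint A) B).
Local Notation S' := (adjoint_group S).
Local Notation A' := (adjoint A).
Local Notation Bs := (control_adjoint B).
Local Notation sS' := (adjoint_strongly_continuous hS hA).
Local Notation gS' := (adjoint_generator hS hA).
Variables (l : R).

Definition weighted_trace phi (t : R) : U := expR (- l * t) *: Bs (S' (- t) phi).
Local Notation f := weighted_trace.

Let Dgroup phi t : dom A' phi -> dom A' (S' t phi).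
Proof. by move=> D; have [] := generator_group sS' gS' t D. Qed.

Lemma weighted_trace_act a phi t : dom A' phi -> f (act a phi) t = act a (f phi t).
Proof.
move=> D; rewrite /f klinear_act; last exact: (group_klinear sS').
have := control_adjoint_linear hS hA hB a (Dgroup (- t) D) (generator0 sS' gS').
rewrite (control_adjoint0 hS hA hB) !addr0 => ->.
by apply: ip_inj => z; rewrite ipZr !ip_actr ipZr.
Qed.

Lemma weighted_traceD phi psi t : dom A' phi -> dom A' psi ->
  f (phi + psi) t = f phi t + f psi t.
Proof.
move=> D1 D2; rewrite /f klinearD; last exact: (group_klinear sS').
have := control_adjoint_linear hS hA hB 1 (Dgroup (- t) D1) (Dgroup (- t) D2).
by rewrite !act1 => ->; rewrite scalerDr.
Qed.

Lemma weighted_traceZ r phi t : dom A' phi -> f (r *: phi) t = r *: f phi t.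
Proof. by move=> D; rewrite -!act_real; exact: weighted_trace_act. Qed.

Lemma weighted_trace_continuous phi : dom A' phi -> continuous (f phi).
Proof.
move=> D t; apply: cvgZ; last first.
  by apply: (control_adjoint_group_continuous hS hA hB) => //; exact: opp_continuous.
apply: continuous_comp; last exact: continuous_expR.
by apply: cvgM; [exact: cvg_cst|exact: cvg_id].
Qed.

Lemma weighted_trace_shift phi s t :
  f phi (t + s) = expR (- l * s) *: f (S' (- s) phi) t.
Proof.
rewrite /f -(groupD sS') -opprD scalerA -expRD; congr (expR _ *: _).
by rewrite mulrDr addrC.
Qed.

Definition partial_gramian (n : nat) phi psi := itg 0 n%:R (fun t => ip (f phi t) (f psi t)).
Local Notation q := partial_gramian.

Lemma weighted_trace_L2 a b phi : dom A' phi -> L2 a b (f phi).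
Proof. by move=> D; apply: L2_continuous; exact: weighted_trace_continuous. Qed.

Let ifg a b phi psi : dom A' phi -> dom A' psi -> itgb a b (fun t => ip (f phi t) (f psi t)).
Proof. by move=> D D'; apply: L2_ip; exact: weighted_trace_L2. Qed.

Lemma partial_gramian_diag n phi : q n phi phi = sqn 0 n%:R (f phi).
Proof. by apply: eq_itg => t _; rewrite ip_norm. Qed.

Variables (M w C : R).
Hypotheses (M1 : 1 <= M) (w0 : 0 <= w) (wl : w < l) (C0 : 0 <= C).
Hypothesis growth : forall t x, `|S' t x| <= M * expR (w * `|t|) * `|x|.
Hypothesis trace1 : forall phi, dom A' phi ->
  sqn 0 1 (fun t => Bs (S' (- t) phi)) <= C * `|phi| ^+ 2.

Let rho : R := expR (2 * (w - l)).
Let rho0 : 0 < rho. Proof. exact: expR_gt0. Qed.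
Let rho1 : rho < 1. Proof. by rewrite /rho expR_lt1 pmulr_rlt0// subr_lt0. Qed.
Let l0 : 0 < l. Proof. by apply: le_lt_trans wl. Qed.

(** Translation by n: the trace of phi on [n, n + 1] is the trace of S' (- n) phi on [0, 1],
  damped by expR (- l * n). *)
Lemma weighted_trace_unit n phi : dom A' phi ->
  sqn n%:R n.+1%:R (f phi) <= C * M ^+ 2 * rho ^+ n * `|phi| ^+ 2.
Proof.
move=> D; rewrite /sqn.
have cf : continuous (fun t => `|f phi t| ^+ 2).
  move=> t; apply: cvgM; apply: continuous_normr_fun; exact: weighted_trace_continuous.
have -> : n.+1%:R = 1 + n%:R :> R by rewrite -natr1 addrC.
rewrite -{1}(add0r n%:R) itg_shift// ?ler01//.
have Dn := Dgroup (- n%:R) D.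
apply: (@le_trans _ _ (itg 0 1 (fun t => expR (- l * n%:R) ^+ 2 *
    `|Bs (S' (- t) (S' (- n%:R) phi))| ^+ 2))).
  apply: le_itg.
  - have cs : continuous (fun t : R => t + n%:R).
      by move=> t; apply: cvgD; [exact: cvg_id|exact: cvg_cst].
    by apply: itgb_continuous => t; exact: (continuous_comp (cs t) (cf (t + n%:R))).
  - by apply: itgbZ; have [] := trace_L2 hS hA hB 0 1 Dn.
  move=> t /andP[t0 t1]; rewrite weighted_trace_shift /f !normrZ !exprMn.
  rewrite (ger0_norm (expR_ge0 _)); apply: ler_wpM2l; first exact: sqr_ge0.
  rewrite ger0_norm ?expR_ge0// ler_piMl ?sqr_ge0// expr_le1 ?expR_ge0//.
  by rewrite expR_le1 mulNr oppr_le0 mulr_ge0// ltW.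
rewrite itgZ; last by have [] := trace_L2 hS hA hB 0 1 Dn.
apply: le_trans (ler_wpM2l (sqr_ge0 _) (trace1 Dn)) _.
have gn := growth (- n%:R) phi.
have : `|S' (- n%:R) phi| ^+ 2 <= (M * expR (w * n%:R) * `|phi|) ^+ 2.
  rewrite ler_pXn2r ?nnegrE ?mulr_ge0 ?expR_ge0//; last by apply: le_trans M1.
  by move: gn; rewrite normrN ger0_norm.
move=> /(ler_wpM2l C0) /(ler_wpM2l (sqr_ge0 (expR (- l * n%:R)))) /le_trans; apply.
rewrite le_eqVlt; apply/orP; left; apply/eqP.
have -> : rho ^+ n = expR (- l * n%:R) ^+ 2 * expR (w * n%:R) ^+ 2.
  rewrite /rho -expRM_natl -!expRM_natl -expRD; congr expR; lra.
by rewrite !exprMn; ring.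
Qed.

Lemma partial_gramianS n phi psi : dom A' phi -> dom A' psi ->
  q n.+1 phi psi = q n phi psi + itg n%:R n.+1%:R (fun t => ip (f phi t) (f psi t)).
Proof.
by move=> D D'; apply: itg_chasles; rewrite ?ler0n ?ler_nat//; exact: ifg.
Qed.

Let K : R := C * M ^+ 2 / (1 - rho).
Let K0 : 0 <= K.
Proof. by apply: divr_ge0; [rewrite mulr_ge0 ?sqr_ge0|rewrite subr_ge0 ltW]. Qed.

(** The bounds of [weighted_trace_unit] form a geometric series, with partial sums
  K * (1 - rho ^+ n). *)
Lemma partial_gramian_bound n phi : dom A' phi -> q n phi phi <= K * `|phi| ^+ 2.
Proof.
move=> D; apply: (@le_trans _ _ (K * (1 - rho ^+ n) * `|phi| ^+ 2)); last first.
  rewrite -mulrA; apply: ler_wpM2l; first exact: K0.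
  by rewrite ler_piMl ?sqr_ge0// gerBl exprn_ge0// ltW.
elim: n => [|n ih]; first by rewrite /q itg_refl expr0 subrr mulr0 mul0r.
rewrite partial_gramianS//; have := weighted_trace_unit n D.
have -> : itg n%:R n.+1%:R (fun t => ip (f phi t) (f phi t)) = sqn n%:R n.+1%:R (f phi).
  by apply: eq_itg => t _; rewrite ip_norm.
have r1 : 1 - rho != 0 by rewrite gt_eqF// subr_gt0.
have -> : C * M ^+ 2 = K * (1 - rho) by rewrite /K divfK.
by rewrite [rho ^+ n.+1]exprS; move: ih; lra.
Qed.

Lemma partial_gramian_CS n phi psi : dom A' phi -> dom A' psi ->
  `|q n phi psi| <= K * `|phi| * `|psi|.
Proof.
move=> D D'; have r0 : 0 <= K * `|phi| * `|psi|.
  by apply: mulr_ge0 => //; apply: mulr_ge0 => //; exact: K0.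
rewrite -(@ler_pXn2r _ 2)// ?nnegrE//.
rewrite real_normK ?num_real//.
apply: le_trans (L2_CS (weighted_trace_L2 0 n%:R D) (weighted_trace_L2 0 n%:R D')) _.
rewrite -!partial_gramian_diag.
have -> : (K * `|phi| * `|psi|) ^+ 2 = (K * `|phi| ^+ 2) * (K * `|psi| ^+ 2) by ring.
by apply: ler_pM; rewrite ?partial_gramian_bound// partial_gramian_diag sqn_ge0.
Qed.

Let qD n r x y z : dom A' x -> dom A' y -> dom A' z ->
  q n (r *: x + y) z = r * q n x z + q n y z.
Proof.
move=> D1 D2 D3; have rD := subspace_real (generator_subspace sS' gS').
have D1' := real_subspaceZ r rD D1.
rewrite /q -itgZ; last exact: ifg.
rewrite -itgD; [|by apply: itgbZ; exact: ifg|exact: ifg].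
by apply: eq_itg => t _; rewrite weighted_traceD// weighted_traceZ// ipDl ipZl.
Qed.

Let qC n x y : q n x y = q n y x.
Proof. by apply: eq_itg => t _; rewrite ipC. Qed.

(** The diagonal is increasing and bounded; polarization gives the rest. *)
Lemma partial_gramian_cvg phi psi : dom A' phi -> dom A' psi ->
  exists v : R, q n phi psi @[n --> \oo] --> v.
Proof.
move=> D D'; have rD := subspace_real (generator_subspace sS' gS').
have diag x : dom A' x -> exists v : R, q n x x @[n --> \oo] --> v.
  move=> Dx; exists (limn (fun n => q n x x)).
  apply: nondecreasing_is_cvgn.
    apply/nondecreasing_seqP => n; rewrite partial_gramianS// lerDl.
    by apply: itg_ge0 => t _; rewrite ip_norm sqr_ge0.
  by exists (K * `|x| ^+ 2) => _ [n _ <-]; exact: partial_gramian_bound.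
have [v hv] := diag _ (real_subspaceD rD D D').
have [v1 hv1] := diag _ D; have [v2 hv2] := diag _ D'.
exists ((v - v1 - v2) / 2).
have -> : (fun n => q n phi psi) =
    (fun n => (q n (phi + psi) (phi + psi) - q n phi phi - q n psi psi) / 2).
  apply/funext => n; have := qD n 1 D D' (real_subspaceD rD D D').
  rewrite !scale1r => ->; rewrite mul1r ![q n _ (phi + psi)]qC.
  have := qD n 1 D D' D; have := qD n 1 D D' D'; rewrite !scale1r => -> ->.
  by rewrite !mul1r [q n psi phi]qC; field.
by apply: cvgM; [apply: cvgB => //; exact: cvgB|exact: cvg_cst].
Qed.

Lemma gramian_exists : exists Q : H -> H, [/\ bounded_operator Q,
  forall x y, ip (Q x) y = ip x (Q y) &
  forall phi psi, dom A' phi -> dom A' psi -> q n phi psi @[n --> \oo] --> ip (Q phi) psi].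
Proof.
pose g phi psi := limn (fun n => q n phi psi).
have hg phi psi : dom A' phi -> dom A' psi -> q n phi psi @[n --> \oo] --> g phi psi.
  by move=> D D'; have [v hv] := partial_gramian_cvg D D'; apply/cvg_ex; exists v.
have [|||||||Q [bQ sQ hQ]] := @extend_bounded_form R k H (dom A') g K.
- exact: (generator_subspace sS' gS').
- exact: (adjoint_dense hS hA).
- exact: K0.
- move=> r x y z D1 D2 D3; have rD := subspace_real (generator_subspace sS' gS').
  apply: cvg_lim => //; under eq_fun do rewrite qD//.
  by apply: cvgD; [apply: cvgM; [exact: cvg_cst|exact: hg]|exact: hg].
- by move=> x y D D'; rewrite /g; congr (limn _); apply/funext => n; rewrite qC.
- move=> a x y D D'; rewrite /g; congr (limn _); apply/funext => n.
  by apply: eq_itg => t _; rewrite !weighted_trace_act// ip_act.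
- move=> x y D D'; rewrite ler_norml; apply/andP; split.
    apply: (cvgr_to_ge (hg _ _ D D')); near=> n.
    by have := partial_gramian_CS n D D'; rewrite ler_norml => /andP[].
  apply: (cvgr_to_le (hg _ _ D D')); near=> n.
  by have := partial_gramian_CS n D D'; rewrite ler_norml => /andP[].
exists Q; split => // phi psi D D'; rewrite hQ//; exact: hg.
Unshelve. all: by end_near. Qed.

(** Translation of the integral over the half-line; the mismatch at finite n is an integral
  over [n, n + s], which tends to 0. *)
Lemma gramian_shift (Q : H -> H) phi psi s : dom A' phi -> dom A' psi ->
  (forall phi psi, dom A' phi -> dom A' psi -> q n phi psi @[n --> \oo] --> ip (Q phi) psi) ->
  0 <= s <= 1 ->
  expR (- l * s) ^+ 2 * ip (Q (S' (- s) phi)) (S' (- s) psi) =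
  ip (Q phi) psi - itg 0 s (fun t => ip (f phi t) (f psi t)).
Proof.
move=> D D' hQ /andP[s0 s1]; pose m t := ip (f phi t) (f psi t).
have cm : continuous m by apply: continuous_ip; exact: weighted_trace_continuous.
have im a b : itgb a b m by exact: itgb_continuous.
pose N1 := C * M ^+ 2 * (`|phi| ^+ 2 + `|psi| ^+ 2).
have e1 n : expR (- l * s) ^+ 2 * q n (S' (- s) phi) (S' (- s) psi) =
    q n phi psi + itg n%:R (n%:R + s) m - itg 0 s m.
  have n0 : 0 <= n%:R :> R by rewrite ler0n.
  have -> : expR (- l * s) ^+ 2 * q n (S' (- s) phi) (S' (- s) psi) = itg s (n%:R + s) m.
    have -> : itg s (n%:R + s) m = itg (0 + s) (n%:R + s) m by rewrite add0r.
    rewrite itg_shift// /q -itgZ; last by apply: ifg; exact: Dgroup.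
    by apply: eq_itg => t _; rewrite /m !weighted_trace_shift ipZl ipZr mulrA expr2.
  have -> : q n phi psi + itg n%:R (n%:R + s) m = itg 0 (n%:R + s) m.
    by rewrite /q -/m -itg_chasles// lerDl.
  by rewrite (@itg_chasles _ m 0 s) ?lerDr//; lra.
have tail : itg n%:R (n%:R + s) m @[n --> \oo] --> (0 : R).
  have : N1 * rho ^+ n @[n --> \oo] --> N1 * (0 : R).
    apply: cvgM; first exact: cvg_cst.
    by apply: cvg_expr; rewrite gtr0_norm.
  rewrite mulr0 => h; apply: (@squeeze_cvgr _ _ _ _ (fun n => - (N1 * rho ^+ n)) (fun n => N1 * rho ^+ n)) => //.
    near=> n; rewrite -ler_norml.
    apply: le_trans (norm_itg _) _; first exact: im.
    have i1 : itgb n%:R n.+1%:R (fun t => `|f phi t| ^+ 2 + `|f psi t| ^+ 2).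
      apply: itgbD; first by have [] := weighted_trace_L2 n%:R n.+1%:R D.
      by have [] := weighted_trace_L2 n%:R n.+1%:R D'.
    have nS : n%:R + s <= n.+1%:R :> R by rewrite -natr1 lerD2l.
    have n0 : n%:R <= n%:R + s :> R by rewrite lerDl.
    apply: (@le_trans _ _ (itg n%:R n.+1%:R (fun t => `|f phi t| ^+ 2 + `|f psi t| ^+ 2))).
      rewrite (itg_chasles n0 nS i1) -[leLHS]addr0; apply: lerD; last first.
        by apply: itg_ge0 => t _; rewrite addr_ge0// sqr_ge0.
      apply: le_itg.
      - by apply: itgb_norm; exact: im.
      - exact: itgb_subitv i1.
      move=> t _; apply: le_trans (ip_CS _ _) _.
      by have := sqr_ge0 (`|f phi t| - `|f psi t|); rewrite sqrrB; nra.
    rewrite itgD; [|by have [] := weighted_trace_L2 n%:R n.+1%:R D|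
      by have [] := weighted_trace_L2 n%:R n.+1%:R D'].
    have := weighted_trace_unit n D; have := weighted_trace_unit n D'.
    by rewrite /N1 -!/(sqn _ _ _); lra.
  by rewrite -oppr0; apply: cvgN.
have c1 : expR (- l * s) ^+ 2 * q n (S' (- s) phi) (S' (- s) psi) @[n --> \oo] -->
    expR (- l * s) ^+ 2 * ip (Q (S' (- s) phi)) (S' (- s) psi).
  by apply: cvgM; [exact: cvg_cst|apply: hQ; exact: Dgroup].
have c2 : expR (- l * s) ^+ 2 * q n (S' (- s) phi) (S' (- s) psi) @[n --> \oo] -->
    ip (Q phi) psi + 0 - itg 0 s m.
  under eq_fun do rewrite e1.
  by apply: cvgB; [apply: cvgD => //; exact: hQ|exact: cvg_cst].
by rewrite (cvg_unique (@norm_hausdorff _ _) c1 c2) addr0.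
Unshelve. all: by end_near. Qed.

(** Both sides of [gramian_shift] are differentiated at s = 0. *)
Lemma gramian_lyapunov (Q : H -> H) phi psi : bounded_operator Q ->
  (forall phi psi, dom A' phi -> dom A' psi -> q n phi psi @[n --> \oo] --> ip (Q phi) psi) ->
  dom A' phi -> dom A' psi ->
  ip (Q (A' phi)) psi + ip (Q phi) (A' psi) + 2 * l * ip (Q phi) psi = ip (Bs phi) (Bs psi).
Proof.
move=> bQ hQ D D'; pose m t := ip (f phi t) (f psi t).
have cm : continuous m by apply: continuous_ip; exact: weighted_trace_continuous.
have dV x : dom A' x -> is_derive (0 : R) (1 : R) (fun s => S' (- s) x) (- A' x).
  move=> Dx; have h := generator_group_derive sS' gS' 0 Dx.
  rewrite (group0 sS') in h.
  apply/is_derive_littleoP => e e0; move/is_derive_littleoP : h => /(_ e e0)[d d0 hd].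
  exists d => // h hd'; have := hd (- h); rewrite normrN => /(_ hd').
  by rewrite !add0r oppr0 scaleNr scalerN.
have dE : is_derive (0 : R) (1 : R) (fun s : R => expR (- l * s) ^+ 2) (- 2 * l).
  have -> : (fun s : R => expR (- l * s) ^+ 2) = (fun s => expR ((- 2 * l) * s + 0)).
    by apply/funext => s; rewrite -expRM_natl addr0; congr expR; lra.
  have := @is_derive_affine R expR (- 2 * l) 0 0 1.
  by rewrite mulr1; apply; rewrite mulr0 addr0 -{2}expR0; exact: is_derive_expR.
have dT : is_derive (0 : R) (1 : R) (fun s => ip (Q (S' (- s) phi)) (S' (- s) psi))
    (- ip (Q (A' phi)) psi - ip (Q phi) (A' psi)).
  have h := is_derive_ip (is_derive_operator bQ (dV _ D)) (dV _ D').
  apply: (is_derive_eq h).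
  have [lQ _] := bQ; rewrite /= oppr0 !(group0 sS') ipNr; congr (_ - _).
  by rewrite -ipNl -(scaleN1r (A' phi)) klinearZ// scaleN1r.
have dL : is_derive (0 : R) (1 : R)
    (fun s => expR (- l * s) ^+ 2 * ip (Q (S' (- s) phi)) (S' (- s) psi))
    (- 2 * l * ip (Q phi) psi + (- ip (Q (A' phi)) psi - ip (Q phi) (A' psi))).
  have h := is_deriveM dE dT; apply: (is_derive_eq h).
  rewrite mulr0 expR0 oppr0 !(group0 sS') expr1n /GRing.scale /=; ring.
have dR : is_derive (0 : R) (1 : R)
    (fun s => ip (Q phi) psi + itg (-1) 0 m - itg (-1) s m) (- m 0).
  (* Based at -1, the primitive is differentiable on both sides of 0. *)
  have h1 : is_derive (0 : R) (1 : R) (fun s => itg (-1) s m) (m 0).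
    by apply: itg_FTC1 => //; rewrite ltrN10.
  have h := is_deriveB (is_derive_cst (ip (Q phi) psi + itg (-1) 0 m) (0 : R) (1 : R)) h1.
  by apply: (is_derive_eq h); rewrite sub0r.
have m0 : m 0 = ip (Bs phi) (Bs psi).
  by rewrite /m /f mulr0 expR0 !scale1r oppr0 !(group0 sS').
have := is_derive_right_unique dL dR; rewrite m0 => h.
suff : - 2 * l * ip (Q phi) psi + (- ip (Q (A' phi)) psi - ip (Q phi) (A' psi)) =
  - ip (Bs phi) (Bs psi) by lra.
apply: h => s s01; rewrite (gramian_shift D D' hQ s01).
have /andP[s0 _] := s01.
have N10 : -1 <= 0 :> R by rewrite lerN10.
have ims : itgb (-1) s m by exact: itgb_continuous.
by rewrite (itg_chasles N10 s0 ims); ring.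
Qed.

Lemma gramian_positive (Q : H -> H) (T C1 : R) : bounded_operator Q ->
  (forall phi psi, dom A' phi -> dom A' psi -> q n phi psi @[n --> \oo] --> ip (Q phi) psi) ->
  0 < T -> 0 < C1 -> (forall phi, dom A' phi ->
    `|phi| ^+ 2 <= C1 * sqn 0 T (fun t => Bs (S' (- t) phi))) ->
  positive_operator Q.
Proof.
move=> bQ hQ T0 C10 obs.
pose c := expR (- l * T) ^+ 2 / C1.
have c0 : 0 < c by rewrite divr_gt0// exprn_gt0// expR_gt0.
exists c => // x.
have hD phi : dom A' phi -> c * `|phi| ^+ 2 <= ip (Q phi) phi.
  move=> D; apply: (cvgr_to_ge (hQ _ _ D D)).
  have [N TN] : exists N : nat, T <= N%:R.
    by exists (Num.truncn T).+1; apply: ltW; apply: truncnS_gt.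
  near=> n; have nT : T <= n%:R.
    by apply: le_trans TN _; rewrite ler_nat; near: n; exact: nbhs_infty_ge.
  have Lf := weighted_trace_L2.
  rewrite partial_gramian_diag /sqn (@itg_chasles _ _ 0 T n%:R) ?(ltW T0)//; last first.
    by have [] := Lf 0 n%:R _ D.
  rewrite -[leLHS]addr0; apply: lerD; last by apply: itg_ge0 => t _; rewrite sqr_ge0.
  apply: (@le_trans _ _ (expR (- l * T) ^+ 2 * sqn 0 T (fun t => Bs (S' (- t) phi)))).
    rewrite /c -mulrA; apply: ler_wpM2l; first exact: sqr_ge0.
    by rewrite mulrC ler_pdivrMr// mulrC obs.
  rewrite -itgZ; last by have [] := trace_L2 hS hA hB 0 T D.
  apply: le_itg.
  - by apply: itgbZ; have [] := trace_L2 hS hA hB 0 T D.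
  - by have [] := Lf 0 T _ D.
  move=> t /andP[t0 tT]; rewrite /f normrZ exprMn; apply: ler_wpM2r; first exact: sqr_ge0.
  rewrite ger0_norm ?expR_ge0// ler_pXn2r ?nnegrE ?expR_ge0// ler_expR !mulNr lerN2.
  by rewrite ler_pM2l// ltW.
have [u Du ux] := norm_dense_seq x (adjoint_dense hS hA).
have h1 : ip (Q (u n)) (u n) @[n --> \oo] --> ip (Q x) x.
  by apply: cvg_ip => //; exact: bounded_operator_cvg.
have h2 : c * `|u n| ^+ 2 @[n --> \oo] --> c * `|x| ^+ 2.
  by apply: cvgM; [exact: cvg_cst|apply: cvgM; exact: cvg_norm].
rewrite -/(ip _ _); apply: (ler_cvg_to h2 h1); near=> n; exact: hD.
Unshelve. all: by end_near. Qed.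

End Gramian.

(** * Density of regular curves *)

Section VectorIntegrals.
Context {R : realType} {k : scalar_kind} {X : hilbertType R k}.
Local Notation mu := (@lebesgue_measure R).

Lemma bochner_ip (a b : R) (f : R -> X) v x : bochner `]a, b[ f v ->
  itgb a b (fun t => ip (f t) x) /\ ip v x = itg a b (fun t => ip (f t) x).
Proof.
pose r := (1 + `|x|)^-1; have r0 : 0 < r by rewrite invr_gt0 ltr_wpDr.
move=> /(@bochner_functional _ _ _ _ _ _ _ _ (fun w => ip w (r *: x))) [].
- by move=> c u w; rewrite ipDl ipZl.
- move=> w; rewrite lee_fin; apply: le_trans (ip_CS _ _) _; rewrite ler_piMr//.
  by rewrite normrZ gtr0_norm// mulrC ler_pdivrMr ?ltr_wpDr// mul1r lerDr.
move=> i e; have i' : itgb a b (fun t => ip (f t) x).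
  apply: eq_itgb (itgbZ r^-1 i) => t _.
  by rewrite ipZr mulrA mulVf ?mul1r// lt0r_neq0.
split => //; apply: (mulfI (lt0r_neq0 r0)); rewrite -ipZr e -itgZ//.
by apply: eq_itg => t _; rewrite ipZr.
Qed.

Lemma sqn_eq0_ae (a b : R) (f g : R -> X) : L2 a b f -> L2 a b g ->
  sqn a b (fun t => f t - g t) = 0 ->
  {ae mu, forall t, t \in `]a, b[ -> f t = g t}.
Proof.
move=> Lf Lg s0; have [sfg ifg] := L2B Lf Lg.
have : (\int[mu]_(t in `]a, b[) `|(`|f t - g t| ^+ 2)%:E| = 0)%E.
  rewrite -[RHS]/(0%:E) -s0 -integral_itg//; apply: eq_integral => t _.
  by rewrite gee0_abs// lee_fin sqr_ge0.
have mf : measurable_fun `]a, b[ (fun t => (`|f t - g t| ^+ 2)%:E).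
  by apply/measurable_EFinP; exact: itgb_measurable ifg.
have [h _] := ae_eq_integral_abs mu (measurable_itv `]a, b[) mf.
move=> /h; apply: filterS => t ht tab.
have := ht tab => /= -[] /eqP; rewrite sqrf_eq0 normr_eq0 subr_eq0.
by move/eqP.
Qed.

Lemma wintB (a b : R) (f g : R -> X) : continuous f -> continuous g ->
  wint a b (fun t => f t - g t) = wint a b f - wint a b g.
Proof.
move=> cf cg; apply: ip_inj => x.
have cfg : continuous (fun t => f t - g t) by move=> t; exact: cvgB (cf t) (cg t).
rewrite ipBr !wint_ip// -itgB; try (by apply: itgb_continuous; exact: continuous_ipr).
by apply: eq_itg => t _; rewrite ipBr.
Qed.

End VectorIntegrals.

Section RegularCurves.
Context {R : realType} {k : scalar_kind} {H : hilbertType R k}.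
Variables (S : R -> H -> H) (A : operator H).
Hypotheses (hS : strongly_continuous_group S) (hA : generator S A).
Local Notation mu := (@lebesgue_measure R).

Definition regular_curve (g : R -> H) :=
  [/\ forall t, dom A (g t), continuous g & continuous (A \o g)].

Let subD := subspace_real (generator_subspace hS hA).

Let linA (r : R) x y : dom A x -> dom A y -> A (r *: x + y) = r *: A x + A y.
Proof. by move=> D D'; have [_] := generator_linear hS hA (r *: 1) D D'; rewrite !act_real. Qed.

Lemma regular_curve_linear (r : R) g1 g2 : regular_curve g1 -> regular_curve g2 ->
  regular_curve (fun t => r *: g1 t + g2 t).
Proof.
move=> [D1 c1 a1] [D2 c2 a2]; split => [t|t|].
- exact: subD.2.
- by apply: cvgD; [exact: cvgZr (c1 t)|exact: c2].
have -> : A \o (fun t => r *: g1 t + g2 t) = (fun t => r *: A (g1 t) + A (g2 t)).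
  by apply/funext => t /=; exact: linA.
by move=> t; apply: cvgD; [exact: cvgZr (a1 t)|exact: a2].
Qed.

Lemma regular_curveD g1 g2 : regular_curve g1 -> regular_curve g2 ->
  regular_curve (fun t => g1 t + g2 t).
Proof.
move=> h1 h2; have := regular_curve_linear 1 h1 h2.
by congr regular_curve; apply/funext => t; rewrite scale1r.
Qed.

Lemma regular_curveB g1 g2 : regular_curve g1 -> regular_curve g2 ->
  regular_curve (fun t => g1 t - g2 t).
Proof.
move=> h1 h2; have := regular_curve_linear (-1) h2 h1.
by congr regular_curve; apply/funext => t; rewrite scaleN1r addrC.
Qed.

Lemma regular_curve_scale (c : R -> R) x : continuous c -> dom A x ->
  regular_curve (fun t => c t *: x).
Proof.
move=> cc Dx; split => [t|t|].
- exact: real_subspaceZ.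
- by apply: cvgZ; [exact: cc|exact: cvg_cst].
have -> : A \o (fun t => c t *: x) = (fun t => c t *: A x).
  apply/funext => t /=; have := linA (c t) Dx subD.1.
  by rewrite (generator0_val hS hA) !addr0.
by move=> t; apply: cvgZ; [exact: cc|exact: cvg_cst].
Qed.

Lemma regular_curve0 : regular_curve (fun=> 0).
Proof.
have c0 : continuous (fun _ : R => 0 : R) by move=> t; exact: cvg_cst.
have := regular_curve_scale c0 subD.1.
by congr regular_curve; apply/funext => t; rewrite scaler0.
Qed.

Section Approximation.
Variable T : R.

Let approximable f := sm `]0, T[ f /\ forall e : R, 0 < e -> exists g,
  [/\ regular_curve g, itgb 0 T (fun t => `|f t - g t|) & itg 0 T (fun t => `|f t - g t|) < e].

Let smn (f g : R -> H) : sm `]0, T[ f -> sm `]0, T[ g -> measurable_fun `]0, T[ (fun t => `|f t - g t|).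
Proof. by move=> sf sg; apply: sm_norm; exact: smB. Qed.

Let approximableD f1 f2 : approximable f1 -> approximable f2 ->
  approximable (fun t => f1 t + f2 t).
Proof.
move=> [s1 h1] [s2 h2]; split; first exact: smD.
move=> e e0; have e2 : 0 < e / 2 by rewrite divr_gt0.
have [g1 [r1 i1 l1]] := h1 _ e2; have [g2 [r2 i2 l2]] := h2 _ e2.
have le t : `|f1 t + f2 t - (g1 t + g2 t)| <= `|f1 t - g1 t| + `|f2 t - g2 t|.
  by rewrite opprD addrACA ler_normD.
have i : itgb 0 T (fun t => `|f1 t + f2 t - (g1 t + g2 t)|).
  apply: (itgb_dominated _ (itgbD i1 i2)) => [|t _]; last by rewrite normr_id.
  apply: smn; first exact: smD.
  by apply: sm_continuous; have [_ c _] := regular_curveD r1 r2.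
exists (fun t => g1 t + g2 t); split => //; first exact: regular_curveD.
apply: (@le_lt_trans _ _ (itg 0 T (fun t => `|f1 t - g1 t| + `|f2 t - g2 t|))).
  by apply: le_itg => //; exact: itgbD.
by rewrite itgD//; lra.
Qed.

Let approximable_step (c : R -> R) x : norm_dense (dom A) ->
  sm `]0, T[ (fun t => c t *: x) -> itgb 0 T c -> (forall t, `|c t| <= 1) ->
  approximable (fun t => c t *: x).
Proof.
move=> dense sc ic c1; split => // e e0.
have [T0|T0] := leP T 0.
  exists (fun=> 0); split; [exact: regular_curve0| |by rewrite itg_void].
  apply: (itgb_dominated _ (itgb_cst 0 0 T)); last by move=> t /andP[]; lra.
  by apply: smn => //; apply: sm_continuous => t; exact: cvg_cst.
have eT : 0 < e / (2 * T) by rewrite divr_gt0// mulr_gt0.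
have [y Dy xy] := dense x _ eT.
have mT : (mu `]0%R, T[%classic < +oo)%E by rewrite lebesgue_measure_itv/= lte_fin T0 -EFinB ltry.
have [G [cG iG lG]] := @approximation_continuous_integrable R `]0, T[%classic c
   (measurable_itv _) mT ic.
have ey : 0 < e / (2 * (`|y| + 1)) by rewrite divr_gt0// mulr_gt0// ltr_wpDl.
have [n _ hn] := cvge0_lt lG ey.
have {hn} := hn n (leqnn n).
have icG : itgb 0 T (fun t => `|c t - G n t|) by apply: itgb_norm; apply: itgbB => //; exact: iG.
have -> : (\int[mu]_(z in `]0%R, T[%classic) `|(c z - G n z)%:E| =
    (itg 0 T (fun t => `|c t - G n t|))%:E)%E by exact: (integral_itg icG).
rewrite lte_fin => lcG.
have rg := regular_curve_scale (cG n) Dy.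
have le t : `|c t *: x - G n t *: y| <= `|x - y| + `|y| * `|c t - G n t|.
  have -> : c t *: x - G n t *: y = c t *: (x - y) + (c t - G n t) *: y.
    by rewrite scalerBr scalerBl addrA subrK.
  apply: le_trans (ler_normD _ _) _; rewrite !normrZ; apply: lerD; last by rewrite mulrC.
  by rewrite ler_piMl.
have ib : itgb 0 T (fun t => `|x - y| + `|y| * `|c t - G n t|).
  by apply: itgbD; [exact: itgb_cst|exact: itgbZ].
have i : itgb 0 T (fun t => `|c t *: x - G n t *: y|).
  apply: (itgb_dominated _ ib) => [|t _]; last by rewrite normr_id.
  by apply: smn => //; apply: sm_continuous; have [] := rg.
exists (fun t => G n t *: y); split => //.
apply: le_lt_trans (le_itg i ib (fun t _ => le t)) _.
rewrite itgD; [|exact: itgb_cst|exact: itgbZ].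
rewrite itgZ// itg_cst ?ltW// subr0.
have h1 : `|x - y| * T < e / 2.
  by move: xy; rewrite ltr_pdivlMr ?mulr_gt0//; lra.
have h2 : `|y| * itg 0 T (fun t => `|c t - G n t|) <= e / 2.
  have y1 : 0 < `|y| + 1 by rewrite ltr_wpDl.
  move: (ltW lcG); rewrite ler_pdivlMr ?mulr_gt0//.
  have : 0 <= itg 0 T (fun t => `|c t - G n t|) by apply: itg_ge0.
  nra.
lra.
Qed.

Let approximable_simple s : norm_dense (dom A) -> simple_function setT s -> approximable s.
Proof.
move=> dense hs; have [_ fs _] := hs.
have [q0 hq0] := (finite_seqP _).1 fs.
pose q := undup q0; have hq : range s = [set` q].
  by rewrite hq0; apply/seteqP; split => v /=; rewrite mem_undup.
have uq : uniq q by exact: undup_uniq.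
have smS (s' : R -> H) : simple_function setT s' -> sm `]0, T[ s'.
  by move=> h; apply/smP; exists (fun=> s') => // t _; exact: cvg_cst.
have step v : approximable (fun t => (s t == v)%:R *: v).
  apply: approximable_step => //.
  - by apply: smS; apply: (@simple_comp R H H s (fun u => (u == v)%:R *: v)).
  - exact: (itgb_simple 0 T (fun u => (u == v)%:R) hs).
  - by move=> t; case: eqP => _; rewrite ?normr1// normr0.
have sums (r : seq H) : approximable (fun t => \sum_(v <- r) (s t == v)%:R *: v).
  elim: r => [|v r ih].
    under eq_fun do rewrite big_nil; split.
      by apply: sm_continuous => t; exact: cvg_cst.
    move=> e e0; exists (fun=> 0); split; first exact: regular_curve0.
      by apply: itgb_continuous => t; exact: cvg_cst.
    have -> : itg 0 T (fun=> `|0 - 0 : H|) = 0 * itg 0 T (fun=> 0).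
      rewrite -itgZ; last by apply: itgb_cst.
      by apply: eq_itg => t _; rewrite subrr normr0 mul0r.
    by rewrite mul0r.
  by under eq_fun do rewrite big_cons; exact: approximableD.
suff -> : s = (fun t => \sum_(v <- q) (s t == v)%:R *: v) by exact: sums.
apply/funext => t; have sq : s t \in q by have : range s (s t) by []; rewrite hq.
rewrite (bigD1_seq (s t))//= eqxx scale1r big1 ?addr0// => v.
by rewrite eq_sym => /negbTE ->; rewrite scale0r.
Qed.

(** Integrable functions are approximated by simple ones, which are sums of scalar step
  functions times vectors; step functions are approximated by continuous ones and vectors
  by elements of the domain. *)
Lemma regular_dense_L1 h : norm_dense (dom A) -> sm `]0, T[ h -> itgb 0 T (fun t => `|h t|) ->
  forall e : R, 0 < e -> exists g, [/\ regular_curve g,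
    itgb 0 T (fun t => `|h t - g t|) & itg 0 T (fun t => `|h t - g t|) < e].
Proof.
move=> dense sh ih e e0.
have [s [ss is_ ls]] := approx_simple sh ih.
have e2 : 0 < e / 2 by rewrite divr_gt0.
have [n _ hn] : \forall n \near \oo, itg 0 T (fun t => `|h t - s n t|) < e / 2.
  by apply: (cvgr_lt _ ls).
have ln := hn n (leqnn n).
have [sn hs] := approximable_simple dense (ss n).
have [g [rg ig lg]] := hs _ e2; exists g.
have le t : `|h t - g t| <= `|h t - s n t| + `|s n t - g t|.
  by rewrite -(subrKA (s n t)) ler_normD.
have ib := itgbD (is_ n) ig.
have i : itgb 0 T (fun t => `|h t - g t|).
  apply: (itgb_dominated _ ib) => [|t _]; last by rewrite normr_id.
  by apply: smn => //; apply: sm_continuous; have [] := rg.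
split => //; apply: le_lt_trans (le_itg i ib (fun t _ => le t)) _.
by rewrite itgD//; have : itg 0 T (fun t => `|h t - s n t|) < e / 2 := ln; lra.
Qed.

End Approximation.
End RegularCurves.

(** * Mild solutions with regular data *)

Lemma subr_exchange (V : zmodType) (a b c d : V) : a - b - (c - d) = a - c - (b - d).
Proof. by rewrite !opprB [d - c]addrC [d - b]addrC !addrA [a - b - c]addrAC. Qed.

Section ProductRule.
Context {R : realType} {k : scalar_kind} {H : hilbertType R k}.
Variables (S : R -> H -> H) (A : operator H).
Hypotheses (hS : strongly_continuous_group S) (hA : generator S A).

Lemma continuous_at_within (V : normedModType R) (f : R -> V) a b :
  (forall x, a <= x <= b -> {for x, continuous f}) -> {within `[a, b], continuous f}.
Proof.
move=> cf; apply/within_itv_continuousP => x xab e e0.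
have /cvgrPdist_lt/(_ _ e0)/nbhs_ballP[d d0 h] := cf x xab.
by exists d => // y _ xy; exact: h.
Qed.

Let split3 (V : zmodType) (a b c d f g : V) :
  a - f - (d - g) = (a - b - c) + (c - d) + (b - f + g).
Proof.
rewrite subrKA [a - b - d]addrAC -[b - f + g]addrA subrKA opprB.
by rewrite [g - d]addrC addrACA.
Qed.

(** The increment is the sum of those of zeta, of s |-> S (- s) z' and of the orbit of
  zeta t; only the last one requires a vector of the domain, namely zeta t. *)
Lemma group_product_derive (zeta : R -> H) t z' : is_derive t (1 : R) zeta z' ->
  dom A (zeta t) ->
  is_derive t (1 : R) (fun s => S (- s) (zeta s)) (S (- t) z' - S (- t) (A (zeta t))).
Proof.
move=> dz D; have [M M1 hM] := group_local_bound hS (`|t| + 1).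
have M0 : 0 < M by apply: lt_le_trans M1.
apply/is_derive_littleoP => e e0.
have e3 : 0 < e / 3 by rewrite divr_gt0.
have eM : 0 < e / (3 * M) by rewrite divr_gt0// mulr_gt0.
move/is_derive_littleoP : dz => /(_ _ eM)[d1 d10 h1].
have := generator_group_derive hS hA (- t) D.
move=> /is_derive_littleoP /(_ _ e3)[d2 d20 h2].
have /cvgrPdist_lt/(_ _ e3)/nbhs_ballP[d3 d30 h3] := @group_cont R k H S hS z' (- t).
exists (Num.min (Num.min d1 d2) (Num.min d3 1)) => [|h].
  have d30' : 0 < d3 := d30.
  by rewrite !lt_min d10 d20 d30' ltr01.
rewrite !lt_min => /andP[/andP[hd1 hd2] /andP[hd3 hd4]].
rewrite opprD.
have lin x y : S (- t + - h) (x - y) = S (- t + - h) x - S (- t + - h) y.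
  by rewrite klinearB//; exact: (group_klinear hS).
have linZ x : S (- t + - h) (h *: x) = h *: S (- t + - h) x.
  by rewrite klinearZ//; exact: (group_klinear hS).
rewrite scalerBr (split3 _ (S (- t - h) (zeta t)) (h *: S (- t - h) z')).
have -> : e * `|h| = e / 3 * `|h| + e / 3 * `|h| + e / 3 * `|h| by field.
apply: le_trans (ler_normD _ _) _; apply: lerD; last first.
  by have := h2 (- h); rewrite normrN scaleNr opprK; exact.
apply: le_trans (ler_normD _ _) _; apply: lerD.
  rewrite -linZ -!lin; have th : `|- t + - h| <= `|t| + 1.
    by apply: le_trans (ler_normD _ _) _; rewrite !normrN lerD2l ltW.
  apply: le_trans (hM _ _ th) _; apply: le_trans (ler_wpM2l (ltW M0) (h1 h hd1)) _.
  by rewrite le_eqVlt; apply/orP; left; apply/eqP; field; rewrite gt_eqF.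
rewrite -scalerBr normrZ mulrC; apply: ler_wpM2r => //.
rewrite distrC; apply: ltW; apply: h3.
by rewrite /ball /= opprD addrA subrr sub0r normrN normrN.
Qed.

End ProductRule.

Section Mild.
Context {R : realType} {k : scalar_kind} {H U : hilbertType R k}.
Variables (S : R -> H -> H) (A : operator H) (B : U -> H -> scalar_field R k).
Hypotheses (hS : strongly_continuous_group S) (hA : generator S A).
Hypothesis (hB : bounded_to_dual (adjoint A) B).
Local Notation S' := (adjoint_group S).
Local Notation A' := (adjoint A).
Local Notation Bs := (control_adjoint B).
Local Notation sS' := (adjoint_strongly_continuous hS hA).
Local Notation gS' := (adjoint_generator hS hA).
Local Notation regular := (regular_curve A').

(** The integral from 0 to t, based at -1 so as to be differentiable on both sides of
  every t >= 0. *)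
Definition mild_primitive (g : R -> H) t :=
  wint (-1) t (fun s => S' s (g s)) - wint (-1) 0 (fun s => S' s (g s)).

Definition mild z0 g t := S' (- t) (z0 + mild_primitive g t).

Let Dgroup phi t : dom A' phi -> dom A' (S' t phi).
Proof. by move=> D; have [] := generator_group sS' gS' t D. Qed.

Let rD : real_subspace (dom A') := subspace_real (generator_subspace sS' gS').

Let linA (r : R) x y : dom A' x -> dom A' y -> A' (r *: x + y) = r *: A' x + A' y.
Proof. by move=> D D'; have [_] := generator_linear sS' gS' (r *: 1) D D'; rewrite !act_real. Qed.

Let AD x y : dom A' x -> dom A' y -> A' (x + y) = A' x + A' y.
Proof. by move=> D D'; have := linA 1 D D'; rewrite !scale1r. Qed.

Let AB x y : dom A' x -> dom A' y -> A' (x - y) = A' x - A' y.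
Proof. by move=> D D'; have := linA (-1) D' D; rewrite !scaleN1r ![- _ + _]addrC. Qed.

Lemma pulled_back_continuous g : continuous g -> continuous (fun s => S' s (g s)).
Proof. by move=> cg; apply: (group_continuous sS') => // t; exact: cvg_id. Qed.

Lemma mild_primitive_ge0 g t : continuous g -> 0 <= t ->
  mild_primitive g t = wint 0 t (fun s => S' s (g s)).
Proof.
move=> cg t0; rewrite /mild_primitive (@wint_chasles _ _ _ _ (-1) 0 t)//.
- by rewrite addrAC subrr add0r.
- exact: pulled_back_continuous.
Qed.

Lemma mild_primitive_dom g t : regular g -> dom A' (mild_primitive g t) /\
  A' (mild_primitive g t) = mild_primitive (A' \o g) t.
Proof.
move=> [Dg cg cAg].
have e : A' \o (fun s => S' s (g s)) = (fun s => S' s (A' (g s))).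
  by apply/funext => s; exact: (generator_group sS' gS' s (Dg s)).2.
have w a b : dom A' (wint a b (fun s => S' s (g s))) /\
    A' (wint a b (fun s => S' s (g s))) = wint a b (fun s => S' s (A' (g s))).
  have := @adjoint_wint _ _ _ _ _ hS hA (fun s => S' s (g s)) a b.
  rewrite e; apply; [exact: pulled_back_continuous| |by move=> t'; exact: Dgroup].
  exact: (pulled_back_continuous cAg).
have [D1 E1] := w (-1) t; have [D2 E2] := w (-1) 0.
by split; [exact: real_subspaceB|rewrite AB// E1 E2].
Qed.

Lemma mild_dom z0 g t : dom A' z0 -> regular g -> dom A' (mild z0 g t) /\
  A' (mild z0 g t) = mild (A' z0) (A' \o g) t.
Proof.
move=> D rg; have [Dp Ep] := mild_primitive_dom t rg.
have Ds := real_subspaceD rD D Dp.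
by have [D1 ->] := generator_group sS' gS' (- t) Ds; rewrite AD// Ep.
Qed.

Lemma is_derive_mild_primitive g (t : R) : continuous g -> -1 < t ->
  is_derive t (1 : R) (mild_primitive g) (S' t (g t)).
Proof.
move=> cg t1; have cf := pulled_back_continuous cg.
have h := is_deriveB (is_derive_wint cf t1)
  (is_derive_cst (wint (-1) 0 (fun s => S' s (g s))) t (1 : R)).
by apply: (is_derive_eq h); rewrite subr0.
Qed.

Lemma mild_continuous_at z0 g (t : R) : continuous g -> -1 < t -> {for t, continuous (mild z0 g)}.
Proof.
move=> cg t1; apply: (group_cvg sS'); first exact: opp_continuous.
apply: cvgD; first exact: cvg_cst.
exact: is_derive_continuous (is_derive_mild_primitive cg t1).
Qed.

Lemma mild_continuous z0 g T : continuous g -> {within `[0, T], continuous (mild z0 g)}.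
Proof.
move=> cg; apply: continuous_at_within => x /andP[x0 _].
by apply: mild_continuous_at => //; apply: lt_le_trans x0; rewrite ltrN10.
Qed.

Lemma is_derive_mild z0 g (t : R) : dom A' z0 -> regular g -> -1 < t ->
  is_derive t (1 : R) (mild z0 g) (g t - A' (mild z0 g t)).
Proof.
move=> D rg t1; have [Dg cg cAg] := rg; have [Dp Ep] := mild_primitive_dom t rg.
have Ds := real_subspaceD rD D Dp.
have h1 : is_derive t (1 : R) (fun t => z0 + mild_primitive g t) (S' t (g t)).
  have h := is_deriveD (is_derive_cst z0 t (1 : R)) (is_derive_mild_primitive cg t1).
  by apply: (is_derive_eq h); rewrite add0r.
have h := group_product_derive sS' gS' h1 Ds.
apply: (is_derive_eq h); rewrite (groupVK sS'); congr (_ - _).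
by have [_ ->] := generator_group sS' gS' (- t) Ds.
Qed.

Lemma mild_bound (T : R) : 0 <= T -> exists2 C : R, 0 < C & forall z0 g t, continuous g ->
  0 <= t <= T -> `|mild z0 g t| <= C * (`|z0| + itg 0 T (fun s => `|g s|)).
Proof.
move=> T0; have [M M1 hM] := group_local_bound sS' T.
have M0 : 0 < M by apply: lt_le_trans M1.
exists (M * M) => [|z0 g t cg /andP[t0 tT]]; first by rewrite mulr_gt0.
have cf := pulled_back_continuous cg.
have ig a b : itgb a b (fun s => `|g s|).
  by apply: itgb_continuous; exact: continuous_normr_fun.
rewrite /mild mild_primitive_ge0// -mulrA.
apply: le_trans (hM _ _ _) _; first by rewrite normrN ger0_norm.
rewrite ler_pM2l//; apply: le_trans (ler_normD _ _) _; rewrite mulrDr; apply: lerD.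
  by rewrite ler_peMl.
apply: le_trans (wint_norm_le _ _ cf) _.
apply: (@le_trans _ _ (itg 0 t (fun s => M * `|g s|))).
  apply: le_itg.
  - by apply: itgb_continuous; exact: continuous_normr_fun.
  - exact: itgbZ.
  move=> s /andP[s0 st]; apply: hM; rewrite gtr0_norm//.
  by apply: ltW; apply: lt_le_trans tT.
rewrite itgZ// ler_pM2l// (itg_chasles t0 tT)// lerDl.
by apply: itg_ge0.
Qed.

Lemma mildB z0 z1 g0 g1 t : continuous g0 -> continuous g1 ->
  mild (z0 - z1) (fun s => g0 s - g1 s) t = mild z0 g0 t - mild z1 g1 t.
Proof.
move=> c0 c1; have cf := pulled_back_continuous.
have e : mild_primitive (fun s => g0 s - g1 s) t = mild_primitive g0 t - mild_primitive g1 t.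
  rewrite /mild_primitive.
  have -> : (fun s => S' s (g0 s - g1 s)) = (fun s => S' s (g0 s) - S' s (g1 s)).
    by apply/funext => s; rewrite klinearB//; exact: (group_klinear sS').
  by rewrite !(wintB _ _ (cf _ c0) (cf _ c1)) subr_exchange.
rewrite /mild -klinearB; last exact: (group_klinear sS').
by rewrite e [in RHS]opprD [in RHS]addrACA.
Qed.

Lemma mild_clamp_continuous z0 g T : 0 <= T -> dom A' z0 -> regular g ->
  [/\ continuous (mild z0 g \o clamp 0 T), continuous (A' \o (mild z0 g \o clamp 0 T)) &
   continuous (Bs \o (mild z0 g \o clamp 0 T))].
Proof.
move=> T0 D rg; have [Dg cg cAg] := rg.
have c1 : continuous (mild z0 g \o clamp 0 T).
  by apply: clamp_continuous => //; exact: mild_continuous.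
have c2 : continuous (A' \o (mild z0 g \o clamp 0 T)).
  have -> : A' \o (mild z0 g \o clamp 0 T) = mild (A' z0) (A' \o g) \o clamp 0 T.
    by apply/funext => t; exact: (mild_dom _ D rg).2.
  exact: (clamp_continuous T0 (@mild_continuous (A' z0) (A' \o g) T cAg)).
split => //; apply: (control_adjoint_continuous hS hA hB) => // t.
exact: (mild_dom _ D rg).1.
Qed.

Lemma mild_trace_L2 z0 g T : 0 <= T -> dom A' z0 -> regular g -> L2 0 T (Bs \o mild z0 g).
Proof.
move=> T0 D rg; have [_ _ cB] := mild_clamp_continuous T0 D rg.
apply: eq_L2 (L2_continuous 0 T cB) => t /andP[t0 tT].
by rewrite /= clamp_id// !ltW.
Qed.

(** An energy estimate: by the Lyapunov identity the derivative of <Q z, z> is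
  2 l <Q z, z> + 2 <Q z, g> - |B^* z|^2.  Integration bounds the norm of B^* z in L^2 by
  the supremum of |z| and the norm of g in L^1. *)
Lemma mild_trace_bound (Q : H -> H) (l T : R) : 0 <= T -> bounded_operator Q ->
  (forall x y, ip (Q x) y = ip x (Q y)) ->
  (forall phi, dom A' phi -> ip (Q (A' phi)) phi + ip (Q phi) (A' phi) +
    2 * l * ip (Q phi) phi = ip (Bs phi) (Bs phi)) ->
  exists2 C : R, 0 <= C & forall z0 g, dom A' z0 -> regular g ->
    sqn 0 T (Bs \o mild z0 g) <= C * (`|z0| + itg 0 T (fun s => `|g s|)) ^+ 2.
Proof.
move=> T0 bQ sQ lyap.
have combine (x y z u v a b c : R) : y + z - x = u - v -> y <= b -> z <= c ->
    - u <= a -> v <= a -> x <= 2 * a + b + c by lra.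
have [q q0 hq] := bounded_operator_bound bQ.
have [C C0 hC] := mild_bound T0.
exists (2 * q * C ^+ 2 + 2 * `|l| * (q * C ^+ 2) * T + 2 * (q * C)).
  have l0 := normr_ge0 l; have C2 := sqr_ge0 C.
  by rewrite !addr_ge0 ?mulr_ge0// ltW.
move=> z0 g D rg; have [Dg cg cAg] := rg.
have [c1 c2 c3] := mild_clamp_continuous T0 D rg.
set N := `|z0| + _; pose m := mild z0 g \o clamp 0 T.
have G0 : 0 <= itg 0 T (fun s => `|g s|) by apply: itg_ge0.
have N0 : 0 <= N by rewrite addr_ge0.
have mE t : 0 <= t <= T -> m t = mild z0 g t by move=> tT; rewrite /m /= clamp_id.
have mN t : `|m t| <= C * N by apply: hC => //; exact: clamp_itv.
have Dm t : dom A' (m t) by exact: (mild_dom _ D rg).1.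
have cQm : continuous (Q \o m).
  by move=> t; exact: (bounded_operator_cvg bQ (c1 t)).
have Qm x : `|Q (m x)| <= q * (C * N).
  by apply: le_trans (hq _) _; rewrite ler_pM2l.
have E2 t : `|ip (Q (m t)) (m t)| <= q * (C * N) * (C * N).
  by apply: le_trans (ip_CS _ _) _; exact: ler_pM.
have cE : continuous (fun t => ip (Q (m t)) (m t)) by exact: continuous_ip.
have cQg : continuous (fun t => ip (Q (m t)) (g t)) by exact: continuous_ip.
have cB2 : continuous (fun t => ip (Bs (m t)) (Bs (m t))) by exact: continuous_ip.
pose f1 t := 2 * l * ip (Q (m t)) (m t); pose f2 t := 2 * ip (Q (m t)) (g t).
have i0 : itgb 0 T (fun t => ip (Q (m t)) (m t)) by exact: itgb_continuous.
have i0' : itgb 0 T (fun t => ip (Q (m t)) (g t)) by exact: itgb_continuous.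
have i1 : itgb 0 T f1 by exact: itgbZ.
have i2 : itgb 0 T f2 by exact: itgbZ.
have i12 : itgb 0 T (fun t => f1 t + f2 t) by exact: itgbD.
have i3 : itgb 0 T (fun t => ip (Bs (m t)) (Bs (m t))) by exact: itgb_continuous.
have ftc : itg 0 T (fun t => (f1 t + f2 t) - ip (Bs (m t)) (Bs (m t))) =
    ip (Q (m T)) (m T) - ip (Q (m 0)) (m 0).
  apply: (@itg_FTC2 _ (fun t => ip (Q (m t)) (m t))) => //.
  - exact: continuous_within_itv.
  - apply: continuous_within_itv => t; apply: cvgB (cB2 t).
    by apply: cvgD; (apply: cvgM; first exact: cvg_cst); [exact: cE|exact: cQg].
  move=> t /andP[t0 tT].
  apply: (@is_derive_near _ _ _ (fun t => ip (Q (mild z0 g t)) (mild z0 g t))).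
    exists (Num.min t (T - t)) => [|h]; first by rewrite lt_min t0 subr_gt0.
    rewrite lt_min !ltr_norml => /andP[/andP[h1 h2] /andP[h3 h4]].
    by rewrite mE//; apply/andP; split; lra.
  have t1 : -1 < t by apply: lt_trans t0; rewrite ltrN10.
  have dm := is_derive_mild D rg t1.
  have dE := is_derive_ip (is_derive_operator bQ dm) dm.
  apply: (is_derive_eq dE); rewrite /f1 /f2 /= mE ?ltW//.
  have := lyap _ (mild_dom t D rg).1; set z := mild z0 g t => ly.
  rewrite -ly klinearB ?ipBl ?ipBr; last by case: bQ.
  have -> : ip (Q (g t)) z = ip (Q z) (g t) by rewrite sQ ipC.
  ring.
have e1 : sqn 0 T (Bs \o mild z0 g) = itg 0 T (fun t => ip (Bs (m t)) (Bs (m t))).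
  by apply: eq_itg => t /andP[t0 tT]; rewrite ip_norm mE// !ltW.
move: ftc; rewrite itgB// itgD// => ftc.
rewrite e1.
have b1 : `|itg 0 T f1| <= 2 * `|l| * (q * (C * N) * (C * N)) * (T - 0).
  apply: norm_itg_le => // t _; rewrite /f1 normrM normrM ger0_norm//.
  by apply: ler_wpM2l => //; rewrite mulr_ge0.
have b2 : itg 0 T f2 <= 2 * (q * (C * N)) * itg 0 T (fun s => `|g s|).
  have ig : itgb 0 T (fun s => `|g s|).
    by apply: itgb_continuous; exact: continuous_normr_fun.
  rewrite -itgZ//; apply: le_itg => //; first exact: itgbZ.
  move=> t _; rewrite /f2 -mulrA ler_pM2l//.
  by apply: le_trans (ip_le _ _) _; exact: ler_wpM2r.
have b3 : 2 * (q * (C * N)) * itg 0 T (fun s => `|g s|) <= 2 * (q * (C * N)) * N.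
  by apply: ler_wpM2l; [rewrite !mulr_ge0// ltW|rewrite lerDr].
have -> : (2 * q * C ^+ 2 + 2 * `|l| * (q * C ^+ 2) * T + 2 * (q * C)) * N ^+ 2 =
  2 * (q * (C * N) * (C * N)) + 2 * `|l| * (q * (C * N) * (C * N)) * T +
  2 * (q * (C * N)) * N by ring.
rewrite subr0 in b1; apply: (combine _ _ _ _ _ _ _ _ ftc).
- exact: le_trans (ler_norm _) b1.
- exact: le_trans b2 b3.
- by apply: le_trans (ler_norm _) _; rewrite normrN; exact: E2.
- exact: le_trans (ler_norm _) (E2 _).
Qed.

Lemma dual_solution_mild (T : R) z0 g z : 0 <= T -> continuous g ->
  dual_solution S T z0 g z -> forall t, 0 <= t <= T -> z t = mild z0 g t.
Proof.
move=> T0 cg [_ hz] t /andP[t0 tT].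
have := hz t; rewrite t0 tT => /(_ isT) h.
apply: (addIr (- S' (- t) z0)); apply: ip_inj => x.
rewrite ipC; have [_ ->] := bochner_ip x h.
rewrite /mild klinearD; last exact: (group_klinear sS').
rewrite [S' (- t) z0 + _]addrC addrK mild_primitive_ge0//.
have cf := pulled_back_continuous cg.
rewrite (wint_operator _ _ (group_bounded sS' (- t)) cf) wint_ip; last first.
  by move=> s; exact: (bounded_operator_cvg (group_bounded sS' (- t)) (cf s)).
by apply: eq_itg => s _; rewrite ipC /= -(groupD sS') opprB addrC.
Qed.

Lemma eq_dual_solution (T : R) z0 g g' z : (forall t, 0 <= t <= T -> g t = g' t) ->
  dual_solution S T z0 g z -> dual_solution S T z0 g' z.
Proof.
move=> gg' [cz bz]; split => // t /andP[t0 tT].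
have := bz t; rewrite t0 tT => /(_ isT) [[s s1 s2] [s' [s3 s4 s5]]].
have eqg r : `]0, t[%classic r -> g r = g' r.
  rewrite /= in_itv /= => /andP[r0 rt]; apply: gg'.
  by rewrite (ltW r0) (le_trans (ltW rt) tT).
split; first by exists s => // r rt; rewrite -eqg//; exact: s2.
exists s'; split => //.
apply: cvg_trans s4; apply: near_eq_cvg; near=> n.
by apply: eq_integral => r /set_mem rt; rewrite eqg.
Unshelve. all: by end_near. Qed.

Lemma continuous_graph_clamp (T : R) g : 0 <= T -> continuous_graph A T g ->
  regular (g \o clamp 0 T).
Proof.
move=> T0 [Dg cg cAg]; split => [t||].
- by apply: Dg; exact: clamp_itv.
- exact: clamp_continuous.
- exact: (clamp_continuous T0 cAg).
Qed.

End Mild.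

(** * The trace extension *)

Section TraceExtension.
Context {R : realType} {k : scalar_kind} {H U : hilbertType R k}.
Variables (S : R -> H -> H) (A : operator H) (B : U -> H -> scalar_field R k).
Hypotheses (hS : strongly_continuous_group S) (hA : generator S A).
Hypothesis (hB : bounded_to_dual (adjoint A) B).
Local Notation mu := (@lebesgue_measure R).
Local Notation S' := (adjoint_group S).
Local Notation A' := (adjoint A).
Local Notation Bs := (control_adjoint B).
Local Notation sS' := (adjoint_strongly_continuous hS hA).
Local Notation gS' := (adjoint_generator hS hA).
Local Notation regular := (regular_curve A').
Local Notation mild := (mild S).
Variables (T C : R).
Hypotheses (T0 : 0 < T) (C0 : 0 <= C).
Hypothesis bound : forall z0 g, dom A' z0 -> regular g ->
  sqn 0 T (Bs \o mild z0 g) <= C * (`|z0| + itg 0 T (fun s => `|g s|)) ^+ 2.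

Let smr g : regular g -> sm `]0, T[ g.
Proof. by move=> [_ c _]; exact: sm_continuous. Qed.

Let i1B (h1 h2 : R -> H) : Lp_class 1 T h1 -> Lp_class 1 T h2 -> itgb 0 T (fun t => `|h1 t - h2 t|).
Proof.
move=> /Lp_class1P[s1 i1] /Lp_class1P[s2 i2].
apply: (itgb_dominated _ (itgbD i1 i2)) => [|t _]; first by apply: sm_norm; exact: smB.
by rewrite normr_id; exact: ler_normB.
Qed.

Let L1r g : regular g -> Lp_class 1 T g.
Proof.
move=> rg; apply/Lp_class1P; split; first exact: smr.
by apply: itgb_continuous; apply: continuous_normr_fun; case: rg.
Qed.

Definition L1_dist (h1 h2 : R -> H) : R := itg 0 T (fun t => `|h1 t - h2 t|).
Local Notation distance := L1_dist.

Let distance_triangle h1 h2 h3 : Lp_class 1 T h1 -> Lp_class 1 T h2 -> Lp_class 1 T h3 ->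
  distance h1 h3 <= distance h1 h2 + distance h2 h3.
Proof.
move=> l1 l2 l3; rewrite /L1_dist -itgD; [|exact: i1B|exact: i1B].
apply: le_itg; [exact: i1B|by apply: itgbD; exact: i1B|move=> t _].
by rewrite -(subrKA (h2 t)) ler_normD.
Qed.

Let distanceC h1 h2 : distance h1 h2 = distance h2 h1.
Proof. by apply: eq_itg => t _; rewrite distrC. Qed.

Let distance_ge0 h1 h2 : 0 <= distance h1 h2.
Proof. exact: itg_ge0. Qed.

Let L2t z g : dom A' z -> regular g -> L2 0 T (Bs \o mild z g).
Proof. by move=> D rg; exact: (mild_trace_L2 hS hA hB (ltW T0)). Qed.

Lemma mild_trace_lipschitz z1 z2 g1 g2 : dom A' z1 -> dom A' z2 -> regular g1 -> regular g2 ->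
  sqn 0 T (fun t => Bs (mild z1 g1 t) - Bs (mild z2 g2 t)) <=
  C * (`|z1 - z2| + distance g1 g2) ^+ 2.
Proof.
move=> D1 D2 r1 r2.
have rD := subspace_real (generator_subspace sS' gS').
have [_ c1 _] := r1; have [_ c2 _] := r2.
apply: le_trans (bound (real_subspaceB rD D1 D2) (regular_curveB sS' gS' r1 r2)).
rewrite le_eqVlt; apply/orP; left; apply/eqP; apply: eq_itg => t _ /=.
rewrite (mildB hS hA)// (control_adjointB hS hA hB)//.
  by have [] := mild_dom hS hA t D1 r1.
by have [] := mild_dom hS hA t D2 r2.
Qed.

(** Approximate (z0, h) by regular data at the geometric rate that [riesz_fischer] needs. *)
Lemma trace_limit z0 h : Lp_class 1 T h -> exists f, L2 0 T f /\
  forall e : R, 0 < e -> exists z1 g1, [/\ dom A' z1, regular g1,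
    `|z1 - z0| < e, distance g1 h < e & sqn 0 T (fun t => f t - Bs (mild z1 g1 t)) < e].
Proof.
move=> Lh; have /Lp_class1P[sh ih] := Lh.
have q0 n : 0 < (10^-1 : R) ^+ n by rewrite exprn_gt0// invr_gt0.
have ex n : exists zg : H * (R -> H), [/\ dom A' zg.1, regular zg.2,
    `|zg.1 - z0| < 10^-1 ^+ n & distance zg.2 h < 10^-1 ^+ n].
  have [z Dz hz] := adjoint_dense hS hA z0 (q0 n).
  have [g [rg _ hg]] := regular_dense_L1 sS' gS' (adjoint_dense hS hA) sh ih (q0 n).
  exists (z, g); split; [exact: Dz|exact: rg|by rewrite distrC|by rewrite distanceC].
pose zg n := projT1 (cid (ex n)).
have Dz n : dom A' (zg n).1 by have [] := projT2 (cid (ex n)).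
have rg n : regular (zg n).2 by have [] := projT2 (cid (ex n)).
have hz n : `|(zg n).1 - z0| < 10^-1 ^+ n by have [] := projT2 (cid (ex n)).
have hg n : distance (zg n).2 h < 10^-1 ^+ n by have [] := projT2 (cid (ex n)).
pose F n := Bs \o mild (zg n).1 (zg n).2.
have qS n : (10^-1 : R) ^+ n.+1 <= 10^-1 ^+ n.
  by rewrite exprS ler_piMl ?(ltW (q0 n))// invf_le1// ler1n.
have qq n : ((10^-1 : R) ^+ n) ^+ 2 = 100^-1 ^+ n.
  by rewrite exprAC; congr (_ ^+ _); field.
have dF n : sqn 0 T (fun t => F n.+1 t - F n t) <= C * 16 * 100^-1 ^+ n.
  apply: le_trans (mild_trace_lipschitz (Dz n.+1) (Dz n) (rg n.+1) (rg n)) _.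
  rewrite -mulrA; apply: ler_wpM2l => //.
  have -> : 16 * 100^-1 ^+ n = (4 * (10^-1 : R) ^+ n) ^+ 2 by rewrite exprMn qq; congr (_ * _); ring.
  rewrite ler_pXn2r ?nnegrE ?addr_ge0 ?mulr_ge0 ?(ltW (q0 n))//.
  have h1 := ler_normD ((zg n.+1).1 - z0) (z0 - (zg n).1).
  rewrite subrKA [`|z0 - _|]distrC in h1.
  have h2 := distance_triangle (L1r (rg n.+1)) Lh (L1r (rg n)).
  rewrite [distance h _]distanceC in h2.
  have := hz n; have := hz n.+1; have := hg n; have := hg n.+1; have := qS n.
  move: h1 h2; set x := `|(zg n.+1).1 - (zg n).1|; set y := distance _ (zg n).2.
  by lra.
have C16 : 0 <= C * 16 by rewrite mulr_ge0.
have [f [Lf hf]] := riesz_fischer C16 (fun n => L2t (Dz n) (rg n)) dF.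
exists f; split => // e e0.
pose K := C * 16 * (100 / 81); have K0 : 0 <= K by rewrite !mulr_ge0// invr_ge0.
have eK : 0 < e / (K + 1) by rewrite divr_gt0// ltr_wpDl.
have [n hn] := harmonic_lt eK; have {hn} := hn n (leqnn n) => hn.
have qe : (10^-1 : R) ^+ n < e / (K + 1) := le_lt_trans (geometric_le_harmonic n) hn.
have qe' : (10^-1 : R) ^+ n < e.
  by apply: lt_le_trans qe _; rewrite ler_pdivrMr ?ltr_wpDl// ler_peMr ?(ltW e0)// lerDr.
exists (zg n).1, (zg n).2; split => //.
- exact: lt_trans (hz n) qe'.
- exact: lt_trans (hg n) qe'.
apply: le_lt_trans (hf n) _; rewrite mulrAC -/K.
move: qe; rewrite ltr_pdivlMr ?ltr_wpDl// => qe; apply: le_lt_trans qe.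
have q1 : (100^-1 : R) ^+ n <= 10^-1 ^+ n.
  by rewrite -qq expr2 ler_piMl ?(ltW (q0 n))// exprn_ile1// ?invr_ge0// invf_le1// ler1n.
apply: (@le_trans _ _ (K * 10^-1 ^+ n)); first exact: ler_wpM2l.
by rewrite mulrC; apply: ler_wpM2l; rewrite ?lerDl// ltW.
Qed.

Let limit_lipschitz z0 h z1 h1 f f1 : Lp_class 1 T h -> Lp_class 1 T h1 ->
  L2 0 T f -> L2 0 T f1 ->
  (forall e : R, 0 < e -> exists z1 g1, [/\ dom A' z1, regular g1,
    `|z1 - z0| < e, distance g1 h < e & sqn 0 T (fun t => f t - Bs (mild z1 g1 t)) < e]) ->
  (forall e : R, 0 < e -> exists z2 g1, [/\ dom A' z2, regular g1,
    `|z2 - z1| < e, distance g1 h1 < e & sqn 0 T (fun t => f1 t - Bs (mild z2 g1 t)) < e]) ->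
  forall e d : R, 0 < e -> `|z1 - z0| < d -> distance h1 h < d ->
  sqn 0 T (fun t => f1 t - f t) <= 8 * e + 2 * (C * (2 * d + 4 * e) ^+ 2).
Proof.
move=> Lh Lh1 Lf Lf1 hf hf1 e d e0 zd hd.
have d0 : 0 <= d by apply: le_trans (ltW zd).
have dist_le (x p q r a y u v w b : R) : x <= p + q -> q <= r + a -> y <= u + v ->
  v <= w + b -> p < e -> a < e -> u < e -> b < e -> r < d -> w < d ->
  x + y <= 2 * d + 4 * e by lra.
have sum_le (a p q b c c' : R) : a <= 2 * p + 2 * q -> p < e -> q < e -> b <= c ->
  c <= c' -> 2 * a + 2 * b <= 8 * e + 2 * c' by lra.
have [y0 [g0 [D0 r0 a0 b0 c0]]] := hf e e0.
have [y1 [g1 [D1 r1 a1 b1 c1]]] := hf1 e e0.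
have LF0 := L2t D0 r0; have LF1 := L2t D1 r1.
have L0 : L2 0 T (fun t => f t - Bs (mild y0 g0 t)) by exact: (L2B Lf LF0).
have L1 : L2 0 T (fun t => f1 t - Bs (mild y1 g1 t)) by exact: (L2B Lf1 LF1).
have L01 := L2B L1 L0; have L10 := L2B LF1 LF0.
have -> : sqn 0 T (fun t => f1 t - f t) = sqn 0 T (fun t =>
    ((f1 t - Bs (mild y1 g1 t)) - (f t - Bs (mild y0 g0 t))) +
    (Bs (mild y1 g1 t) - Bs (mild y0 g0 t))).
  apply: eq_itg => t _; congr (`|_| ^+ 2).
  by rewrite subr_exchange subrK.
apply: le_trans (sqnD_le L01 L10) _.
have s1 := sqnB_le L1 L0.
have s2 := mild_trace_lipschitz D1 D0 r1 r0.
have s3 : C * (`|y1 - y0| + distance g1 g0) ^+ 2 <= C * (2 * d + 4 * e) ^+ 2.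
  apply: ler_wpM2l => //; rewrite ler_pXn2r ?nnegrE ?addr_ge0//.
  - have h2 := ler_normD (y1 - z1) (z1 - y0); rewrite subrKA in h2.
    have h3 := ler_normD (z1 - z0) (z0 - y0); rewrite subrKA [`|z0 - _|]distrC in h3.
    have h4 := distance_triangle (L1r r1) Lh1 (L1r r0).
    have h5 := distance_triangle Lh1 Lh (L1r r0); rewrite [distance h _]distanceC in h5.
    exact: (dist_le _ _ _ _ _ _ _ _ _ _ h2 h3 h4 h5 a1 a0 b1 b0 zd hd).
  - by rewrite mulr_ge0.
  - by rewrite mulr_ge0// ltW.
exact: (sum_le _ _ _ _ _ _ s1 c1 c0 s2 s3).
Qed.

(** The value at (z0, h) is chosen among the limits of [trace_limit].  All the required
  properties follow from the approximation property of such limits. *)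
Lemma trace_extension_exists : exists E, trace_extension S A B T E.
Proof.
have sqr_sum_le (p q e : R) : 0 <= p -> 0 <= q -> p < e -> q < e -> e <= 1 ->
    (p + q) ^+ 2 <= 4 * e.
  move=> p0 q0 pe qe e1; have e0 : 0 <= e by exact: le_trans (ltW pe).
  apply: (@le_trans _ _ ((2 * e) ^+ 2)).
    by rewrite ler_pXn2r ?nnegrE ?addr_ge0 ?mulr_ge0//; lra.
  have : e ^+ 2 <= e by rewrite expr2 ler_piMl.
  by rewrite exprMn; lra.
have combine (a b e1 e : R) : a < e1 -> b <= C * (4 * e1) ->
    e1 * (2 * (1 + 4 * C)) <= e -> 2 * a + 2 * b <= e by lra.
pose E z0 h := if pselect (Lp_class 1 T h) is left Lh
  then projT1 (cid (trace_limit z0 Lh)) else (fun=> 0).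
have EP z0 h : Lp_class 1 T h -> L2 0 T (E z0 h) /\ forall e : R, 0 < e ->
    exists z1 g1, [/\ dom A' z1, regular g1, `|z1 - z0| < e, distance g1 h < e &
      sqn 0 T (fun t => E z0 h t - Bs (mild z1 g1 t)) < e].
  move=> Lh; rewrite /E; case: pselect => // Lh'; exact: (projT2 (cid (trace_limit z0 Lh'))).
exists E; split.
- by move=> z0 h Lh; apply/Lp_class2P; have [] := EP z0 h Lh.
- move=> z0 h Lh eps eps0.
  pose d := eps / (12 * (C + 1)).
  have C1 : 0 < C + 1 by rewrite ltr_wpDl.
  have d0 : 0 < d by rewrite divr_gt0// mulr_gt0.
  exists d => // z1 h1 Lh1 zd hd.
  have [Lf hf] := EP z0 h Lh; have [Lf1 hf1] := EP z1 h1 Lh1.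
  have [_ is_] := L2B Lf1 Lf.
  rewrite integral_itg// lte_fin; move: hd; rewrite integral_itg ?lte_fin; last exact: i1B.
  move=> hd; pose e := Num.min (d / 4) (eps ^+ 2 / 32).
  have eps2 : 0 < eps ^+ 2 by rewrite exprn_gt0.
  have e0 : 0 < e by rewrite lt_min; apply/andP; split; exact: divr_gt0.
  apply: le_lt_trans (limit_lipschitz Lh Lh1 Lf Lf1 hf hf1 e0 zd hd) _.
  have e1 : 4 * e <= d.
    have : e <= d / 4 by rewrite ge_min lexx.
    by lra.
  have e2 : 8 * e <= eps ^+ 2 / 4.
    have : e <= eps ^+ 2 / 32 by rewrite ge_min lexx orbT.
    lra.
  have e3 : C * (2 * d + 4 * e) ^+ 2 <= C * (3 * d) ^+ 2.
    have a1 : 0 <= 2 * d + 4 * e by apply: addr_ge0; apply: mulr_ge0 => //; exact: ltW.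
    have a2 : 2 * d + 4 * e <= 3 * d by lra.
    by apply: ler_wpM2l => //; rewrite ler_pXn2r ?nnegrE// (le_trans a1).
  have e4 : C * (3 * d) ^+ 2 <= eps ^+ 2 / 16.
    have -> : C * (3 * d) ^+ 2 = C / (C + 1) ^+ 2 * (eps ^+ 2 / 16).
      by rewrite /d; field; rewrite gt_eqF.
    rewrite ler_piMl ?divr_ge0 ?sqr_ge0// ler_pdivrMr ?exprn_gt0// mul1r.
    by have := sqr_ge0 C; rewrite expr2 sqrrD expr2; lra.
  by move: eps2 e2 (le_trans e3 e4); lra.
move=> z0 g z D0 gg hz.
have rg := continuous_graph_clamp (ltW T0) gg; set g' := g \o clamp 0 T in rg.
have gE t : 0 <= t <= T -> g' t = g t by move=> tT; rewrite /g' /= clamp_id.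
have Lg : Lp_class 1 T g.
  have [_ cg _] := gg; apply/Lp_class1P; split; first exact: sm_within (ltW T0) cg.
  by apply: itgb_within => x; apply: continuous_comp; [exact: cg|exact: norm_continuous].
have dg h : distance h g' = distance h g.
  by apply: eq_itg => t /andP[t0 tT]; rewrite gE// !ltW.
have hz' : dual_solution S T z0 g' z.
  by apply: eq_dual_solution hz => t tT; rewrite gE.
have zE t : 0 <= t <= T -> z t = mild z0 g' t.
  by apply: (dual_solution_mild hS hA (ltW T0)) => //; case: rg.
have [LE hE] := EP z0 g Lg; have LF := L2t D0 rg.
suff s0 : sqn 0 T (fun t => E z0 g t - (Bs \o mild z0 g') t) = 0.
  have [N [mN N0 sN]] := sqn_eq0_ae LE LF s0; exists N; split => // t nt; apply: sN => h.
  apply: nt => tT.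
  rewrite h//= zE//; move: tT; rewrite in_itv /= => /andP[t0 t1].
  by rewrite !ltW.
apply/eqP; rewrite eq_le sqn_ge0 andbT; apply/ler_addgt0Pr => e e0; rewrite add0r.
have K1 : 0 < 2 * (1 + 4 * C) by rewrite mulr_gt0// ltr_wpDr// mulr_ge0.
pose e1 := Num.min 1 (e / (2 * (1 + 4 * C))).
have e10 : 0 < e1 by rewrite lt_min ltr01 divr_gt0.
have e11 : e1 <= 1 by rewrite ge_min lexx.
have e12 : e1 * (2 * (1 + 4 * C)) <= e.
  by rewrite -ler_pdivlMr// ge_min lexx orbT.
have [y [g1 [D1 r1 a1 b1 c1]]] := hE e1 e10.
have LF1 := L2t D1 r1.
have La := L2B LE LF1; have Lb := L2B LF1 LF.
have -> : sqn 0 T (fun t => E z0 g t - (Bs \o mild z0 g') t) = sqn 0 T (fun t =>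
    (E z0 g t - Bs (mild y g1 t)) + (Bs (mild y g1 t) - Bs (mild z0 g' t))).
  by apply: eq_itg => t _; rewrite subrKA.
apply: le_trans (sqnD_le La Lb) _.
have s2 := mild_trace_lipschitz D1 D0 r1 rg.
have s3 : (`|y - z0| + distance g1 g') ^+ 2 <= 4 * e1.
  by apply: sqr_sum_le => //; rewrite dg.
have s4 := ler_wpM2l C0 s3.
exact: (combine _ _ _ _ c1 (le_trans s2 s4) e12).
Qed.

End TraceExtension.

(** * The closed-loop system *)

Section ClosedLoop.
Context {R : realType} {k : scalar_kind} {H U : hilbertType R k}.
Variables (S : R -> H -> H) (A : operator H) (B : U -> H -> scalar_field R k).
Hypotheses (hS : strongly_continuous_group S) (hA : generator S A).
Hypothesis (hB : bounded_to_dual (adjoint A) B).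
Local Notation mu := (@lebesgue_measure R).
Local Notation S' := (adjoint_group S).
Local Notation A' := (adjoint A).
Local Notation Bs := (control_adjoint B).
Local Notation sS' := (adjoint_strongly_continuous hS hA).
Local Notation gS' := (adjoint_generator hS hA).
Variable l : R.
Hypothesis l0 : 0 <= l.

(** The solution of z' = - A^* z - 2 l z. *)
Definition damped z0 t := expR (- (2 * l) * t) *: S' (- t) z0.

Lemma is_derive_expR_linear (a t : R) :
  is_derive t (1 : R) (fun s => expR (a * s)) (a * expR (a * t)).
Proof.
have -> : (fun s : R => expR (a * s)) = (fun s => expR (a * s + 0)).
  by apply/funext => s; rewrite addr0.
by apply: is_derive_affine; rewrite addr0; exact: is_derive_expR.
Qed.

Lemma expR_linear_continuous (a : R) : continuous (fun s : R => expR (a * s)).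
Proof. by move=> t; exact: is_derive_continuous (is_derive_expR_linear a t). Qed.

Lemma damped_continuous z0 : continuous (damped z0).
Proof.
move=> t; apply: cvgZ; first exact: expR_linear_continuous.
by apply: (group_cvg sS'); [exact: opp_continuous|exact: cvg_cst].
Qed.

Lemma damped0 z0 : damped z0 0 = z0.
Proof. by rewrite /damped mulr0 expR0 scale1r oppr0 (group0 sS'). Qed.

Lemma damped_bound (T : R) : exists2 K : R, 0 < K & forall z0 t, 0 <= t <= T ->
  `|damped z0 t| <= K * `|z0|.
Proof.
have [M M1 hM] := group_local_bound sS' T.
exists M => [|z0 t /andP[t0 tT]]; first by apply: lt_le_trans M1.
rewrite /damped normrZ ger0_norm ?expR_ge0//.
apply: (@le_trans _ _ (1 * `|S' (- t) z0|)).
  apply: ler_wpM2r => //; rewrite expR_le1 mulNr oppr_le0.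
  by rewrite mulr_ge0// mulr_ge0.
by rewrite mul1r; apply: hM; rewrite normrN ger0_norm.
Qed.

Lemma dampedB x y t : damped (x - y) t = damped x t - damped y t.
Proof. by rewrite /damped klinearB ?scalerBr//; exact: (group_klinear sS'). Qed.

Lemma damped_dom z0 t : dom A' z0 ->
  dom A' (damped z0 t) /\ A' (damped z0 t) = damped (A' z0) t.
Proof.
move=> D; have [D1 E1] := generator_group sS' gS' (- t) D.
have := generator_act sS' gS' (expR (- (2 * l) * t) *: 1) D1.
by rewrite !act_real E1.
Qed.

Lemma is_derive_damped z0 (t : R) : dom A' z0 ->
  is_derive t (1 : R) (damped z0) (- A' (damped z0 t) - (2 * l) *: damped z0 t).
Proof.
move=> D; have h1 := group_product_derive sS' gS' (is_derive_cst z0 t (1 : R)) D.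
have h := is_derive_scale (is_derive_expR_linear (- (2 * l)) t) h1.
apply: (is_derive_eq h); rewrite (klinear0 (group_klinear sS' _)) sub0r.
have [_ ->] := damped_dom t D.
by rewrite mulNr scaleNr -scalerA scalerN addrC.
Qed.

Local Notation rhs z := (fun t => - ((2 * l) *: z t)).

Lemma damped_dual_solution (T : R) z0 : dual_solution S T z0 (rhs (damped z0)) (damped z0).
Proof.
split; first by apply: continuous_within_itv; exact: damped_continuous.
move=> t /andP[t0 tT].
pose f s := S' (- (t - s)) (- ((2 * l) *: damped z0 s)).
have cf : continuous f.
  apply: (group_continuous sS').
    by move=> s; apply: cvgN; apply: cvgB; [exact: cvg_cst|exact: cvg_id].
  by move=> s; apply: cvgN; apply: cvgZr; exact: damped_continuous.
apply: bochner_weak.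
- exact: sm_continuous.
- by apply: itgb_continuous; exact: continuous_normr_fun.
move=> x; pose c := ip (S' (- t) z0) x.
have fE s : ip (f s) x = - (2 * l) * expR (- (2 * l) * s) * c.
  rewrite /f -scaleNr /damped scalerA klinearZ; last exact: (group_klinear sS').
  by rewrite -(groupD sS') opprB addrAC subrr sub0r ipZl.
pose F s := expR (- (2 * l) * s) * c.
suff -> : itg 0 t (fun s => ip (f s) x) = F t - F 0.
  by rewrite /F mulr0 expR0 mul1r ipBl /damped ipZl.
apply: (@itg_FTC2 R F) => //.
- apply: continuous_within_itv => s; apply: cvgM; last exact: cvg_cst.
  exact: expR_linear_continuous.
- by apply: continuous_within_itv; apply: continuous_ip => // s; exact: cvg_cst.
move=> s _; have h := is_deriveM (is_derive_expR_linear (- (2 * l)) s) (is_derive_cst c s (1 : R)).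
by apply: (is_derive_eq h); rewrite fE /GRing.scale /= mulr0 add0r mulrC.
Qed.

(** S' t (z t) solves c' = - 2 l c, so that its product with expR (2 * l * t) is constant. *)
Lemma damped_unique (T : R) z0 z : 0 <= T -> dual_solution S T z0 (rhs z) z ->
  forall t, 0 <= t <= T -> z t = damped z0 t.
Proof.
move=> T0 hz; have [cz _] := hz.
pose Z := z \o clamp 0 T; have cZ : continuous Z by exact: clamp_continuous.
have ZE t : 0 <= t <= T -> Z t = z t by move=> tT; rewrite /Z /= clamp_id.
have cg : continuous (rhs Z) by move=> t; apply: cvgN; exact: cvgZr (cZ t).
have hz' : dual_solution S T z0 (rhs Z) z.
  by apply: eq_dual_solution hz => t tT; rewrite ZE.
have zm := dual_solution_mild hS hA T0 cg hz'.
move=> t /andP[t0 tT]; rewrite zm ?t0//.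
rewrite /mild /damped -klinearZ; last exact: (group_klinear sS').
congr (S' _ _); apply: ip_inj => x; rewrite ipZr ![ip x _]ipC.
pose y s := z0 + mild_primitive S (rhs Z) s.
have dy s : 0 <= s <= t -> is_derive s (1 : R) y (- (2 * l) *: y s).
  move=> /andP[s0 st]; have s1 : -1 < s by apply: lt_le_trans s0; rewrite ltrN10.
  have h := is_deriveD (is_derive_cst z0 s (1 : R)) (is_derive_mild_primitive hS hA cg s1).
  apply: (is_derive_eq h); rewrite add0r.
  have sT : 0 <= s <= T by rewrite s0 (le_trans st).
  rewrite ZE// -scaleNr klinearZ; last exact: (group_klinear sS').
  by rewrite zm// /mild (groupKV sS').
have dE s : 0 <= s <= t -> is_derive s (1 : R) (fun s => ip (expR (2 * l * s) *: y s) x) 0.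
  move=> st; have h := is_derive_ipl x (is_derive_scale (is_derive_expR_linear (2 * l) s) (dy s st)).
  apply: (is_derive_eq h); rewrite scalerA -scalerDl ipZl.
  by rewrite mulrN [_ * (2 * l)]mulrC subrr mul0r.
have := @itg_FTC2 R (fun s => ip (expR (2 * l * s) *: y s) x) (fun=> 0) 0 t t0.
rewrite itg_cst// mul0r => ftc.
have {}ftc : ip (expR (2 * l * t) *: y t) x = ip (expR (2 * l * 0) *: y 0) x.
  apply/esym/eqP; rewrite -subr_eq0 -oppr_eq0 opprB; apply/eqP/esym; apply: ftc.
  - by apply: continuous_at_within => s st; exact: is_derive_continuous (dE s st).
  - by apply: continuous_within_itv => s; exact: cvg_cst.
  - by move=> s /andP[s0 st]; apply: dE; rewrite !ltW.
move: ftc; rewrite mulr0 expR0 !ipZl mul1r /y (mild_primitive_ge0 hS hA cg (lexx 0)).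
rewrite wint_refl addr0 => <-.
by rewrite mulrA -expRD mulNr addNr expR0 mul1r.
Qed.

Section WeakSolution.
Variable Q : H -> H.
Hypotheses (bQ : bounded_operator Q) (sQ : forall x y, ip (Q x) y = ip x (Q y)).
Hypothesis lyapunov : forall phi psi, dom A' phi -> dom A' psi ->
  ip (Q (A' phi)) psi + ip (Q phi) (A' psi) + 2 * l * ip (Q phi) psi = ip (Bs phi) (Bs psi).

Lemma test_function_ends (T : R) psi : 0 < T -> test_function T psi -> psi 0 = 0 /\ psi T = 0.
Proof.
move=> T0 [_ [a [b [a0 bT h]]]]; split; apply/eqP; apply: contraT => /h /andP[]; lra.
Qed.

Lemma test_function_derive (T : R) psi (t : R) : test_function T psi ->
  is_derive t (1 : R) psi (derive1 psi t).
Proof. by move=> [h _]; apply: derivable_is_derive; exact: (h 0%N t). Qed.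

Lemma test_function_continuous (T : R) psi : test_function T psi ->
  continuous psi /\ continuous (derive1 psi).
Proof.
move=> tpsi; split=> t; first exact: is_derive_continuous (test_function_derive t tpsi).
have [h _] := tpsi; have := derivable_is_derive (h 1%N t).
by rewrite derive1n1; exact: is_derive_continuous.
Qed.

(** The two sides of the weak formulation for the state Q z and the control - w, moved to
  the left. *)
Definition weak_form (T : R) (psi : R -> R) (phi : H) (z : R -> H) (w : R -> U) : R :=
  itg 0 T (fun t => derive1 psi t * ip (Q (z t)) phi) +
  itg 0 T (fun t => psi t * (ip (Q (z t)) (A' phi) - ip (w t) (Bs phi))).

(** By the Lyapunov identity the integrand is the derivative of psi <Q z, phi>, and psi
  vanishes at both ends. *)
Lemma regular_weak_form (T : R) psi phi z0 : 0 < T -> test_function T psi ->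
  dom A' phi -> dom A' z0 -> weak_form T psi phi (damped z0) (Bs \o damped z0) = 0.
Proof.
move=> T0 tpsi Dphi D; have [cpsi cpsi'] := test_function_continuous tpsi.
have [p0 pT] := test_function_ends T0 tpsi.
have cz := @damped_continuous z0.
have cQ : continuous (fun t => Q (damped z0 t)).
  by move=> t; exact: (bounded_operator_cvg bQ (cz t)).
have cB : continuous (Bs \o damped z0).
  apply: (control_adjoint_continuous hS hA hB) => //.
    by move=> t; have [] := damped_dom t D.
  have -> : A' \o damped z0 = damped (A' z0).
    by apply/funext => t; exact: (damped_dom t D).2.
  exact: damped_continuous.
have cst (X : hilbertType R k) (v : X) : continuous (fun _ : R => v) by move=> t; exact: cvg_cst.
have c1 : continuous (fun t => derive1 psi t * ip (Q (damped z0 t)) phi).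
  by move=> t; apply: cvgM; [exact: cpsi'|exact: (continuous_ip cQ (cst H phi))].
have c2 : continuous (fun t => psi t * (ip (Q (damped z0 t)) (A' phi) - ip (Bs (damped z0 t)) (Bs phi))).
  move=> t; apply: cvgM; first exact: cpsi.
  by apply: cvgB; [exact: (continuous_ip cQ (cst H _))|exact: (continuous_ip cB (cst U _))].
rewrite /weak_form -itgD; [|exact: itgb_continuous|exact: itgb_continuous].
transitivity (psi T * ip (Q (damped z0 T)) phi - psi 0 * ip (Q (damped z0 0)) phi);
  last by rewrite p0 pT !mul0r subrr.
apply: (@itg_FTC2 R (fun t => psi t * ip (Q (damped z0 t)) phi)); first exact: ltW.
- apply: continuous_within_itv => t; apply: cvgM; first exact: cpsi.
  exact: (continuous_ip cQ (cst H phi)).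
- by apply: continuous_within_itv => t; apply: cvgD; [exact: c1|exact: c2].
move=> t _; have dz := is_derive_ipl phi (is_derive_operator bQ (is_derive_damped t D)).
have h := is_deriveM (test_function_derive t tpsi) dz.
apply: (is_derive_eq h); rewrite addrC; congr (_ + _); first exact: mulrC.
apply: (congr1 (fun v => psi t * v)); rewrite -lyapunov//; last by have [] := damped_dom t D.
have [kQ _] := bQ.
rewrite klinearB// klinearZ// ipBl ipZl -[Q (- _)]/(Q (- A' _)) -scaleN1r klinearZ// scaleN1r ipNl.
ring.
Qed.

Lemma damped_weak_form_bound (T : R) psi phi : 0 < T -> test_function T psi ->
  exists2 K : R, 0 < K & forall z0, `|itg 0 T (fun t => derive1 psi t * ip (Q (damped z0 t)) phi) +
    itg 0 T (fun t => psi t * ip (Q (damped z0 t)) (A' phi))| <= K * `|z0|.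
Proof.
move=> T0 tpsi; have [cpsi cpsi'] := test_function_continuous tpsi.
have [q q0 hq] := bounded_operator_bound bQ.
have [M M0 hM] := damped_bound T.
have [p p0 hp] := continuous_bounded_itv 0 T cpsi.
have [p' p'0 hp'] := continuous_bounded_itv 0 T cpsi'.
exists ((p' * (q * M * `|phi|) + p * (q * M * `|A' phi|)) * T + 1) => [|z0].
  by rewrite ltr_wpDl// !mulr_ge0 ?addr_ge0 ?mulr_ge0// ltW.
have cQ : continuous (fun t => Q (damped z0 t)).
  by move=> t; exact: (bounded_operator_cvg bQ (@damped_continuous z0 t)).
have cst (v : H) : continuous (fun _ : R => v) by move=> t; exact: cvg_cst.
have b (f : R -> R) (c : R) (v : H) : continuous f -> (forall t, 0 <= t <= T -> `|f t| <= c) -> 0 <= c ->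
    `|itg 0 T (fun t => f t * ip (Q (damped z0 t)) v)| <= c * (q * M * `|v|) * T * `|z0|.
  move=> cf hf c0.
  have -> : c * (q * M * `|v|) * T * `|z0| = c * (q * (M * `|z0|) * `|v|) * (T - 0) by ring.
  apply: norm_itg_le; first exact: ltW.
    apply: itgb_continuous => t; apply: cvgM; first exact: cf.
    exact: (continuous_ip cQ (cst v)).
  move=> t /andP[t0 tT]; have tT' : 0 <= t <= T by rewrite !ltW.
  rewrite normrM; apply: ler_pM => //; first exact: hf.
  apply: le_trans (ip_CS _ _) _; apply: ler_wpM2r => //.
  by apply: le_trans (hq _) _; rewrite ler_pM2l//; exact: hM.
apply: le_trans (ler_normD _ _) _.
have h1 := b (derive1 psi) p' phi cpsi' hp' (ltW p'0).
have h2 := b psi p (A' phi) cpsi hp (ltW p0).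
apply: le_trans (lerD h1 h2) _.
have -> : p' * (q * M * `|phi|) * T * `|z0| + p * (q * M * `|A' phi|) * T * `|z0| =
  (p' * (q * M * `|phi|) + p * (q * M * `|A' phi|)) * T * `|z0| by ring.
by apply: ler_wpM2r => //; rewrite lerDl.
Qed.

(** A trace extension is continuous, and explicit at the data of damped solutions that
  start in the domain; whichever extension defines it, a trace value is therefore a limit
  of traces B^* z1. *)
Lemma trace_value_limit (T : R) E z0 h w : 0 < T -> trace_extension S A B T E ->
  Lp_class 1 T h -> L2 0 T w -> (forall t, 0 < t < T -> h t = - ((2 * l) *: damped z0 t)) ->
  {ae mu, forall t, t \in `]0, T[ -> w t = E z0 h t} ->
  forall e : R, 0 < e -> exists z1, [/\ dom A' z1, `|z1 - z0| < e,
    L2 0 T (Bs \o damped z1) & sqn 0 T (fun t => Bs (damped z1 t) - w t) < e ^+ 2].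
Proof.
move=> T0 [E1 E2 E3] Lh Lw hE wE e e0.
have [d d0 hd] := E2 z0 h Lh e e0.
have [M M0 hM] := damped_bound T.
have K0 : 0 < 2 * l * M * T + 1 by rewrite ltr_wpDl// !mulr_ge0// ltW.
pose r := Num.min e (Num.min d (d / (2 * l * M * T + 1))).
have r0 : 0 < r by rewrite !lt_min e0 d0 divr_gt0.
have [z1 D1 zz] := adjoint_dense hS hA z0 r0; exists z1.
move: zz; rewrite distrC !lt_min => /and3P[z1e z1d z1K].
have cz1 := @damped_continuous z1.
have cg : continuous_graph A T (rhs (damped z1)).
  have rD := subspace_real (generator_subspace sS' gS').
  split.
  - move=> t _; rewrite -scaleNr; apply: real_subspaceZ => //.
    by have [] := damped_dom t D1.
  - by apply: continuous_within_itv => t; apply: cvgN; exact: cvgZr (cz1 t).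
  have -> : A' \o rhs (damped z1) = (fun t => - ((2 * l) *: damped (A' z1) t)).
    apply/funext => t; have [Dt Et] := damped_dom t D1.
    have [_ h1] := generator_act sS' gS' (- (2 * l) *: 1) Dt.
    by rewrite !act_real !scaleNr Et in h1.
  apply: continuous_within_itv => t; apply: cvgN; apply: cvgZr.
  exact: damped_continuous.
have Lg : Lp_class 1 T (rhs (damped z1)).
  have cr : continuous (rhs (damped z1)) by move=> t; apply: cvgN; exact: cvgZr (cz1 t).
  apply/Lp_class1P; split; first exact: sm_continuous.
  by apply: itgb_continuous; exact: continuous_normr_fun.
have dist : (\int[mu]_(t in `]0%R, T[) `|- ((2 * l) *: damped z1 t) - h t|%:E < d%:E)%E.
  have eqd t : 0 < t < T ->
      `|- ((2 * l) *: damped z1 t) - h t| = 2 * l * `|damped (z1 - z0) t|.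
    move=> tT; rewrite hE// opprK addrC -scalerBr normrZ ger0_norm ?mulr_ge0//.
    by rewrite distrC dampedB.
  have cd : continuous (fun t => 2 * l * `|damped (z1 - z0) t|).
    move=> t; apply: cvgM; first exact: cvg_cst.
    exact: (continuous_normr_fun (@damped_continuous (z1 - z0))).
  have id : itgb 0 T (fun t => `|- ((2 * l) *: damped z1 t) - h t|).
    by apply: eq_itgb (itgb_continuous 0 T cd) => t tT; rewrite eqd.
  rewrite integral_itg// lte_fin (eq_itg eqd).
  apply: (@le_lt_trans _ _ (2 * l * (M * `|z1 - z0|) * (T - 0))).
    apply: le_trans (ler_norm _) _; apply: norm_itg_le; [exact: ltW|exact: itgb_continuous|].
    move=> t /andP[t0 tT]; rewrite ger0_norm ?mulr_ge0//.
    apply: ler_wpM2l; first by rewrite mulr_ge0.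
    by apply: hM; rewrite !ltW.
  move: z1K; rewrite ltr_pdivlMr//; apply: le_lt_trans.
  have -> : 2 * l * (M * `|z1 - z0|) * (T - 0) = `|z1 - z0| * (2 * l * M * T) by ring.
  by apply: ler_wpM2l => //; rewrite lerDl.
have := hd z1 _ Lg z1d dist.
have aeE := E3 z1 _ _ D1 cg (damped_dual_solution T z1).
have LB : L2 0 T (Bs \o damped z1).
  apply: L2_continuous; apply: (control_adjoint_continuous hS hA hB) => //.
    by move=> t; have [] := damped_dom t D1.
  have -> : A' \o damped z1 = damped (A' z1).
    by apply/funext => t; exact: (damped_dom t D1).2.
  exact: damped_continuous.
move=> hlt; split => //.
have [_ iBw] := L2B LB Lw.
have LE1 := (Lp_class2P _ _).1 (E1 z1 _ Lg); have LE0 := (Lp_class2P _ _).1 (E1 z0 h Lh).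
have [_ iE] := L2B LE1 LE0.
rewrite -lte_fin -(integral_itg iBw); apply: le_lt_trans hlt.
rewrite le_eqVlt; apply/orP; left; apply/eqP.
apply: ge0_ae_eq_integral; [exact: measurable_itv|..].
- by apply/measurable_EFinP; exact: itgb_measurable iBw.
- by apply/measurable_EFinP; exact: itgb_measurable iE.
- by move=> t _; rewrite lee_fin sqr_ge0.
- by move=> t _; rewrite lee_fin sqr_ge0.
have [N1 [mN1 N10 sN1]] := aeE; have [N2 [mN2 N20 sN2]] := wE.
exists (N1 `|` N2); split; first exact: measurableU.
  exact: etrans (measureU0 mN1 mN2 N20) N10.
move=> t /= nt; apply: contrapT => /not_orP[n1 n2]; apply: nt => tT.
have e1 : E z1 (rhs (damped z1)) t = Bs (damped z1 t).
  by apply: contrapT => c; apply: n1; apply: sN1 => /= /(_ tT).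
have e2 : w t = E z0 h t by apply: contrapT => c; apply: n2; apply: sN2 => /= /(_ tT).
by rewrite e1 e2.
Qed.

(** Limit of [regular_weak_form] along [trace_value_limit]. *)
Lemma trace_weak_form (T : R) E z0 h w psi phi : 0 < T -> trace_extension S A B T E ->
  Lp_class 1 T h -> L2 0 T w -> (forall t, 0 < t < T -> h t = - ((2 * l) *: damped z0 t)) ->
  {ae mu, forall t, t \in `]0, T[ -> w t = E z0 h t} ->
  test_function T psi -> dom A' phi -> weak_form T psi phi (damped z0) w = 0.
Proof.
move=> T0 hE Lh Lw hz wE tpsi Dphi; have [cpsi cpsi'] := test_function_continuous tpsi.
have [K K0 hK] := damped_weak_form_bound phi T0 tpsi.
have cp : continuous (fun t => psi t *: Bs phi).
  by move=> t; apply: cvgZ; [exact: cpsi|exact: cvg_cst].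
have Lp := L2_continuous 0 T cp; set P2 := sqn 0 T (fun t => psi t *: Bs phi).
have P20 : 0 <= P2 by exact: sqn_ge0.
have cst (v : H) : continuous (fun _ : R => v) by move=> t; exact: cvg_cst.
have cQ x : continuous (fun t => Q (damped x t)).
  by move=> t; exact: (bounded_operator_cvg bQ (@damped_continuous x t)).
have iQ' x : itgb 0 T (fun t => derive1 psi t * ip (Q (damped x t)) phi).
  apply: itgb_continuous => t; apply: cvgM; first exact: cpsi'.
  exact: (continuous_ip (cQ x) (cst phi)).
have iQ x : itgb 0 T (fun t => psi t * ip (Q (damped x t)) (A' phi)).
  apply: itgb_continuous => t; apply: cvgM; first exact: cpsi.
  exact: (continuous_ip (cQ x) (cst (A' phi))).
have split_form x v : L2 0 T v -> weak_form T psi phi (damped x) v =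
    (itg 0 T (fun t => derive1 psi t * ip (Q (damped x t)) phi) +
     itg 0 T (fun t => psi t * ip (Q (damped x t)) (A' phi))) -
    itg 0 T (fun t => ip (v t) (psi t *: Bs phi)).
  move=> Lv; rewrite -addrA -itgB//; last exact: L2_ip.
  by congr (_ + _); apply: eq_itg => t _; rewrite ipZr mulrBr.
apply/eqP; rewrite -normr_le0; apply/ler_addgt0Pr => eps eps0; rewrite add0r.
pose e := eps / 2 / (K + P2 + 1).
have S0 : 0 < K + P2 + 1 by rewrite ltr_wpDl// addr_ge0// ltW.
have e0 : 0 < e by rewrite divr_gt0// divr_gt0.
have eS : e * (K + P2 + 1) = eps / 2 by rewrite /e divfK// gt_eqF.
have e_le r : r <= K + P2 + 1 -> e * r <= eps / 2.
  by move=> rS; rewrite -eS; apply: ler_wpM2l => //; exact: ltW.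
have eK : K * e <= eps / 2.
  by rewrite mulrC; apply: e_le; rewrite -addrA lerDl addr_ge0.
have eP : e * P2 <= eps / 2.
  by apply: e_le; rewrite addrAC lerDr addr_ge0// ltW.
have eP1 : e <= eps / 2.
  by rewrite -[e]mulr1; apply: e_le; rewrite lerDr addr_ge0// ltW.
have [z1 [D1 z1z LB sB]] := trace_value_limit T0 hE Lh Lw hz wE e0.
have r1 := regular_weak_form T0 tpsi Dphi D1.
have e1 := split_form z0 w Lw; have e2 := split_form z1 _ LB.
rewrite -[weak_form _ _ _ _ _]subr0 -r1 e1 e2.
set a := itg _ _ _; set b := itg _ _ _; set c := itg _ _ _.
set a' := itg _ _ _; set b' := itg _ _ _; set c' := itg _ _ _.
have -> : a + b - c - (a' + b' - c') = (c' - c) - ((a' - a) + (b' - b)) by ring.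
have h1 : `|(a' - a) + (b' - b)| <= K * `|z1 - z0|.
  rewrite /a /a' /b /b' -!itgB//; apply: le_trans (hK (z1 - z0)).
  rewrite le_eqVlt; apply/orP; left; apply/eqP; congr `|_ + _|; apply: eq_itg => t _;
    have [kQ _] := bQ; rewrite dampedB klinearB// ipBl mulrBr//.
have h2 : `|c' - c| <= eps / 2.
  have LBw := L2B LB Lw.
  have -> : c' - c = itg 0 T (fun t => ip (Bs (damped z1 t) - w t) (psi t *: Bs phi)).
    rewrite /c /c' -itgB; [|exact: L2_ip|exact: L2_ip].
    by apply: eq_itg => t _; rewrite ipBl.
  rewrite -(@ler_pXn2r _ 2)// ?nnegrE ?divr_ge0 ?(ltW eps0)//.
  rewrite real_normK ?num_real//; apply: le_trans (L2_CS LBw Lp) _.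
  rewrite -/P2; apply: le_trans (ler_wpM2r P20 (ltW sB)) _.
  rewrite expr2 -mulrA [(eps / 2) ^+ 2]expr2; apply: ler_pM.
  - exact: ltW.
  - by rewrite mulr_ge0// ltW.
  - exact: eP1.
  - exact: eP.
apply: le_trans (ler_normB _ _) _.
have h3 : K * `|z1 - z0| <= eps / 2.
  by apply: le_trans eK; rewrite ler_pM2l// ltW.
by rewrite [eps]splitr; apply: lerD => //; exact: le_trans h1 h3.
Qed.

(** Imaginary parts are obtained from real parts by testing with i phi. *)
Lemma trace_weak_solution (T : R) E z0 h w : 0 < T -> trace_extension S A B T E ->
  Lp_class 1 T h -> L2 0 T w -> (forall t, 0 < t < T -> h t = - ((2 * l) *: damped z0 t)) ->
  {ae mu, forall t, t \in `]0, T[ -> w t = E z0 h t} ->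
  weak_solution A B T (fun t => - w t) (Q z0) (Q \o damped z0).
Proof.
move=> T0 hE Lh Lw hz wE; split.
- by apply/Lp_class2P; exact: L2N.
- apply: continuous_within_itv => t.
  exact: (bounded_operator_cvg bQ (@damped_continuous z0 t)).
- by rewrite /= damped0.
move=> phi psi Dphi tpsi.
have wf phi' : dom A' phi' -> itg 0 T (fun t => derive1 psi t * ip (Q (damped z0 t)) phi') =
   - itg 0 T (fun t => psi t * (ip (Q (damped z0 t)) (A' phi') + ip (- w t) (Bs phi'))).
  move=> D'; apply/eqP; rewrite -addr_eq0; apply/eqP.
  rewrite -[RHS](trace_weak_form T0 hE Lh Lw hz wE tpsi D'); congr (_ + _).
  by apply: eq_itg => t _; rewrite ipNl.
have [Di Ai] := generator_act sS' gS' (@imaginary_unit R k) Dphi.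
have Bi : Bs (act (@imaginary_unit R k) phi) = act (@imaginary_unit R k) (Bs phi).
  have := control_adjoint_linear hS hA hB (@imaginary_unit R k) Dphi (generator0 sS' gS').
  by rewrite (control_adjoint0 hS hA hB) !addr0.
have opp_of (a b : R) : - scalar_of k a b = scalar_of k (- a) (- b) by case: k.
rewrite /scalar_integral opp_of; apply: scalar_of_inj.
- rewrite -[LHS]/(itg 0 T _) -[X in - X]/(itg 0 T _).
  have := wf phi Dphi; congr (_ = - _); apply: eq_itg => t _; rewrite scalar_ReZ//.
  by rewrite scalar_ReD.
- rewrite -[LHS]/(itg 0 T _) -[X in - X]/(itg 0 T _).
  have := wf _ Di; congr (_ = - _); apply: eq_itg => t _; rewrite scalar_ImZ ?Im_inner//.
  by rewrite scalar_ImD !Im_inner Ai Bi.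
Qed.

End WeakSolution.
End ClosedLoop.

(** * Rapid stabilization *)

Theorem proposition2p3 (R : realType) (k : scalar_kind) (H U : hilbertType R k)
    (S : R -> H -> H) (A : operator H) (B : U -> H -> scalar_field R k)
    (hS : strongly_continuous_group S) (hA : generator S A)
    (hB : bounded_to_dual (adjoint A) B) (hadm : admissible S A B)
    (hctrl : exists2 T : R, 0 < T & exactly_controllable A B T) :
  rapidly_stabilizable S A B.
Proof.
move=> nu nu0; have sS' := adjoint_strongly_continuous hS hA.
have [M [w [M1 w0 growth]]] := group_growth sS'.
(* l > w makes the Gramian converge, and 2 l - w >= nu is the decay rate. *)
pose l := w + nu; have wl : w < l by rewrite ltrDl.
have l0 : 0 <= l by rewrite addr_ge0// ltW.
have [C0 C00 trace1] := admissible_trace hS hA hB hadm ltr01.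
have [Q [bQ sQ hQ]] := gramian_exists hS hA hB M1 w0 wl C00 growth trace1.
have lyap := gramian_lyapunov hS hA hB M1 w0 wl C00 growth trace1 bQ hQ.
have [T T0 ctrl] := hctrl.
have [C1 C10 obs] := observability hS hA hB T0 ctrl.
have pQ : positive_operator Q := gramian_positive hS hA hB w0 wl bQ hQ T0 C10 obs.
have [Qinv [bQi QK QiK]] := positive_operator_inverse bQ sQ pQ.
have [q q0 hq] := bounded_operator_bound bQ.
have [qi qi0 hqi] := bounded_operator_bound bQi.
have M0 : 0 < M by apply: lt_le_trans M1.
have b0 : bounded_operator (fun _ : H => 0 : H).
  apply: (@klinear_bounded_operator _ _ _ _ _ 0) => [a x y|x].
    by rewrite act0 addr0.
  by rewrite normr0 mul0r.
have bid : bounded_operator (id : U -> U).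
  by apply: (@klinear_bounded_operator _ _ _ _ _ 1) => // x; rewrite mul1r.
exists l, Q, Qinv, (fun=> 0), id, (q * M * qi); split.
- by split => //; apply: symmetric_ip => //; case: bQ.
- by [].
- split => // [|x].
    by apply: symmetric_ip; [case: b0|move=> x y; rewrite ip0l ip0r].
  by rewrite -/(ip _ _) ip0l.
- split => // x; rewrite -/(ip _ _) ip_norm; exact: sqr_ge0.
split => [|y0]; first by rewrite !mulr_gt0.
have rhsE (z : R -> H) : (fun t => - ((2 * l) *: z t) - 0) = (fun t => - ((2 * l) *: z t)).
  by apply/funext => t; rewrite subr0.
split; last first.
  move=> y z [z00 hz hw] t t0.
  (* The horizon t + 1 is positive even if t = 0. *)
  have T1 : 0 < t + 1 by rewrite ltr_wpDl.
  have tT : 0 <= t <= t + 1 by rewrite t0 lerDl ler01.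
  have := hz _ T1; rewrite /= rhsE => hz'.
  have zE := damped_unique hS hA (ltW T1) hz'.
  have [v [Lh /Lp_class2P Lv [E hE vE]] wy] := hw _ T1.
  have hE' s : 0 < s < t + 1 -> - ((2 * l) *: z s) - 0 = - ((2 * l) *: damped S l (Qinv y0) s).
    by move=> /andP[s0 s1]; rewrite subr0 zE// !ltW.
  have wQ := trace_weak_solution hS hA hB l0 bQ lyap T1 hE Lh Lv hE' vE.
  rewrite QiK in wQ.
  have yE := weak_solution_unique hS hA hB wy wQ tT; rewrite /= in yE.
  rewrite zE//; split; first by rewrite yE QK.
  rewrite yE; apply: le_trans (hq _) _.
  rewrite /damped normrZ ger0_norm ?expR_ge0//.
  have g := growth (- t) (Qinv y0); rewrite normrN ger0_norm// in g.
  have e : expR (- (2 * l) * t) * expR (w * t) <= expR (- nu * t).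
    rewrite -expRD ler_expR -mulrDl; apply: ler_wpM2r => //.
    by rewrite /l; lra.
  have -> : q * M * qi * expR (- nu * t) * `|y0| = q * (expR (- nu * t) * M * (qi * `|y0|)).
    by ring.
  rewrite ler_pM2l//.
  apply: (@le_trans _ _ (expR (- (2 * l) * t) * (M * expR (w * t) * `|Qinv y0|))).
    by apply: ler_wpM2l => //; exact: expR_ge0.
  have -> : expR (- (2 * l) * t) * (M * expR (w * t) * `|Qinv y0|) =
    expR (- (2 * l) * t) * expR (w * t) * M * `|Qinv y0| by ring.
  apply: ler_pM => //; first by rewrite !mulr_ge0 ?expR_ge0// ltW.
  by rewrite ler_pM2r.
exists (Q \o damped S l (Qinv y0)), (damped S l (Qinv y0)).
have cz := @damped_continuous _ _ _ _ _ hS hA l (Qinv y0).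
split.
- by rewrite (damped0 hS hA).
- move=> T' _; rewrite /= rhsE; exact: damped_dual_solution hS hA _ _ _.
move=> T' T'0; rewrite /= rhsE.
have lyap' phi : dom (adjoint A) phi -> ip (Q (adjoint A phi)) phi +
    ip (Q phi) (adjoint A phi) + 2 * l * ip (Q phi) phi =
    ip (control_adjoint B phi) (control_adjoint B phi) by move=> D; exact: lyap.
have [C2 C20 bound] := mild_trace_bound hS hA hB (ltW T'0) bQ sQ lyap'.
have [E hE] := trace_extension_exists hS hA hB T'0 C20 bound.
have Lh : Lp_class 1 T' (fun t => - ((2 * l) *: damped S l (Qinv y0) t)).
  have ch : continuous (fun t => - ((2 * l) *: damped S l (Qinv y0) t)).
    by move=> t; apply: cvgN; exact: cvgZr (cz t).
  apply/Lp_class1P; split; first exact: sm_continuous.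
  by apply: itgb_continuous; exact: continuous_normr_fun.
have [hE1 _ _] := hE; have Lw := hE1 (Qinv y0) _ Lh.
exists (E (Qinv y0) (fun t => - ((2 * l) *: damped S l (Qinv y0) t))).
  split => //; exists E => //.
  by exists set0; split => // t; apply.
have /Lp_class2P Lw' := Lw.
have aeE : {ae lebesgue_measure, forall t, t \in `]0, T'[ ->
    E (Qinv y0) (fun t => - ((2 * l) *: damped S l (Qinv y0) t)) t =
    E (Qinv y0) (fun t => - ((2 * l) *: damped S l (Qinv y0) t)) t}.
  by exists set0; split => // t; apply.
have := trace_weak_solution hS hA hB l0 bQ lyap T'0 hE Lh Lw' (fun _ _ => erefl) aeE.
by rewrite QiK.
Qed.
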